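(* Let $\Omega\subset\mathbb R^3$ be a bounded Lipschitz domain with connected complement, $\Gamma$ an open subset of $\partial\Omega$, $k>0$, and let $v,w\in H^1(\Omega)$ be a pair of conductive transmission eigenfunctions associated with $k$, i.e. a nontrivial pair satisfying $$\Delta w+k^2 q w=0\ \text{ in }\Omega,\qquad \Delta v+k^2 v=0\ \text{ in }\Omega,\qquad w=v,\ \ \partial_\nu w=\partial_\nu v+\eta v\ \text{ on }\Gamma .$$ Assume that $\mathbf 0\in\Gamma$ and that $\Omega$ contains a cuboid corner $\Omega\cap B_h=\mathcal K\cap B_h=\mathcal K^h$ such that $v\in C^\alpha(\overline{\mathcal K^h})$, $q\in H^2(\overline{\mathcal K^h})$ and $\eta\in C^\alpha(\overline{\Gamma_h})$ for some $0<\alpha<1$. If $\eta(\mathbf 0)\neq0$, then $v(\mathbf 0)=0$.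
   Context: $q=1+V$ with $V\in L^\infty(\Omega)$ complex-valued; $\eta\in L^\infty(\partial\Omega)$ is complex-valued; $\nu$ is the exterior unit normal to $\partial\Omega$. $B_h$ is the open ball of radius $h>0$ centered at the origin. $\mathcal K$ is the cuboid cone with apex $\mathbf 0$ and edges along $\mathbf e_1=(1,0,0)^\top$, $\mathbf e_2=(0,1,0)^\top$, $\mathbf e_3=(0,0,1)^\top$, i.e. the open octant $\{x_1,x_2,x_3>0\}$; $\mathcal K^h=\mathcal K\cap B_h$ and $\Gamma_h=\partial\mathcal K\cap B_h$. *)

(* Defs.v *)
From HB Require Import structures.
From mathcomp Require Import all_boot all_order all_algebra.
From mathcomp Require Import complex.
From mathcomp Require Import all_classical all_reals all_analysis.
Set Implicit Arguments.
Unset Strict Implicit.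
Unset Printing Implicit Defensive.
Import Order.TTheory GRing.Theory Num.Theory.
Import numFieldNormedType.Exports.
Import ComplexField.Normc.
Local Open Scope classical_set_scope.
Local Open Scope complex_scope.
Local Open Scope ring_scope.

(* Euclidean 3-space is the product R * R * R, so that the product topology,
   the product sigma-algebra and the iterated product measure of the library
   apply.  The library norm on it is the sup norm; [enorm] is the Euclidean
   one. *)
Notation E3 R := (R * R * R)%type.

Section Geometry.
Context {R : realType}.

Definition coord (i : 'I_3) (x : E3 R) : R :=
  match val i with 0 => x.1.1 | 1 => x.1.2 | _ => x.2 end.

Definition vece (i : 'I_3) : E3 R :=
  ((val i == 0)%:R, (val i == 1)%:R, (val i == 2)%:R).

Definition dot (x y : E3 R) : R := \sum_(i < 3) coord i x * coord i y.
Definition enorm (x : E3 R) : R := Num.sqrt (dot x x).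

Definition eball (h : R) : set (E3 R) := [set x | enorm x < h].

Definition bdry (A : set (E3 R)) : set (E3 R) := closure A `\` A°.

Definition octant : set (E3 R) := [set x | forall i, 0 < coord i x].

Definition octant_trunc (h : R) : set (E3 R) := octant `&` eball h.

Definition octant_faces (h : R) : set (E3 R) := bdry octant `&` eball h.

(* Near each boundary point x, and in Cartesian coordinates with orthonormal
   frame (a, b, n) centred at x, Omega is the strict epigraph of a Lipschitz
   function. *)
Definition lipschitz_domain (Omega : set (E3 R)) : Prop :=
  [/\ open Omega, connected Omega, Omega !=set0 &
    forall x, bdry Omega x ->
      exists (a b n : E3 R) (r : R) (g : R * R -> R),
        [/\ [/\ dot a a = 1, dot b b = 1 & dot n n = 1],
            [/\ dot a b = 0, dot a n = 0 & dot b n = 0],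
            0 < r, lipschitz g &
            forall y, enorm (y - x) < r ->
              (Omega y <-> g (dot (y - x) a, dot (y - x) b) < dot (y - x) n)]].

End Geometry.

Section Measures.
Context {R : realType}.

(* [measurableTypeR R] is R with its Borel sigma-algebra, on which the
   library's Lebesgue measure lives. *)
Definition leb3 : {measure set (E3 (measurableTypeR R)) -> \bar R} :=
  ((@lebesgue_measure R \x @lebesgue_measure R) \x @lebesgue_measure R)%E.

Local Open Scope ereal_scope.

Definition diam (C : set (E3 R)) : \bar R :=
  ereal_sup (0 |` [set (enorm (p.1 - p.2))%:E | p in C `*` C]).

Definition haus_weight (d : R) (C : set (E3 R)) : \bar R :=
  if diam C <= d%:E then (pi / 4)%:E * (diam C * diam C) else +oo.

(* Two-dimensional Hausdorff outer measure, normalised to agree with area.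
   [mu_ext] takes the infimum of the sums of weights over countable covers by
   Borel sets (a set and its closure have the same diameter, so this is no
   restriction); sets of diameter larger than d have weight +oo and are thus
   excluded from the covers. *)
Definition hausdorff2 (A : set (E3 R)) : \bar R :=
  ereal_sup [set mu_ext (haus_weight d) A | d in [set d : R | (0 < d)%R]].

Lemma diam_ge0 C : 0 <= diam C.
Proof. by apply: ereal_sup_ubound; left. Qed.

Lemma diam0 : diam set0 = 0.
Proof.
rewrite /diam (_ : 0 |` _ = [set 0]) ?ereal_sup1//.
apply/seteqP; split=> [y [->//|[p [[]]]]|y ->]; by left.
Qed.

Lemma haus_weight0 d : (0 < d)%R -> haus_weight d set0 = 0.
Proof. by move=> d0; rewrite /haus_weight diam0 lee_fin ltW// !mule0. Qed.

Lemma haus_weight_ge0 d C : 0 <= haus_weight d C.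
Proof.
rewrite /haus_weight; case: ifP => // _.
by rewrite !mule_ge0 ?diam_ge0// lee_fin divr_ge0// pi_ge0.
Qed.

Let hausdorff2_set0 : hausdorff2 set0 = 0.
Proof.
rewrite /hausdorff2 (_ : image _ _ = [set 0]) ?ereal_sup1//.
apply/seteqP; split=> [y [d d0 <-]|y ->].
  by rewrite mu_ext0//; [exact: haus_weight0|exact: haus_weight_ge0].
by exists 1%R => //=; rewrite mu_ext0//;
  [exact: haus_weight0|exact: haus_weight_ge0].
Qed.

Let hausdorff2_ge0 A : 0 <= hausdorff2 A.
Proof.
apply: (@le_trans _ _ (mu_ext (haus_weight 1) A)).
  by apply: mu_ext_ge0 => *; exact: haus_weight_ge0.
by apply: ereal_sup_ubound; exists 1%R => //=.
Qed.

Let le_hausdorff2 : {homo hausdorff2 : A B / A `<=` B >-> A <= B}.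
Proof.
move=> A B AB; apply: ge_ereal_sup => y [d d0 <-].
apply: (@le_trans _ _ (mu_ext (haus_weight d) B)); first exact: le_mu_ext.
by apply: ereal_sup_ubound; exists d.
Qed.

Let hausdorff2_sigma_subadditive : sigma_subadditive hausdorff2.
Proof.
move=> F; apply: ge_ereal_sup => y [d d0 <-].
apply: (@le_trans _ _ (\sum_(i <oo) mu_ext (haus_weight d) (F i))).
  by apply: mu_ext_sigma_subadditive => *; rewrite ?haus_weight0//;
     exact: haus_weight_ge0.
apply: lee_nneseries => i _ *.
  by apply: mu_ext_ge0 => *; exact: haus_weight_ge0.
by apply: ereal_sup_ubound; exists d.
Qed.

HB.instance Definition _ := isOuterMeasure.Build R (E3 R) hausdorff2
  hausdorff2_set0 hausdorff2_ge0 le_hausdorff2 hausdorff2_sigma_subadditive.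

Definition haus_outer : {outer_measure set (E3 R) -> \bar R} := hausdorff2.

(* Surface measure; its measurable sets are the Caratheodory-measurable ones,
   which include the Borel sets. *)
Definition surf : {measure set (caratheodory_type haus_outer) -> \bar R} :=
  (haus_outer : set (caratheodory_type haus_outer) -> \bar R).

End Measures.
Arguments leb3 {R}.
Arguments surf {R}.

Section ComplexFunctions.
Context {R : realType} {d : measure_display} {T : measurableType d}.
Variable mu : {measure set T -> \bar R}.
Implicit Types (D : set T) (f : T -> R[i]).

Definition cmeasurable D f : Prop :=
  measurable_fun D (fun x => complex.Re (f x)) /\
  measurable_fun D (fun x => complex.Im (f x)).

Definition cintegral D f : R[i] :=
  (\int[mu]_(x in D) complex.Re (f x))%R +i*
  (\int[mu]_(x in D) complex.Im (f x))%R.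

Definition sqL2 D f : \bar R :=
  (\int[mu]_(x in D) (normc (f x) ^+ 2)%:E)%E.

Definition L2 D f : Prop := cmeasurable D f /\ (sqL2 D f < +oo)%E.

Definition Linf D f : Prop :=
  cmeasurable D f /\
  exists M : R, {ae mu, forall x, D x -> normc (f x) <= M}.

End ComplexFunctions.

(* Elements of L^2, L^oo and Sobolev spaces are represented by functions on the
   whole of E3, of which only the values almost everywhere on the relevant set
   matter; test functions are real-valued and the pairings bilinear. *)
Section Sobolev.
Context {R : realType}.
Implicit Types (U : set (E3 R)) (f g u : E3 R -> R[i]) (phi : E3 R -> R).

Definition partial (i : 'I_3) phi : E3 R -> R := fun x => 'D_(vece i) phi x.
Definition partials (s : seq 'I_3) phi : E3 R -> R := foldr partial phi s.

Definition smooth phi : Prop :=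
  forall s : seq 'I_3, continuous (partials s phi) /\
    forall i x, derivable (partials s phi) x (vece i).

Definition laplacian phi : E3 R -> R :=
  fun x => \sum_(i < 3) partials [:: i; i] phi x.

Definition test_fun U phi : Prop :=
  smooth phi /\
  exists K : set (E3 R), [/\ compact K, K `<=` U & forall x, ~ K x -> phi x = 0].

Definition csmooth u : Prop :=
  smooth (fun x => complex.Re (u x)) /\ smooth (fun x => complex.Im (u x)).

Definition cpartial (i : 'I_3) u : E3 R -> R[i] := fun x =>
  partial i (fun y => complex.Re (u y)) x +i*
  partial i (fun y => complex.Im (u y)) x.

Definition weak_partial U (i : 'I_3) f g : Prop :=
  forall phi, test_fun U phi ->
    cintegral leb3 U (fun x => f x * (partial i phi x)%:C) =
    - cintegral leb3 U (fun x => g x * (phi x)%:C).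

(* Delta f = g in U in the sense of distributions. *)
Definition weak_laplacian U f g : Prop :=
  forall phi, test_fun U phi ->
    cintegral leb3 U (fun x => f x * (laplacian phi x)%:C) =
    cintegral leb3 U (fun x => g x * (phi x)%:C).

(* f belongs to H^m(U) = W^{m,2}(U). *)
Fixpoint sobolev (m : nat) U f : Prop :=
  L2 leb3 U f /\
  if m is m'.+1 then
    forall i, exists g, weak_partial U i f g /\ sobolev m' U g
  else True.

Definition weak_gradient U f (G : 'I_3 -> E3 R -> R[i]) : Prop :=
  forall i, L2 leb3 U (G i) /\ weak_partial U i f (G i).

(* This constrains f pointwise on A: applied to an element of a Sobolev or
   Lebesgue space, it says that f is its Hoelder continuous representative. *)
Definition holder (alpha : R) (A : set (E3 R)) f : Prop :=
  exists C : R, forall x y, A x -> A y ->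
    normc (f x - f y) <= C * enorm (x - y) `^ alpha.

(* g is the trace on the boundary of Omega of u in H^1(Omega): the map
   u |-> u restricted to the boundary, defined for smooth u, is extended by
   continuity from H^1(Omega) to L^2(bdry Omega). *)
Definition is_trace (Omega : set (E3 R)) u g : Prop :=
  L2 surf (bdry Omega) g /\
  exists (G : 'I_3 -> E3 R -> R[i]) (un : nat -> E3 R -> R[i]),
    [/\ weak_gradient Omega u G,
        forall n, csmooth (un n),
        (fun n => sqL2 leb3 Omega (fun x => un n x - u x)) @ \oo --> 0%E,
        forall i, (fun n => sqL2 leb3 Omega
          (fun x => cpartial i (un n) x - G i x)) @ \oo --> 0%E &
        (fun n => sqL2 surf (bdry Omega) (fun x => un n x - g x)) @ \oo
          --> 0%E].

(* Test functions for distributions on a relatively open part Gamma of the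
   boundary: smooth functions whose (compact) support meets the boundary only
   in Gamma.  They need not vanish inside Omega. *)
Definition bdry_test_fun (Omega Gamma : set (E3 R)) phi : Prop :=
  test_fun (~` (bdry Omega `\` Gamma)) phi.

(* N is the normal derivative on Gamma of u in H^1(Omega) with Laplacian in
   L^2(Omega), as the functional given by Green's formula
   <d_nu u, phi> = \int_Omega (grad u . grad phi + (Delta u) phi). *)
Definition is_normal_derivative (Omega Gamma : set (E3 R)) u
    (N : (E3 R -> R) -> R[i]) : Prop :=
  exists (G : 'I_3 -> E3 R -> R[i]) (L : E3 R -> R[i]),
    [/\ weak_gradient Omega u G, L2 leb3 Omega L, weak_laplacian Omega u L &
      forall phi, bdry_test_fun Omega Gamma phi ->
        N phi = cintegral leb3 Omega (fun x =>
          (\sum_(i < 3) G i x * (partial i phi x)%:C) + L x * (phi x)%:C)].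

Definition conductive_transmission_eigenfunctions
    (Omega Gamma : set (E3 R)) (k : R) (q eta v w : E3 R -> R[i]) : Prop :=
  [/\ (sobolev 1 Omega v /\ sobolev 1 Omega w) /\
      ~ ({ae leb3, forall x, Omega x -> v x = 0} /\
         {ae leb3, forall x, Omega x -> w x = 0}),
      weak_laplacian Omega w (fun x => - ((k ^+ 2)%:C * q x * w x)),
      weak_laplacian Omega v (fun x => - ((k ^+ 2)%:C * v x)) &
      exists (tv tw : E3 R -> R[i]) (Nv Nw : (E3 R -> R) -> R[i]),
        [/\ is_trace Omega v tv /\ is_trace Omega w tw,
            is_normal_derivative Omega Gamma v Nv /\
            is_normal_derivative Omega Gamma w Nw,
            {ae surf, forall x, Gamma x -> tw x = tv x} &
            forall phi, bdry_test_fun Omega Gamma phi ->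
              Nw phi = Nv phi +
                cintegral surf Gamma (fun x => eta x * tv x * (phi x)%:C)]].

End Sobolev.

(* Main.v *)
(* Put u = w - v. Near the corner, with phi the harmonic exponential
   exp (- s (x1 + x2 + 4 x3)) cos (3 s (x1 - x2)) times a cut-off, Green's
   formula turns the transmission conditions into
     int_Gamma eta v phi = int (- u Lap phi - k^2 (q w - v) phi).
   On the faces x1 = 0 and x2 = 0 the integral of phi has size s^-2 and on
   x3 = 0 it is nonnegative, so the left-hand side is eta(0) v(0) times at
   least c s^-2, up to an error controlled by the oscillation of eta and of
   the trace of v. On the right, Lap phi is exponentially small, and the
   Poincare-type bound int u^2 exp (- s (x1 + x2 + x3)) = O(s^-2), which holds
   because u has zero trace, makes the other term o(s^-2). The trace of v is
   only known as an L^2 limit; its oscillation is estimated by an integration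
   by parts against a weight that decays at the rate s^3 in the normal
   direction. Letting s tend to infinity and then the size of the corner to 0
   gives eta(0) v(0) = 0. *)
Require Import Defs.
From HB Require Import structures.
From mathcomp Require Import all_boot all_order all_algebra.
From mathcomp Require Import complex.
From mathcomp Require Import all_classical all_reals all_analysis.
From mathcomp Require Import measurable_realfun ring lra.
Import Order.TTheory GRing.Theory Num.Theory.
Import numFieldNormedType.Exports.
Local Open Scope classical_set_scope.
Local Open Scope complex_scope.
Local Open Scope ring_scope.
Set Implicit Arguments.
Unset Strict Implicit.
Unset Printing Implicit Defensive.
(* [vector.coord] would otherwise shadow [Defs.coord]. *)
Import Defs.

(** * Borel sets and integration over boxes *)

Section measurable_continuous.
Context {R : realType}.
Notation mR := (measurableTypeR R).

(** The exponent is the complex null vector (1 - 3i, 1 + 3i, 4): the squares -8 - 6i, -8 + 6i and 16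
    cancel, which is harmonicity, and all real parts are positive, which gives decay in the octant.
    Conjugate first and second entries make the integral over x3 = 0 a squared modulus, so that no
    face can cancel another, whatever positive factors the faces carry. This matters because surface
    measure is defined by Hausdorff covers: on each coordinate plane it is identified, through
    translation invariance, with a positive finite multiple of Lebesgue measure, and the multiple is
    never evaluated. Test functions are real and the eigenfunctions complex, so every identity is
    used for real and imaginary parts separately. The order of choices is rigid. A tolerance e fixes
    the box, small enough for v and eta to vary by at most e on it; then s grows with the cut-off
    held fixed; the smooth functions approximating v and w are chosen last, with an accuracy that
    depends on s. *)

Definition countable_base (T : topologicalType) (M : set (set T)) :=
  exists B : nat -> set T, (forall n, M (B n)) /\
    forall x U, nbhs x U -> exists n, B n x /\ B n `<=` U.

Lemma countable_base_real :
  @countable_base R (fun A => measurable (A : set mR)).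
Proof.
exists (fun n => if unpickle n is Some (a, b)
  then `](ratr a : R), (ratr b : R)[%classic else set0 : set R).
split=> [n|x U /nbhs_ballP[e /= e0 xU]].
  by case: unpickle => [[a b]|]; [exact: measurable_itv|exact: measurable0].
have [a] : exists q : rat, ratr q \in `]x - e, x[ by apply: rat_in_itvoo; lra.
have [b] : exists q : rat, ratr q \in `]x, x + e[ by apply: rat_in_itvoo; lra.
rewrite !in_itv/= => /andP[b1 b2] /andP[a1 a2].
exists (pickle (a, b)); rewrite pickleK; split; rewrite /= ?in_itv/= ?a2 ?b1//.
move=> y /=; rewrite in_itv/= => /andP[ya yb]; apply: xU.
by rewrite /ball/= ltr_norml; apply/andP; split; lra.
Qed.

Lemma countable_base_prod (T1 T2 : topologicalType) M1 M2
    (M : set (set (T1 * T2))) :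
  (forall A B, M1 A -> M2 B -> M (A `*` B)) -> M set0 ->
  @countable_base T1 M1 -> @countable_base T2 M2 ->
  @countable_base (T1 * T2)%type M.
Proof.
move=> MX M0 [B1 [mB1 B1P]] [B2 [mB2 B2P]].
exists (fun n => if unpickle n is Some (a, b) then B1 a `*` B2 b else set0).
split=> [n|[x y] U [[/= U1 U2] [/= xU1 yU2] U12]].
  by case: unpickle => [[a b]|]; [exact: MX|].
have [a [xa aU]] := B1P _ _ xU1; have [b [yb bU]] := B2P _ _ yU2.
exists (pickle (a, b)); rewrite pickleK; split=> // z [za zb].
by apply: U12; split; [exact: aU|exact: bU].
Qed.

(** An open set is the union of the base sets that it contains, and these are countably many. With
    the product base of rational intervals this links the product topology of [E3 R] to its product
    sigma-algebra. *)
Lemma open_countable_base (T : topologicalType) (M : set (set T)) :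
  (forall F : nat -> set T, (forall n, M (F n)) -> M (\bigcup_n F n)) ->
  M set0 -> countable_base M -> forall A, open A -> M A.
Proof.
move=> MU M0 [B [mB BP]] A oA.
rewrite (_ : A = \bigcup_n (if `[< B n `<=` A >] then B n else set0)).
  by apply: MU => n; case: ifP.
apply/seteqP; split=> [x Ax|x [n _]].
  have [n [xB BA]] := BP x A (open_nbhs_nbhs (conj oA Ax)).
  by exists n => //; rewrite asboolT.
by case: ifPn => // /asboolP; apply.
Qed.

Notation mR2 := (mR * mR)%type.
Notation mE3 := (E3 mR).

Lemma open_measurable2 (A : set (R * R)) : open A -> measurable (A : set mR2).
Proof.
apply: (open_countable_base (M := fun A => measurable (A : set mR2))) => //.
  by move=> F mF; exact: bigcup_measurable.
apply: countable_base_prod countable_base_real countable_base_real => //.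
by move=> X Y; exact: measurableX.
Qed.

Lemma open_measurable3 (A : set (E3 R)) : open A -> measurable (A : set mE3).
Proof.
apply: (open_countable_base (M := fun A => measurable (A : set mE3))) => //.
  by move=> F mF; exact: bigcup_measurable.
apply: (@countable_base_prod _ _ (fun A => measurable (A : set mR2))) _ _ _
  countable_base_real => //.
  by move=> X Y; exact: measurableX.
apply: countable_base_prod countable_base_real countable_base_real => //.
by move=> X Y; exact: measurableX.
Qed.

Lemma closed_measurable3 (A : set (E3 R)) :
  closed A -> measurable (A : set mE3).
Proof.
by move=> cA; rewrite -(setCK A); apply: measurableC; apply: open_measurable3;
  exact: closed_openC.
Qed.

(** The map [i] joins two structures on one carrier, the measurable and the topological one; it is
    instantiated with the identity. *)
Lemma continuous_measurable (d : measure_display) (T : measurableType d)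
    (T' : topologicalType) (i : T -> T') (f : T' -> R) :
  (forall A, open A -> measurable (i @^-1` A)) ->
  continuous f -> measurable_fun setT (f \o i).
Proof.
move=> oM cf; apply: (measurability _ (RGenOpens.measurableE R)).
move=> _ [_ [a [b ->] <-]]; rewrite setTI comp_preimage; apply: oM.
by apply: open_comp => // x _; exact: cf.
Qed.

Lemma continuous_measurable1 (f : R -> R) :
  continuous f -> measurable_fun setT (f : mR -> R).
Proof. exact: continuous_measurable_fun. Qed.

Lemma continuous_measurable2 (f : R * R -> R) :
  continuous f -> measurable_fun setT (f : mR2 -> R).
Proof.
by move=> cf; apply: (@continuous_measurable _ mR2 _ id f) cf => A; exact: open_measurable2.
Qed.

Lemma continuous_measurable3 (f : E3 R -> R) :
  continuous f -> measurable_fun setT (f : mE3 -> R).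
Proof.
by move=> cf; apply: (@continuous_measurable _ mE3 _ id f) cf => A; exact: open_measurable3.
Qed.

End measurable_continuous.

Section Rintegral_fubini.
Context d1 d2 (T1 : measurableType d1) (T2 : measurableType d2) (R : realType).
Variables (m1 : {sigma_finite_measure set T1 -> \bar R})
  (m2 : {sigma_finite_measure set T2 -> \bar R}).
Variables (A : set T1) (B : set T2) (f : T1 * T2 -> R).
Hypotheses (mA : measurable A) (mB : measurable B).
Hypothesis intf : (m1 \x m2)%E.-integrable (A `*` B) (EFin \o f).

Let mAB : measurable (A `*` B). Proof. exact: measurableX. Qed.
Let intF : (m1 \x m2)%E.-integrable setT ((EFin \o f) \_ (A `*` B)).
Proof. exact: (integrable_mkcond _ mAB).1. Qed.

(** [fine] is taken slice by slice, which is faithful only where the slice integral is finite. Joint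
    integrability gives this merely almost everywhere, hence the assumption on every slice. *)
Lemma Rintegral_setX1 :
  (forall x, A x -> m2.-integrable B (fun y => (f (x, y))%:E)) ->
  (\int[(m1 \x m2)%E]_(z in A `*` B) f z =
   \int[m1]_(x in A) \int[m2]_(y in B) f (x, y))%R.
Proof.
move=> fB; rewrite /Rintegral; congr fine.
rewrite integral_mkcond -integral12_prod_meas1// [RHS]integral_mkcond.
apply: eq_integral => x _; rewrite /fubini_F patchE; case: ifPn => xA.
  rewrite fineK; last by apply: integrable_fin_num => //; apply: fB; rewrite -inE.
  rewrite [RHS]integral_mkcond; apply: eq_integral => y _.
  by rewrite !patchE in_setX xA.
by apply: integral0_eq => y _; rewrite patchE in_setX (negbTE xA).
Qed.

Lemma Rintegral_setX2 :
  (forall y, B y -> m1.-integrable A (fun x => (f (x, y))%:E)) ->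
  (\int[(m1 \x m2)%E]_(z in A `*` B) f z =
   \int[m2]_(y in B) \int[m1]_(x in A) f (x, y))%R.
Proof.
move=> fA; rewrite /Rintegral; congr fine.
rewrite integral_mkcond -integral21_prod_meas1// [RHS]integral_mkcond.
apply: eq_integral => y _; rewrite /fubini_G patchE; case: ifPn => yB.
  rewrite fineK; last by apply: integrable_fin_num => //; apply: fA; rewrite -inE.
  rewrite [RHS]integral_mkcond; apply: eq_integral => x _.
  by rewrite !patchE in_setX yB andbT.
by apply: integral0_eq => x _; rewrite patchE in_setX (negbTE yB) andbF.
Qed.

End Rintegral_fubini.

(** * Boxes in the octant: Fubini and the fundamental theorem of calculus *)

Section box.
Context {R : realType}.
Notation mR := (measurableTypeR R).
Notation mR2 := (mR * mR)%type.
Notation mE3 := (E3 mR).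
Notation mu := (@lebesgue_measure R).

(** A named copy of the product measure, to which a sigma-finite structure is attached so that it
    can serve as a factor in Fubini's theorem for [leb3]. *)
Definition leb2 : set mR2 -> \bar R := (mu \x mu)%E.

HB.instance Definition _ := Measure.on leb2.

Let leb2_sigma_finite : sigma_finite setT leb2.
Proof.
have /sigma_finiteP[F [TF ndF Foo]] := sigma_finiteT mu.
exists (fun n => F n `*` F n).
  rewrite -setXTT TF predeqE => -[x y]; split.
    move=> [/= [n _ Fnx] [k _ Gky]]; exists (maxn n k) => //; split.
    - by move: x Fnx; exact/subsetPset/ndF/leq_maxl.
    - by move: y Gky; exact/subsetPset/ndF/leq_maxr.
  by move=> [n _ []/= ? ?]; split; exists n.
move=> k; have [? ?] := Foo k; split; first exact: measurableX.
by rewrite [leb2 _]product_measure1E// lte_mul_pinfty// ge0_fin_numE.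
Qed.

HB.instance Definition _ := Measure_isSigmaFinite.Build _ _ _ leb2
  leb2_sigma_finite.

Lemma integral_leb3E (D : set mE3) (f : mE3 -> \bar R) :
  (\int[leb3]_(x in D) f x = \int[leb2 \x mu]_(x in D) f x)%E.
Proof. by apply: eq_measure_integral. Qed.

Lemma integrable_leb3E (D : set mE3) (f : mE3 -> \bar R) :
  leb3.-integrable D f <-> (leb2 \x mu)%E.-integrable D f.
Proof.
by split=> /integrableP[mf foo]; apply/integrableP; split => //; move: foo;
  rewrite integral_leb3E.
Qed.

Definition insert (i : 'I_3) (p : R * R) : E3 R :=
  match val i with
  | 0 => (0, p.1, p.2) | 1 => (p.1, 0, p.2) | _ => (p.1, p.2, 0)
  end.

(** Leaving out 0 puts the box inside the open octant and keeps the three faces disjoint and off the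
    coordinate axes. *)
Definition sq (r : R) : set (R * R) := `]0, r] `*` `]0, r].
Definition box (r : R) : set (E3 R) := sq r `*` `]0, r].

Lemma measurable_sq r : measurable (sq r : set mR2).
Proof. by apply: measurableX; exact: measurable_itv. Qed.

Lemma measurable_box r : measurable (box r : set mE3).
Proof. by apply: measurableX; [exact: measurable_sq|exact: measurable_itv]. Qed.

Lemma boxP r x : box r x <-> forall i, 0 < coord i x <= r.
Proof.
rewrite /box /sq/= !in_itv/=; split=> [[[x1 x2] x3] i|xr].
  by rewrite /coord; case: i => [[|[|[|//]]] ?].
by split; [split; [exact: (xr (@Ordinal 3 0 isT))|exact: (xr (@Ordinal 3 1 isT))]|exact: (xr (@Ordinal 3 2 isT))].
Qed.

Let itv_fin (r : R) : (mu (`]0%R, r]%classic : set mR) < +oo)%E.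
Proof. by rewrite lebesgue_measure_itv/=; case: ifPn => // _; rewrite -EFinB ltry. Qed.

Lemma leb2_sq_fin r : (leb2 (sq r) < +oo)%E.
Proof.
by rewrite [leb2 _]product_measure1E//; apply: lte_mul_pinfty => //;
  rewrite ?ge0_fin_numE//; exact: itv_fin.
Qed.

Lemma leb3_box_fin r : (leb3 (box r : set mE3) < +oo)%E.
Proof.
rewrite [leb3 _]product_measure1E//; last exact: measurable_sq.
by apply: lte_mul_pinfty => //; rewrite ?ge0_fin_numE//;
  [exact: leb2_sq_fin|exact: itv_fin].
Qed.

Lemma continuous_bounded_on (T : topologicalType) (K A : set T) (f : T -> R) :
  continuous f -> compact K -> A `<=` K -> [bounded f x | x in A].
Proof.
move=> cf cK AK; have : compact (f @` K).
  by apply: continuous_compact => //; exact: continuous_subspaceT.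
move=> /compact_bounded[M [Mr MP]]; exists M; split=> // y My x Ax.
by apply: MP => //; exists x => //; exact: AK.
Qed.

Let itvS (r : R) : `]0, r]%classic `<=` (`[0, r]%classic : set R).
Proof. by move=> x/=; rewrite !in_itv/= => /andP[/ltW -> ->]. Qed.

Lemma continuous_integrable_itv (f : R -> R) r : continuous f ->
  mu.-integrable `]0, r] (EFin \o f).
Proof.
move=> cf; apply: measurable_bounded_integrable => //; first exact: itv_fin.
  by apply: (@measurable_funTS _ _ mR _ _ f); exact: continuous_measurable1.
exact: continuous_bounded_on cf (@segment_compact _ 0 r) (@itvS r).
Qed.

Lemma continuous_integrable_sq (f : R * R -> R) r : continuous f ->
  leb2.-integrable (sq r) (EFin \o f).
Proof.
move=> cf; apply: measurable_bounded_integrable.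
- exact: measurable_sq.
- exact: leb2_sq_fin.
- by apply: (@measurable_funTS _ _ mR2 _ _ f); exact: continuous_measurable2.
- apply: continuous_bounded_on cf (compact_setX (@segment_compact _ 0 r) (@segment_compact _ 0 r)) _.
  by move=> x [? ?]; split; exact: itvS.
Qed.

Lemma continuous_integrable_box (f : E3 R -> R) r : continuous f ->
  leb3.-integrable (box r : set mE3) (EFin \o f).
Proof.
move=> cf; apply: measurable_bounded_integrable.
- exact: measurable_box.
- exact: leb3_box_fin.
- by apply: (@measurable_funTS _ _ mE3 _ _ f); exact: continuous_measurable3.
- apply: continuous_bounded_on cf (compact_setX (compact_setX
    (@segment_compact _ 0 r) (@segment_compact _ 0 r)) (@segment_compact _ 0 r)) _.
  by move=> x [[? ?] ?]; split; [split|]; exact: itvS.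
Qed.

Lemma continuous_pair (T U V : topologicalType) (f : T -> U) (g : T -> V) :
  continuous f -> continuous g -> continuous (fun x => (f x, g x)).
Proof. by move=> cf cg x; exact: cvg_pair (cf x) (cg x). Qed.

Lemma continuous_compT (T U V : topologicalType) (f : T -> U) (g : U -> V) :
  continuous f -> continuous g -> continuous (fun x => g (f x)).
Proof. by move=> cf cg x; exact: (continuous_comp (cf x) (cg (f x))). Qed.

Lemma continuous_fst (U V : topologicalType) : continuous (@fst U V).
Proof. by move=> x; exact: cvg_fst. Qed.

Lemma continuous_snd (U V : topologicalType) : continuous (@snd U V).
Proof. by move=> x; exact: cvg_snd. Qed.

Lemma continuous_insert i : continuous (insert i : R * R -> E3 R).
Proof.
rewrite /insert; case: i => [[|[|m]] ?] /=;
  do 2?apply: continuous_pair; by [exact: cst_continuous|exact: continuous_fst|exact: continuous_snd].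
Qed.

Lemma coordD i (x y : E3 R) : coord i (x + y) = coord i x + coord i y.
Proof. by rewrite /coord; case: i => [[|[|m]] ?]. Qed.

Lemma coordZ i (a : R) (x : E3 R) : coord i (a *: x) = a * coord i x.
Proof. by rewrite /coord; case: i => [[|[|m]] ?]. Qed.

Lemma coord_vece i j : coord i (vece j) = (i == j)%:R :> R.
Proof. by case: i j => [[|[|[|//]]] ?] [[|[|[|//]]] ?]. Qed.

Lemma continuous_coord i : continuous (coord i : E3 R -> R).
Proof.
have c1 : continuous (fst : E3 R -> R * R) by exact: continuous_fst.
rewrite /coord; case: i => [[|[|m]] ?] /= x; last exact: cvg_snd.
- by apply: (continuous_comp (c1 x)); exact: cvg_fst.
- by apply: (continuous_comp (c1 x)); exact: cvg_snd.
Qed.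

Lemma derive1_slice (f : E3 R -> R) i x (t : R) :
  derivable f (x + t *: vece i) (vece i) ->
  is_derive t 1 (fun t => f (x + t *: vece i)) (partial i f (x + t *: vece i)).
Proof.
have E : (fun h : R => h^-1 *: (((fun t => f (x + t *: vece i)) \o shift t) h%:A
      - f (x + t *: vece i))) =
    (fun h => h^-1 *: ((f \o shift (x + t *: vece i)) (h *: vece i)
      - f (x + t *: vece i))).
  apply/funext => h /=; congr (_ *: (f _ - _)).
  by rewrite /GRing.scale/= mulr1 addrCA -scalerDl.
by move=> df; split; [rewrite /derivable E|rewrite /partial /derive E].
Qed.

Lemma continuous_line (x : E3 R) (e : E3 R) : continuous (fun t : R => x + t *: e).
Proof.
move=> t; apply: cvgD; first exact: cvg_cst.
by apply: cvgZr_tmp; exact: cvg_id.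
Qed.

Lemma Rintegral_derive (F f : R -> R) r : 0 < r -> continuous f ->
  (forall t : R, is_derive t 1 F (f t)) ->
  \int[mu]_(t in `]0, r]) f t = F r - F 0.
Proof.
move=> r0 cf dF.
have cF : continuous F.
  move=> t; apply: differentiable_continuous; apply/derivable1_diffP.
  by case: (dF t).
rewrite Rintegral_itv_obnd_cbnd; last exact: continuous_integrable_itv.
have dLR : derivable_oo_LRcontinuous F 0 r.
  split; first by move=> t _; case: (dF t).
  + by apply: cvg_at_right_filter; exact: cF.
  + by apply: cvg_at_left_filter; exact: cF.
have dE : {in `]0, r[, F^`()%classic =1 f}.
  by move=> t _; rewrite derive1E; case: (dF t).
by rewrite /Rintegral (continuous_FTC2 r0 (continuous_subspaceT cf) dLR dE).
Qed.

Lemma ftc_slice (f : E3 R -> R) i (x : E3 R) r : 0 < r ->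
  (forall x, derivable f x (vece i)) -> continuous (partial i f) ->
  \int[mu]_(t in `]0, r]) partial i f (x + t *: vece i) =
  f (x + r *: vece i) - f x.
Proof.
move=> r0 df cpf; pose F (t : R) : R := f (x + t *: vece i).
have cF : continuous (fun t : R => partial i f (x + t *: vece i)).
  exact: (@continuous_compT R (E3 R) R (fun t => x + t *: vece i) _ (@continuous_line x (vece i)) cpf).
have dF (t : R) : is_derive t 1 F (partial i f (x + t *: vece i)) by exact: derive1_slice.
by rewrite (Rintegral_derive r0 cF dF) /F scale0r addr0.
Qed.

Lemma continuous_curryl (U V : topologicalType) (g : U * V -> R) u :
  continuous g -> continuous (fun v => g (u, v)).
Proof.
move=> cg; apply: (continuous_compT _ cg).
by apply: continuous_pair => ?; [exact: cvg_cst|exact: cvg_id].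
Qed.

Lemma continuous_curryr (U V : topologicalType) (g : U * V -> R) v :
  continuous g -> continuous (fun u => g (u, v)).
Proof.
move=> cg; apply: (continuous_compT _ cg).
by apply: continuous_pair => ?; [exact: cvg_id|exact: cvg_cst].
Qed.

Lemma Rintegral_sq1 (g : R * R -> R) r : continuous g ->
  \int[leb2]_(x in sq r) g x =
  \int[mu]_(a in `]0, r]) \int[mu]_(b in `]0, r]) g (a, b).
Proof.
move=> cg; rewrite [LHS]Rintegral_setX1//; first exact: continuous_integrable_sq.
by move=> a _; apply: continuous_integrable_itv; exact: continuous_curryl.
Qed.

Lemma Rintegral_sq2 (g : R * R -> R) r : continuous g ->
  \int[leb2]_(x in sq r) g x =
  \int[mu]_(b in `]0, r]) \int[mu]_(a in `]0, r]) g (a, b).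
Proof.
move=> cg; rewrite [LHS]Rintegral_setX2//; first exact: continuous_integrable_sq.
by move=> b _; apply: continuous_integrable_itv; exact: continuous_curryr.
Qed.

Lemma Rintegral_box1 (g : E3 R -> R) r : continuous g ->
  \int[leb3]_(x in box r) g x =
  \int[leb2]_(p in sq r) \int[mu]_(c in `]0, r]) g (p, c).
Proof.
move=> cg; rewrite [LHS]/Rintegral integral_leb3E.
apply: (@Rintegral_setX1 _ _ _ _ _ leb2 mu).
- exact: measurable_sq.
- exact: measurable_itv.
- exact/integrable_leb3E/continuous_integrable_box.
- by move=> p _; apply: continuous_integrable_itv; exact: continuous_curryl.
Qed.

Lemma Rintegral_box2 (g : E3 R -> R) r : continuous g ->
  \int[leb3]_(x in box r) g x =
  \int[mu]_(c in `]0, r]) \int[leb2]_(p in sq r) g (p, c).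
Proof.
move=> cg; rewrite [LHS]/Rintegral integral_leb3E.
apply: (@Rintegral_setX2 _ _ _ _ _ leb2 mu).
- exact: measurable_sq.
- exact: measurable_itv.
- exact/integrable_leb3E/continuous_integrable_box.
- by move=> c _; apply: continuous_integrable_sq; exact: continuous_curryr.
Qed.

Let eq_int d (T : measurableType d) (m : {measure set T -> \bar R}) (D : set T)
  (f g : T -> R) : (forall x, D x -> f x = g x) ->
  \int[m]_(x in D) f x = \int[m]_(x in D) g x.
Proof. by move=> fg; apply: eq_Rintegral => x; rewrite inE => /fg. Qed.

Let RintegralN d (T : measurableType d) (m : {measure set T -> \bar R}) (D : set T)
  (f : T -> R) : measurable D -> m.-integrable D (EFin \o f) ->
  \int[m]_(x in D) (- f x) = - \int[m]_(x in D) f x.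
Proof.
move=> mD intf; rewrite -mulN1r -RintegralZl//; apply: eq_int => x _.
by rewrite mulN1r.
Qed.

(** Integrate first along direction i: the far end contributes nothing because f vanishes there, and
    the near end gives minus the value on the coordinate plane. *)
Lemma Rintegral_partial_box (f : E3 R -> R) i r : 0 < r ->
  continuous f -> (forall x, derivable f x (vece i)) ->
  continuous (partial i f) -> (forall x, coord i x = r -> f x = 0) ->
  \int[leb3]_(x in box r) partial i f x = - \int[leb2]_(p in sq r) f (insert i p).
Proof.
move=> r0 cf df cpf f0.
have ftc p : \int[mu]_(t in `]0, r]) partial i f (insert i p + t *: vece i)
    = - f (insert i p).
  rewrite ftc_slice// f0 ?sub0r// coordD coordZ coord_vece eqxx mulr1.
  by rewrite /insert /coord; case: (i) => [[|[|m]] ?]; rewrite /= add0r.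
have cfi : continuous (f \o insert i).
  by apply: (continuous_compT _ cf); exact: continuous_insert.
rewrite -RintegralN//; [|exact: measurable_sq|exact: continuous_integrable_sq].
have cfN : continuous (fun p => - f (insert i p)).
  by move=> p; apply: cvgN; exact: cfi.
move: ftc cfN {cfi}; case: (i) cpf => [[|[|[|//]]] ilt] cpf ftc cfN.
- rewrite Rintegral_box2// [RHS]Rintegral_sq2//; apply: eq_int => c _.
  rewrite Rintegral_sq2; last exact: continuous_curryr.
  apply: eq_int => b _; rewrite -ftc; apply: eq_int => a _.
  by congr (partial _ f _); rewrite /insert/= /vece/=; congr (_, _, _);
    rewrite /= /GRing.scale/= ?mulr0 ?mulr1 ?addr0 ?add0r.
- rewrite Rintegral_box2// [RHS]Rintegral_sq2//; apply: eq_int => c _.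
  rewrite Rintegral_sq1; last exact: continuous_curryr.
  apply: eq_int => a _; rewrite -ftc; apply: eq_int => b _.
  by congr (partial _ f _); rewrite /insert/= /vece/=; congr (_, _, _);
    rewrite /= /GRing.scale/= ?mulr0 ?mulr1 ?addr0 ?add0r.
- rewrite Rintegral_box1//; apply: eq_int => -[a b] _; rewrite -ftc.
  apply: eq_int => c _.
  by congr (partial _ f _); rewrite /insert/= /vece/=; congr (_, _, _);
    rewrite /= /GRing.scale/= ?mulr0 ?mulr1 ?addr0 ?add0r.
Qed.

Lemma Rintegral_sq_prod (a b : R -> R) r : continuous a -> continuous b ->
  \int[leb2]_(p in sq r) (a p.1 * b p.2) =
  (\int[mu]_(t in `]0, r]) a t) * \int[mu]_(t in `]0, r]) b t.
Proof.
move=> ca cb; rewrite Rintegral_sq1/=; last first.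
  move=> p; apply: cvgM; [exact: continuous_compT (@continuous_fst _ _) ca p|].
  exact: continuous_compT (@continuous_snd _ _) cb p.
rewrite -RintegralZr//; last exact: continuous_integrable_itv.
by apply: eq_int => x _; rewrite RintegralZl//; exact: continuous_integrable_itv.
Qed.

Lemma Rintegral_box_prod (a b c : R -> R) r :
  continuous a -> continuous b -> continuous c ->
  \int[leb3]_(x in box r) (a x.1.1 * b x.1.2 * c x.2) =
  (\int[mu]_(t in `]0, r]) a t) * (\int[mu]_(t in `]0, r]) b t)
  * \int[mu]_(t in `]0, r]) c t.
Proof.
move=> ca cb cc.
have cab : continuous (fun p : R * R => a p.1 * b p.2).
  move=> p; apply: cvgM; [exact: continuous_compT (@continuous_fst _ _) ca p|].
  exact: continuous_compT (@continuous_snd _ _) cb p.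
rewrite Rintegral_box1/=; last first.
  move=> p; apply: cvgM; [exact: continuous_compT (@continuous_fst _ _) cab p|].
  exact: continuous_compT (@continuous_snd _ _) cc p.
rewrite -Rintegral_sq_prod// -RintegralZr//.
- by apply: eq_int => x _; rewrite RintegralZl//; exact: continuous_integrable_itv.
- exact: measurable_sq.
- exact: continuous_integrable_sq.
Qed.

End box.

(** * Smooth functions and cut-offs *)

Section smooth1.
Context {R : realType}.
Implicit Types (f g : R -> R).

Definition has_deriv f g := forall t : R, is_derive t 1 f (g t).

(* Coinductive characterisation of C^oo: membership in a class closed under
   differentiation. *)
Definition deriv_closed (C : (R -> R) -> Prop) :=
  forall f, C f -> exists2 g, C g & has_deriv f g.

Definition smooth1 f := exists2 C, deriv_closed C & C f.

Lemma smooth1_deriv : deriv_closed smooth1.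
Proof.
move=> f [C CC Cf]; have [g Cg fg] := CC f Cf.
by exists g => //; exists C.
Qed.

Lemma has_deriv_continuous f g : has_deriv f g -> continuous f.
Proof.
move=> fg t; apply: differentiable_continuous; apply/derivable1_diffP.
by case: (fg t).
Qed.

Lemma smooth1_continuous f : smooth1 f -> continuous f.
Proof. by move=> /smooth1_deriv[g _ /has_deriv_continuous]. Qed.

Lemma has_derivD f f' g g' : has_deriv f f' -> has_deriv g g' ->
  has_deriv (fun t => f t + g t) (fun t => f' t + g' t).
Proof. by move=> ff gg t; have := ff t; have := gg t => ? ?; exact: is_deriveD. Qed.

Lemma has_derivM f f' g g' : has_deriv f f' -> has_deriv g g' ->
  has_deriv (fun t => f t * g t) (fun t => f t * g' t + g t * f' t).
Proof. by move=> ff gg t; have := ff t; have := gg t => ? ?; exact: is_deriveM. Qed.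

Lemma has_deriv_comp f f' g g' : has_deriv f f' -> has_deriv g g' ->
  has_deriv (fun t => f (g t)) (fun t => f' (g t) * g' t).
Proof. by move=> ff gg t; apply: is_derive1_comp; [exact: ff|exact: gg]. Qed.

(** By the Leibniz rule this algebra is stable under differentiation as soon as the derivatives of
    its generators lie in it, so smoothness of a compound expression reduces to a check on
    generators. *)
Inductive algebra_of (T : Type) (S : (T -> R) -> Prop) : (T -> R) -> Prop :=
| algebra_in (f : T -> R) of S f : algebra_of S f
| algebraD (f g : T -> R) of algebra_of S f & algebra_of S g :
    algebra_of S (fun t => f t + g t)
| algebraM (f g : T -> R) of algebra_of S f & algebra_of S g :
    algebra_of S (fun t => f t * g t).

Lemma deriv_closed_algebra (S : (R -> R) -> Prop) :
  (forall f, S f -> exists2 g, algebra_of S g & has_deriv f g) ->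
  deriv_closed (algebra_of S).
Proof.
move=> SS h; elim=> {h} [f /SS//|f g _ [f' Sf' ff'] _ [g' Sg' gg']|].
  by exists (fun t => f' t + g' t); [exact: algebraD|exact: has_derivD].
move=> f g Sf [f' Sf' ff'] Sg [g' Sg' gg'].
exists (fun t => f t * g' t + g t * f' t); last exact: has_derivM.
by apply: algebraD; apply: algebraM.
Qed.

Lemma smooth1_algebra f : algebra_of smooth1 f -> smooth1 f.
Proof.
move=> Sf; exists (algebra_of smooth1) => //; apply: deriv_closed_algebra.
by move=> g /smooth1_deriv[g' ? ?]; exists g' => //; exact: algebra_in.
Qed.

Lemma smooth1D f g : smooth1 f -> smooth1 g -> smooth1 (fun t => f t + g t).
Proof. by move=> sf sg; apply/smooth1_algebra/algebraD; exact: algebra_in. Qed.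

Lemma smooth1M f g : smooth1 f -> smooth1 g -> smooth1 (fun t => f t * g t).
Proof. by move=> sf sg; apply/smooth1_algebra/algebraM; exact: algebra_in. Qed.

(** The chain rule leaves the class of composites with g, but not the algebra generated by these
    composites and the smooth functions. *)
Lemma smooth1_comp f g : smooth1 f -> smooth1 g -> smooth1 (fun t => f (g t)).
Proof.
move=> sf sg; pose S h := smooth1 h \/ exists2 k, smooth1 k & h = (fun t => k (g t)).
exists (algebra_of S); last by apply: algebra_in; right; exists f.
apply: deriv_closed_algebra => h [/smooth1_deriv[h' sh' hh']|[k]].
  by exists h' => //; apply: algebra_in; left.
move=> /smooth1_deriv[k' sk' kk'] ->; have [g' sg' gg'] := smooth1_deriv sg.
exists (fun t => k' (g t) * g' t); last exact: has_deriv_comp.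
by apply: algebraM; apply: algebra_in; [right; exists k'|left].
Qed.

Lemma has_deriv_affine (a b : R) : has_deriv (fun t => a * t + b) (fun=> a).
Proof.
move=> t; rewrite -[a in is_derive _ _ _ a]addr0; apply: is_deriveD.
have := is_deriveM (is_derive_cst a t 1) (is_derive_id t 1).
by rewrite scaler0 addr0 /GRing.scale/= mulr1.
Qed.

Lemma smooth1_affine (a b : R) : smooth1 (fun t => a * t + b).
Proof.
exists (fun f => exists a b, f = (fun t => a * t + b)); last by exists a, b.
move=> f [{}a [{}b ->]]; exists (fun t => 0 * t + a); first by exists 0, a.
have -> : (fun t => 0 * t + a) = (fun=> a).
  by apply/funext => t; rewrite mul0r add0r.
exact: has_deriv_affine.
Qed.

Lemma smooth1_cst (a : R) : smooth1 (fun=> a).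
Proof.
rewrite (_ : (fun _ => _) = (fun t => 0 * t + a)); first exact: smooth1_affine.
by apply/funext => t; rewrite mul0r add0r.
Qed.

Lemma smooth1_expR : smooth1 expR.
Proof.
by exists (eq expR) => // _ <-; exists expR => // t; exact: is_derive_expR.
Qed.

Lemma smooth1_cos_sin : smooth1 cos /\ smooth1 sin.
Proof.
pose C f := exists a b : R, f = (fun t => a * cos t + b * sin t).
have dC : deriv_closed C.
  move=> _ [a [b ->]]; exists (fun t => b * cos t + (- a) * sin t).
    by exists b, (- a).
  move=> t; rewrite addrC mulNr -mulrN; apply: is_deriveD.
by split; exists C => //; [exists 1, 0|exists 0, 1]; apply/funext => t;
  rewrite mul1r mul0r ?addr0 ?add0r.
Qed.

End smooth1.

(** * Flat functions and smooth cut-offs of one variable *)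

Section flat.
Context {R : realType}.

(** [flat 0] is the classical function exp (-1/t) extended by 0. Differentiation produces powers of
    1/t, and with them the family is closed up to linear combinations. *)
Definition flat (n : nat) (t : R) : R :=
  if 0 < t then t^-1 ^+ n * expR (- t^-1) else 0.

Lemma flat_neg n t : t <= 0 -> flat n t = 0.
Proof. by rewrite /flat leNgt; case: ltP. Qed.

(** A single term of the exponential series, y^(n+2) / (n+2)! <= exp y at y = 1/t, beats the n+1
    powers of 1/t and leaves one factor t. *)
Lemma flat_bound n (t : R) : `|flat n.+1 t| <= (n.+2)`!%:R * `|t|.
Proof.
rewrite /flat; case: ltP => [t0|_]; last by rewrite normr0 mulr_ge0.
have y0 : 0 < t^-1 by rewrite invr_gt0.
rewrite ger0_norm; last by rewrite mulr_ge0 ?expR_ge0// exprn_ge0// ltW.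
rewrite (gtr0_norm t0) expRN ler_pdivrMr ?expR_gt0//.
have F0 : 0 < (n.+2)`!%:R :> R by rewrite ltr0n fact_gt0.
have H := expR_ge1Dxn n.+1 (ltW y0).
apply: (@le_trans _ _ ((n.+2)`!%:R * t * (t^-1 ^+ n.+2 / (n.+2)`!%:R))).
  rewrite (exprS _ n.+1) le_eqVlt; apply/orP; left; apply/eqP.
  by field; rewrite !lt0r_neq0.
by rewrite ler_pM2l ?mulr_gt0//; apply: le_trans H; rewrite lerDr.
Qed.

Lemma is_derive_flat n (t : R) :
  is_derive t 1 (flat n) (flat n.+2 t - n%:R * flat n.+1 t).
Proof.
have [t0|t0|<-] := ltgtP 0 t.
- have tn0 : t != 0 by rewrite gt_eqF.
  suff H : is_derive t 1 (fun s : R => s^-1 ^+ n * expR (- s^-1) : R)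
      (flat n.+2 t - n%:R * flat n.+1 t).
    apply: near_eq_is_derive H; near=> s; rewrite /flat ifT//.
    by near: s; exact: lt_nbhsr.
  have dV : is_derive t 1 (fun s : R => s^-1 : R) (- t ^- 2).
    have := @is_deriveV _ id t 1 1 tn0 (is_derive_id t 1).
    by rewrite /GRing.scale/= mulr1.
  have dX := is_deriveX n dV.
  have dE : is_derive t 1 (fun s : R => expR (- s^-1) : R) (expR (- t^-1) * (t ^- 2)).
    apply: is_derive1_comp.
    by have := is_deriveN dV; rewrite opprK.
  have := is_deriveM dX dE.
  rewrite exprfctE mulrfctE /flat t0 /GRing.scale/=.
  set E := expR (- t^-1); set u := t^-1.
  rewrite -!exprVn -/u.
  rewrite (_ : u ^+ n * _ + _ = u ^+ n.+2 * E - n%:R * (u ^+ n.+1 * E)) //.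
  case: n dX => [|n] _; first by rewrite mul0r; ring.
  by rewrite /= !exprS; ring.
- rewrite !flat_neg ?ltW// mulr0 subr0.
  apply: near_eq_is_derive (is_derive_cst (0 : R) t 1).
  near=> s; rewrite flat_neg//= ltW//; near: s; exact: lt_nbhsl.
- rewrite !flat_neg// mulr0 subr0.
  have H : h^-1 *: ((flat n \o shift 0) h%:A - flat n 0) @[h --> 0^'] --> (0 : R).
    apply/cvgr0Pnorm_le => e e0.
    have F0 : 0 < (n.+2)`!%:R :> R by rewrite ltr0n fact_gt0.
    near=> h.
    have h0 : h != 0 by near: h; exact: nbhs_dnbhs_neq.
    rewrite /= addr0 /GRing.scale/= mulr1 (flat_neg n (lexx 0)) subr0.
    (* The difference quotient at 0 is the next member of the family, which [flat_bound] sends to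
       0. *)
    have -> : h^-1 * flat n h = flat n.+1 h.
      by rewrite /flat; case: ifP => _; rewrite ?mulr0// exprS mulrA.
    rewrite (le_trans (flat_bound _ _))// -ler_pdivlMl//.
    near: h; apply: dnbhs0_le; by rewrite mulr_gt0// invr_gt0.
  by split; [apply/cvg_ex; exists 0|apply: cvg_lim].
Unshelve. all: by end_near. Qed.

Lemma smooth1_flat n : smooth1 (flat n).
Proof.
pose S f := (exists a, f = fun=> a) \/ exists n, f = flat n.
exists (algebra_of S); last by apply: algebra_in; right; exists n.
apply: deriv_closed_algebra => _ [[a ->]|[{}n ->]].
  exists (fun=> 0); first by apply: algebra_in; left; exists 0.
  by move=> t; exact: is_derive_cst.
exists (fun t => flat n.+2 t + (- n%:R) * flat n.+1 t); last first.
  by move=> t; rewrite mulNr; exact: is_derive_flat.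
apply: algebraD; first by apply: algebra_in; right; exists n.+2.
by apply: algebraM; apply: algebra_in; [left; exists (- n%:R)|right; exists n.+1].
Qed.

Lemma flat_ge0 n t : 0 <= flat n t.
Proof.
rewrite /flat; case: ltP => // t0; rewrite mulr_ge0 ?expR_ge0// exprn_ge0//.
by rewrite invr_ge0 ltW.
Qed.

Lemma flat0_gt0 t : 0 < t -> 0 < flat 0 t.
Proof. by move=> t0; rewrite /flat t0 mul1r expR_gt0. Qed.

Lemma flat0_le : {homo flat 0 : s t / s <= t}.
Proof.
move=> s t st; have [s0|s0] := leP s 0; first by rewrite (flat_neg _ s0) flat_ge0.
have t0 : 0 < t by exact: lt_le_trans st.
by rewrite /flat s0 t0 !mul1r ler_expR lerN2 lef_pV2// posrE.
Qed.

(** Nesting [flat 0] gives a smooth step with a constant denominator: the inner difference equals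
    [flat 0 1] for t <= 1 and is nonpositive for t >= 2. *)
Definition bump_half (t : R) : R :=
  flat 0 (flat 0 1 - flat 0 (t - 1)) / flat 0 (flat 0 1).

Definition bump (r t : R) : R :=
  bump_half (2 / r * t) * bump_half (- (2 / r * t)).

Let e0 : 0 < flat 0 1. Proof. exact: flat0_gt0. Qed.
Let ee0 : 0 < flat 0 (flat 0 1). Proof. by do 2 apply: flat0_gt0. Qed.

Lemma smooth1_bump_half : smooth1 bump_half.
Proof.
apply: smooth1M; last exact: smooth1_cst.
apply: (smooth1_comp (smooth1_flat 0)).
apply: smooth1D; first exact: smooth1_cst.
have := smooth1M (smooth1_cst (-1)) (smooth1_comp (smooth1_flat 0) (smooth1_affine 1 (-1))).
by under eq_fun do rewrite mulN1r mul1r.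
Qed.

Lemma smooth1_bump r : smooth1 (bump r).
Proof.
apply: smooth1M.
  have := smooth1_comp smooth1_bump_half (smooth1_affine (2 / r) 0).
  by under eq_fun do rewrite addr0.
have := smooth1_comp smooth1_bump_half (smooth1_affine (- (2 / r)) 0).
by under eq_fun do rewrite addr0 mulNr.
Qed.

Lemma bump_half1 t : t <= 1 -> bump_half t = 1.
Proof.
move=> t1; rewrite /bump_half (flat_neg _ (t := t - 1)) ?subr_le0// subr0.
by rewrite divff// gt_eqF.
Qed.

Lemma bump_half0 t : 2 <= t -> bump_half t = 0.
Proof.
move=> t2; rewrite /bump_half (flat_neg _ (t := _ - flat 0 (t - 1))) ?mul0r//.
by rewrite subr_le0; apply: flat0_le; lra.
Qed.

Lemma bump_half_ge0 t : 0 <= bump_half t.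
Proof. by rewrite divr_ge0// flat_ge0. Qed.

Lemma bump_half_le1 t : bump_half t <= 1.
Proof.
by rewrite ler_pdivrMr// mul1r flat0_le// gerBl flat_ge0.
Qed.

Lemma bump_ge0 r t : 0 <= bump r t.
Proof. by rewrite mulr_ge0// bump_half_ge0. Qed.

Lemma bump_le1 r t : bump r t <= 1.
Proof. by rewrite mulr_ile1 ?bump_half_ge0 ?bump_half_le1. Qed.

Lemma bump1 r t : 0 < r -> `|t| <= r / 2 -> bump r t = 1.
Proof.
move=> r0 tr; have : `|2 / r * t| <= 1.
  by rewrite normrM gtr0_norm ?divr_gt0// -ler_pdivlMl ?divr_gt0// mulr1 invf_div.
by rewrite ler_norml => /andP[t1 t2]; rewrite /bump !bump_half1 ?mulr1// lerNl.
Qed.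

Lemma bump0 r t : 0 < r -> r <= `|t| -> bump r t = 0.
Proof.
move=> r0 rt; suff : 2 <= `|2 / r * t|.
  rewrite /bump; case: ler0P => _ h; first by rewrite [X in _ * X]bump_half0 ?mulr0.
  by rewrite bump_half0 ?mul0r.
by rewrite normrM gtr0_norm ?divr_gt0// -mulrA ler_pMr// mulrC ler_pdivlMr// mul1r.
Qed.

End flat.

(** * Smooth functions of three variables *)

Section smooth3.
Context {R : realType}.
Implicit Types (f g : E3 R -> R).

Definition partial_closed (C : (E3 R -> R) -> Prop) := forall f, C f ->
  continuous f /\ forall i, (forall x, derivable f x (vece i)) /\ C (partial i f).

Lemma partial_closed_smooth C f : partial_closed C -> C f -> smooth f.
Proof.
move=> CC Cf s; suff /CC[cs ds] : C (partials s f).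
  by split=> // i x; have [] := ds i.
by elim: s => //= i s /CC[_ /(_ i)[]].
Qed.

Lemma smooth_partial i f : smooth f -> smooth (partial i f).
Proof.
by move=> sf s; have := sf (rcons s i); rewrite /partials foldr_rcons.
Qed.

Lemma smooth_partial_closed : partial_closed smooth.
Proof.
move=> f sf; have [cf df] := sf [::]; split; first exact: cf.
by move=> i; split; [exact: df|exact: smooth_partial].
Qed.

Lemma smooth_continuous f : smooth f -> continuous f.
Proof. by case/smooth_partial_closed. Qed.

Lemma smooth_derivable f i x : smooth f -> derivable f x (vece i).
Proof. by case/smooth_partial_closed => _ /(_ i)[]. Qed.

Lemma partialD f g i : (forall x, derivable f x (vece i)) ->
  (forall x, derivable g x (vece i)) ->
  partial i (fun x => f x + g x) = (fun x => partial i f x + partial i g x).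
Proof. by move=> df dg; apply/funext => x; exact: deriveD. Qed.

Lemma partialM f g i : (forall x, derivable f x (vece i)) ->
  (forall x, derivable g x (vece i)) ->
  partial i (fun x => f x * g x) =
  (fun x => f x * partial i g x + g x * partial i f x).
Proof. by move=> df dg; apply/funext => x; exact: deriveM. Qed.

Lemma partial_closed_algebra (S : (E3 R -> R) -> Prop) :
  (forall f, S f -> continuous f /\
     forall i, (forall x, derivable f x (vece i)) /\ algebra_of S (partial i f)) ->
  partial_closed (algebra_of S).
Proof.
move=> SS h; elim=> {h} [f /SS//|f g _ [cf df] _ [cg dg]|f g Sf [cf df] Sg [cg dg]].
  split=> [x|i]; first by apply: cvgD; [exact: cf|exact: cg].
  have [dif Cif] := df i; have [dig Cig] := dg i.
  split=> [x|]; first exact: derivableD.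
  by rewrite partialD//; exact: algebraD.
split=> [x|i]; first by apply: cvgM; [exact: cf|exact: cg].
have [dif Cif] := df i; have [dig Cig] := dg i.
split=> [x|]; first exact: derivableM.
by rewrite partialM//; apply: algebraD; apply: algebraM.
Qed.

Lemma smooth_algebra f : algebra_of smooth f -> smooth f.
Proof.
apply: partial_closed_smooth; apply: partial_closed_algebra => g.
move=> /smooth_partial_closed[cg dg]; split=> // i; have [? ?] := dg i.
by split=> //; exact: algebra_in.
Qed.

Lemma smoothD f g : smooth f -> smooth g -> smooth (fun x => f x + g x).
Proof. by move=> sf sg; apply/smooth_algebra/algebraD; exact: algebra_in. Qed.

Lemma smoothM f g : smooth f -> smooth g -> smooth (fun x => f x * g x).
Proof. by move=> sf sg; apply/smooth_algebra/algebraM; exact: algebra_in. Qed.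

Lemma is_derive_coord (f : R -> R) (f' : R) i j (x : E3 R) :
  is_derive (coord i x) 1 f f' ->
  is_derive x (vece j) (fun y => f (coord i y)) ((i == j)%:R * f').
Proof.
have [->|ij] := eqVneq i j; rewrite ?mul1r ?mul0r => -[df]; [move=> <-|move=> _].
  have E : (fun h : R => h^-1 *: ((f \o shift (coord j x)) h%:A - f (coord j x))) =
    (fun h : R => h^-1 *: (((fun y : E3 R => f (coord j y)) \o shift x) (h *: vece j)
      - f (coord j x))).
    apply/funext => h /=; congr (_ *: (f _ - _)).
    by rewrite coordD coordZ coord_vece eqxx.
  by split; [rewrite /derivable -E|rewrite /derive -E].
have E : (fun h : R => h^-1 *: (((fun y : E3 R => f (coord i y)) \o shift x) (h *: vece j)
      - f (coord i x))) = cst 0.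
  apply/funext => h /=.
  by rewrite coordD coordZ coord_vece (negbTE ij) mulr0 add0r subrr scaler0.
split; first by rewrite /derivable E; exact: is_cvg_cst.
by rewrite /derive E; exact: lim_cst.
Qed.

Lemma partial_lift (f f' : R -> R) i j : has_deriv f f' ->
  partial j (fun x => f (coord i x)) = (fun x => (i == j)%:R * f' (coord i x)).
Proof.
by move=> ff; apply/funext => x; apply: derive_val; apply: is_derive_coord.
Qed.

Lemma smooth_lift (f : R -> R) i : smooth1 f -> smooth (fun x => f (coord i x)).
Proof.
move=> sf; pose C g := exists2 h, smooth1 h & g = (fun x => h (coord i x)).
apply: (@partial_closed_smooth C); last by exists f.
move=> _ [g sg ->]; have [g' sg' gg'] := smooth1_deriv sg.
split; first exact: continuous_compT (@continuous_coord _ i) (smooth1_continuous sg).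
move=> j; split=> [x|]; first by case: (is_derive_coord j (gg' (coord i x))).
rewrite (partial_lift _ _ gg'); exists (fun t => (i == j)%:R * g' t) => //.
by apply: smooth1M => //; exact: smooth1_cst.
Qed.

Definition tensor (a b c : R -> R) : E3 R -> R :=
  fun x => a x.1.1 * b x.1.2 * c x.2.

Lemma smooth_tensor a b c : smooth1 a -> smooth1 b -> smooth1 c ->
  smooth (tensor a b c).
Proof.
move=> sa sb sc; apply: smoothM; first apply: smoothM.
- exact: (@smooth_lift a (@Ordinal 3 0 isT)).
- exact: (@smooth_lift b (@Ordinal 3 1 isT)).
- exact: (@smooth_lift c (@Ordinal 3 2 isT)).
Qed.

Lemma partial_tensor a b c a' b' c' i :
  has_deriv a a' -> has_deriv b b' -> has_deriv c c' ->
  partial i (tensor a b c) =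
  match val i with
  | 0 => tensor a' b c | 1 => tensor a b' c | _ => tensor a b c' end.
Proof.
move=> da db dc; apply/funext => x; apply: derive_val.
have Da : is_derive x (vece i) (fun x : E3 R => a x.1.1 : R) _ :=
  @is_derive_coord a _ (@Ordinal 3 0 isT) i x (da x.1.1).
have Db : is_derive x (vece i) (fun x : E3 R => b x.1.2 : R) _ :=
  @is_derive_coord b _ (@Ordinal 3 1 isT) i x (db x.1.2).
have Dc : is_derive x (vece i) (fun x : E3 R => c x.2 : R) _ :=
  @is_derive_coord c _ (@Ordinal 3 2 isT) i x (dc x.2).
apply: is_derive_eq (is_deriveM (is_deriveM Da Db) Dc) _.
by rewrite /GRing.scale/= mulrfctE; case: i {Da Db Dc} => [[|[|[|//]]] ?] /=;
  rewrite /eq_op/= /tensor /=; ring.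
Qed.

End smooth3.

(** * The two-dimensional Hausdorff measure on coordinate planes *)

Section euclidean_norm.
Context {R : realType}.
Implicit Types x y : E3 R.

Lemma enorm_ge0 x : 0 <= enorm x.
Proof. exact: sqrtr_ge0. Qed.

Lemma coord_le_enorm i x : `|coord i x| <= enorm x.
Proof.
rewrite -sqrtr_sqr; apply: ler_wsqrtr.
by rewrite /dot (bigD1 i)//= -expr2 lerDl; apply: sumr_ge0 => j _; rewrite -expr2 sqr_ge0.
Qed.

Lemma enorm_le_sum x : enorm x <= \sum_(i < 3) `|coord i x|.
Proof.
have S0 : 0 <= \sum_(i < 3) `|coord i x| by apply: sumr_ge0.
rewrite -(ger0_norm S0) -sqrtr_sqr; apply: ler_wsqrtr.
rewrite /dot !big_ord_recl !big_ord0 !addr0.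
set a := coord _ x; set b := coord _ x; set c := coord _ x.
rewrite -!expr2 -(real_normK (num_real a)) -(real_normK (num_real b)) -(real_normK (num_real c)).
have := normr_ge0 a; have := normr_ge0 b; have := normr_ge0 c; nra.
Qed.

Lemma coordN i x : coord i (- x) = - coord i x.
Proof. by rewrite /coord; case: i => [[|[|m]] ?]. Qed.

Lemma enorm_distC x y : enorm (x - y) = enorm (y - x).
Proof.
rewrite -opprB /enorm /dot; congr Num.sqrt; apply: eq_bigr => i _.
by rewrite coordN mulrNN.
Qed.

Lemma coordB i x y : coord i (x - y) = coord i x - coord i y.
Proof. by rewrite /coord; case: i => [[|[|m]] ?]. Qed.

End euclidean_norm.

(** * Borel sets are Caratheodory measurable for Hausdorff measure *)

Section hausdorff.
Context {R : realType}.
Local Open Scope ereal_scope.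
Implicit Types A B C : set (E3 R).
Notation H := (@hausdorff2 R).
Notation mR := (measurableTypeR R).
Notation mR2 := (mR * mR)%type.
Notation mE3 := (E3 mR).

Lemma enorm_le_diam C x y : C x -> C y -> (enorm (x - y))%:E <= diam C.
Proof. by move=> Cx Cy; apply: ereal_sup_ubound; right; exists (x, y). Qed.

Lemma haus_weight_le (d e : R) C : (d <= e)%R -> haus_weight e C <= haus_weight d C.
Proof.
move=> de; rewrite /haus_weight; case: ifPn => [Ce|Ce].
  by case: ifPn => // _; rewrite leey.
by rewrite ifF//; apply: contraNF Ce => /le_trans; apply; rewrite lee_fin.
Qed.

Lemma mu_ext_haus_weight_le (d e : R) A : (d <= e)%R ->
  mu_ext (haus_weight e) A <= mu_ext (haus_weight d) A.
Proof.
move=> de; apply: le_ereal_inf_tmp => _ [F FA <-].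
apply: (@le_trans _ _ (\sum_(k <oo) haus_weight e (F k))).
  by apply: ereal_inf_lbound; exists F.
apply: lee_nneseries => k; first by move=> *; exact: haus_weight_ge0.
by move=> _; exact: haus_weight_le.
Qed.

Lemma mu_ext_le_hausdorff2 (d : R) A : (0 < d)%R -> mu_ext (haus_weight d) A <= H A.
Proof. by move=> d0; apply: ereal_sup_ubound; exists d. Qed.

(** A covering set that meets both A and B has diameter at least e > d, hence infinite weight. A
    cover of finite total weight therefore splits into a cover of A and a cover of B. *)
Lemma mu_ext_separated (d e : R) A B : (0 < d)%R -> (d < e)%R ->
  (forall x y, A x -> B y -> (e <= enorm (x - y))%R) ->
  mu_ext (haus_weight d) A + mu_ext (haus_weight d) B <=
  mu_ext (haus_weight d) (A `|` B).
Proof.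
move=> d0 de AB; apply: le_ereal_inf_tmp => _ [F [mF FAB] <-].
pose G (D : set (E3 R)) k := if `[< F k `&` D !=set0 >] then F k else set0.
have mG D k : measurable (G D k : set mE3).
  by rewrite /G; case: ifP => // _; exact: mF.
have GD D : D `<=` A `|` B -> D `<=` \bigcup_k G D k.
  move=> DAB x Dx; have [k _ Fkx] := FAB _ (DAB _ Dx).
  by exists k => //; rewrite /G asboolT//; exists x.
have ext D : D `<=` A `|` B ->
    mu_ext (haus_weight d) D <= \sum_(k <oo) haus_weight d (G D k).
  move=> /GD DG; apply: ereal_inf_lbound; exists (G D) => //.
  by split => // k; exact: mG.
apply: (le_trans (leeD (ext A (@subsetUl _ _ _)) (ext B (@subsetUr _ _ _)))).
rewrite -nneseriesD; [|by move=> *; exact: haus_weight_ge0..].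
apply: lee_nneseries => k; first by move=> *; rewrite adde_ge0// haus_weight_ge0.
move=> _; rewrite /G.
case: asboolP => [[x [Fx Ax]]|_]; last first.
  by rewrite haus_weight0// add0e; case: ifP => // _; rewrite haus_weight0// haus_weight_ge0.
case: asboolP => [[y [Fy By]]|_]; last by rewrite haus_weight0// adde0.
rewrite {3}/haus_weight ifF ?leey//; apply/negbTE; rewrite -ltNge.
apply: lt_le_trans (enorm_le_diam Fx Fy).
by rewrite lte_fin; apply: lt_le_trans de _; exact: AB.
Qed.

Lemma hausdorff2_ge0 A : 0 <= H A.
Proof. exact: (outer_measure_ge0 haus_outer). Qed.

Lemma le_hausdorff2 A B : A `<=` B -> H A <= H B.
Proof. exact: (le_outer_measure haus_outer). Qed.

Lemma hausdorff2_separated (e : R) A B : (0 < e)%R ->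
  (forall x y, A x -> B y -> (e <= enorm (x - y))%R) ->
  H A + H B <= H (A `|` B).
Proof.
move=> e0 AB; have [->|] := eqVneq (H (A `|` B)) +oo; first by rewrite leey.
rewrite -ltey => Hoo.
have fA : H A \is a fin_num.
  by rewrite ge0_fin_numE ?hausdorff2_ge0// (le_lt_trans _ Hoo)// le_hausdorff2//; exact: subsetUl.
have fB : H B \is a fin_num.
  by rewrite ge0_fin_numE ?hausdorff2_ge0// (le_lt_trans _ Hoo)// le_hausdorff2//; exact: subsetUr.
rewrite -leeBrDr//; apply: ge_ereal_sup => _ [a /= a0 <-].
have fa : mu_ext (haus_weight a) A \is a fin_num.
  rewrite ge0_fin_numE; last by apply: mu_ext_ge0 => *; exact: haus_weight_ge0.
  by rewrite (le_lt_trans (mu_ext_le_hausdorff2 A a0))// -ge0_fin_numE ?hausdorff2_ge0.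
rewrite leeBrDr// addeC -leeBrDr//; apply: ge_ereal_sup => _ [b /= b0 <-].
rewrite leeBrDr// addeC.
(* Refining the scale only increases [mu_ext], so one scale below a, b and e serves both suprema. *)
pose d := Num.min (Num.min a b) (e / 2)%R.
have d0 : (0 < d)%R by rewrite !lt_min a0 b0 divr_gt0.
have da : (d <= a)%R by rewrite /d !ge_min lexx.
have db : (d <= b)%R by rewrite /d !ge_min lexx orbT.
have de : (d < e)%R by rewrite /d gt_min ltr_pdivrMr// ltr_pMr// ltr1n orbT.
apply: (le_trans (leeD (mu_ext_haus_weight_le A da) (mu_ext_haus_weight_le B db))).
apply: le_trans (mu_ext_le_hausdorff2 _ d0).
exact: mu_ext_separated d0 de AB.
Qed.

Lemma coord_gap_enorm i (e : R) (x y : E3 R) :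
  (coord i x + e <= coord i y -> e <= enorm (x - y))%R.
Proof.
move=> xy; apply: le_trans (coord_le_enorm i _); rewrite coordB distrC.
by apply: le_trans (ler_norm _); lra.
Qed.

(** Caratheodory's argument: two shells whose indices differ by at least 2 are at positive distance,
    so the even shells add up to at most H X, and so do the odd ones. *)
Lemma shells_summable i (X : set (E3 R)) (u : nat -> R) :
  (forall n, u n.+1 < u n)%R -> H X < +oo ->
  \sum_(k <oo) H (X `&` [set x | u k.+1 <= coord i x < u k]%R) < +oo.
Proof.
move=> du HX; pose S k := X `&` [set x | u k.+1 <= coord i x < u k]%R.
rewrite [ltLHS](_ : _ = \sum_(k <oo) H (S k))//.
have u_le m n : (m <= n)%N -> (u n <= u m)%R.
  by elim: n => [|n ih]; [rewrite leqn0 => /eqP->|rewrite leq_eqVlt => /orP[/eqP->//|/ih]; apply: le_trans; exact: ltW].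
have parity (b N : nat) : \sum_(0 <= k < N) H (S (k.*2 + b)%N) <= H X.
  (* Strengthened for the induction: the shells met so far lie in this half-space, which is at
     positive distance from the next shell of the same parity. *)
  suff HN : \sum_(0 <= k < N) H (S (k.*2 + b)%N) <=
      H (X `&` [set x | u ((N.*2 + b).-1) <= coord i x]%R).
    by apply: le_trans HN _; apply: le_hausdorff2; exact: subIsetl.
  elim: N => [|N ih]; first by rewrite big_nil hausdorff2_ge0.
  rewrite big_nat_recr//=; case: (posnP (N.*2 + b)) => [Nb|Nb].
    have N0 : N = 0%N by apply/eqP; move/eqP: Nb; rewrite addn_eq0 double_eq0 => /andP[].
    subst N; clear ih; case: b Nb => // _; rewrite big_nil add0e; apply: le_hausdorff2.
    by move=> x [Xx /= /andP[ux _]]; split.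
  set n := (N.*2 + b)%N in Nb ih *.
  rewrite -[X in _ <= X]/(H (X `&` [set x | u n.+1 <= coord i x]%R)).
  apply: le_trans (leeD ih (lexx _)) _.
  apply: le_trans (@hausdorff2_separated (u n.-1 - u n)%R _ _ _ _) _.
  - by rewrite subr_gt0; move: (du n.-1); rewrite prednK.
  - move=> x y [_ /= ux] [_ /= /andP[_ uy]].
    rewrite enorm_distC.
    by apply: (@coord_gap_enorm i); lra.
  - apply: le_hausdorff2 => x [[Xx /= ux]|[Xx /= /andP[ux _]]]; split => //=.
    by apply: le_trans ux; apply: u_le; rewrite (leq_trans (leq_pred _)).
apply: (@le_lt_trans _ _ (H X + H X)); last by rewrite lte_add_pinfty.
have S0 k : 0 <= H (S k) by exact: hausdorff2_ge0.
apply: lime_le; first exact: is_cvg_nneseries.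
near=> n.
apply: (@le_trans _ _ (\sum_(0 <= k < n.*2) H (S k))).
  rewrite (@big_cat_nat _ _ _ n 0 n.*2)//=; first by rewrite leeDl// sume_ge0.
  by rewrite -addnn leq_addr.
suff -> : \sum_(0 <= k < n.*2) H (S k) =
    \sum_(0 <= k < n) H (S (k.*2 + 0)%N) + \sum_(0 <= k < n) H (S (k.*2 + 1)%N).
  by apply: leeD; exact: parity.
rewrite -big_split/=; elim: (n) => [|m ih]; first by rewrite !big_nil.
by rewrite doubleS !big_nat_recr//= ih addn0 addn1 addeA.
Unshelve. all: by end_near. Qed.

(** F and its complement touch, so additivity on separated sets does not apply directly. It does
    apply to F and the part beyond [u n]; the shells in between form the tail of a convergent
    series. *)
Lemma caratheodory_halfspace i (a : R) :
  haus_outer.-caratheodory [set x : E3 R | coord i x <= a]%R.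
Proof.
apply: le_caratheodory_measurable => X; set F := [set x | _].
change (H (X `&` F) + H (X `&` ~` F) <= H X).
have [->|] := eqVneq (H X) +oo; first by rewrite leey.
rewrite -ltey => Hoo.
pose u (n : nat) : R := (a + n.+1%:R^-1)%R.
have du n : (u n.+1 < u n)%R by rewrite ltrD2l ltf_pV2 ?posrE// ltr_nat.
pose S k := X `&` [set x | u k.+1 <= coord i x < u k]%R.
have sumS : \sum_(k <oo) H (S k) < +oo by exact: shells_summable.
have ua n : (a < u n)%R by rewrite ltrDl invr_gt0.
have u_le m n : (m <= n)%N -> (u n <= u m)%R.
  by move=> mn; rewrite lerD2l lef_pV2 ?posrE// ler_nat.
have main n : H (X `&` F) + H (X `&` ~` F) <= H X + \sum_(n <= k <oo) H (S k).
  pose A := X `&` [set x | u n <= coord i x]%R.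
  have HA : H (X `&` F) + H A <= H X.
    apply: le_trans (@hausdorff2_separated (u n - a)%R _ _ _ _) _.
    - by rewrite subr_gt0.
    - move=> x y [_ xa] [_ ya]; apply: (@coord_gap_enorm i).
      by rewrite /F/= in xa ya *; lra.
    - by apply: le_hausdorff2 => x [[]|[]].
  apply: le_trans (leeD HA (lexx _)); rewrite -addeA; apply: leeD => //.
  apply: (@le_trans _ _ (H (A `|` \bigcup_(k in ~` `I_n) S k))).
    apply: le_hausdorff2 => x [Xx /negP]; rewrite -ltNge => ax.
    have [ux|ux] := leP (u n) (coord i x); [by left|right].
    have ex : exists k, (u k <= coord i x)%R.
      have e0 : (0 < coord i x - a)%R by rewrite subr_gt0.
      exists (Num.truncn (coord i x - a)^-1).
      have := truncnS_gt (coord i x - a)^-1.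
      rewrite /u -lerBrDl -[leRHS]invrK lef_pV2 ?posrE ?invr_gt0//.
      exact: ltW.
    case: (ex_minnP ex) => -[|k] uk kmin.
      by have := le_lt_trans uk ux; rewrite ltNge u_le.
    have ku : (coord i x < u k)%R.
      by rewrite ltNge; apply/negP => /kmin; rewrite ltnn.
    exists k; last by split=> //=; rewrite uk.
    move=> /= kn.
    by have := le_lt_trans uk ux; rewrite ltNge u_le.
  apply: le_trans (outer_measureU2 haus_outer _ _) _; apply: leeD => //.
  exact: (outer_measure_sigma_subadditive_tail haus_outer).
have tail : (\sum_(n <= k <oo) H (S k)) @[n --> \oo] --> 0.
  by apply: nneseries_tail_cvg => // k _; exact: hausdorff2_ge0.
have lim : (H X + \sum_(n <= k <oo) H (S k)) @[n --> \oo] --> H X + 0.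
  apply: cvgeD => //; last exact: cvg_cst.
  by rewrite fin_num_adde_defl// ge0_fin_numE// hausdorff2_ge0.
rewrite adde0 in lim; rewrite -(cvg_lim _ lim)//.
by apply: lime_ge; [apply/cvg_ex; exists (H X)|exact: nearW].
Qed.

Notation cE3 := (caratheodory_type (@haus_outer R)).

Lemma measurable_coord_surf i : measurable_fun setT (coord i : cE3 -> mR).
Proof.
apply: (measurability _ (RGenOInfty.measurableE R)) => _ [_ [a ->] <-].
rewrite setTI (_ : _ @^-1` _ = ~` [set x | coord i x <= a]%R).
  by apply: caratheodory_measurable_setC; exact: caratheodory_halfspace.
by apply/seteqP; split=> x /=; rewrite in_itv/= andbT ltNge => /negP.
Qed.

(** The passage from Borel to Caratheodory measurability: it is enough to test coordinates, whose
    sublevel sets are the half-spaces just treated. *)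
Lemma measurable_id_surf : measurable_fun setT (id : cE3 -> mE3).
Proof.
rewrite (_ : id = fun x : cE3 => (coord (@Ordinal 3 0 isT) x : mR,
  coord (@Ordinal 3 1 isT) x : mR, coord (@Ordinal 3 2 isT) x : mR)); last first.
  by apply/funext => -[[a b] c].
apply: measurable_fun_pair; last exact: measurable_coord_surf.
by apply: measurable_fun_pair; exact: measurable_coord_surf.
Qed.

Lemma measurable_surf (A : set (E3 R)) :
  measurable (A : set mE3) -> measurable (A : set cE3).
Proof.
by move=> mA; have := measurable_id_surf measurableT mA; rewrite setTI.
Qed.

Lemma measurable_funT_surf d (T : measurableType d) (f : E3 R -> T) :
  measurable_fun (setT : set mE3) f -> measurable_fun (setT : set cE3) f.
Proof. by move=> mf mD B mB; apply: measurable_surf; exact: mf. Qed.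

Lemma diam_shift C (t : E3 R) : diam [set x | C (x + t)%R] = diam C.
Proof.
rewrite /diam; congr (ereal_sup (_ `|` _)); apply/seteqP; split=> _ [[x y] [/= Cx Cy] <-].
  by exists (x + t, y + t)%R => //=; rewrite opprD addrACA subrr addr0.
exists (x - t, y - t)%R; first by split=> /=; rewrite subrK.
by rewrite /= opprB addrA subrK.
Qed.

Lemma measurable_shift A (t : E3 R) : measurable (A : set mE3) ->
  measurable ([set x | A (x + t)%R] : set mE3).
Proof.
move=> mA.
have mt : measurable_fun setT (fun x : mE3 => (x.1.1 + t.1.1, x.1.2 + t.1.2, x.2 + t.2)%R : mE3).
  apply: measurable_fun_pair; first apply: measurable_fun_pair.
  - by apply: measurable_funD => //; apply: measurableT_comp.
  - by apply: measurable_funD => //; apply: measurableT_comp.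
  - exact: measurable_funD.
have := mt measurableT A mA; rewrite setTI; congr measurable.
Qed.

Let shift_le A (t : E3 R) : H [set x | A (x + t)%R] <= H A.
Proof.
apply: ge_ereal_sup => _ [d /= d0 <-]; apply: le_trans (mu_ext_le_hausdorff2 A d0).
apply: le_ereal_inf_tmp => _ [F [mF AF] <-].
apply: ereal_inf_lbound; exists (fun k => [set x | F k (x + t)%R]).
  split=> [k|x /= /AF[k _ Fk]]; last by exists k.
  exact: measurable_shift (mF k).
apply: congr_lim; apply/funext => n; apply: eq_bigr => k _.
by rewrite /haus_weight diam_shift.
Qed.

Lemma hausdorff2_shift A (t : E3 R) : H [set x | A (x + t)%R] = H A.
Proof.
apply/eqP; rewrite eq_le shift_le/=.
rewrite -[leLHS](_ : H [set x | [set y | A (y + t)%R] (x - t)%R] = _) ?shift_le//.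
by congr H; apply/seteqP; split=> x /=; rewrite subrK.
Qed.

End hausdorff.

(** * Uniqueness of translation-invariant measures on the line and in the plane *)

Section translation_invariant.
Context {R : realType}.
Notation mR := (measurableTypeR R).
Local Notation oc a b := (`]a%R, b%R]%classic : set mR).
Variable m : {measure set mR -> \bar R}.
Hypothesis m_fin : (m (oc (0) (1)) < +oo)%E.
Hypothesis m_inv : forall a b t, m (oc (a + t) (b + t)) = m (oc (a) (b)).

Let g (t : R) := fine (m (oc (0) (t))).

Let m_itv a b : measurable (`]a, b]%classic : set mR).
Proof. exact: measurable_itv. Qed.

Let m0D s t : 0 <= s -> 0 <= t -> (m (oc (0) (s + t)) = m (oc (0) (s)) + m (oc (0) (t)))%E.
Proof.
move=> s0 t0; rewrite -[in m (oc 0 t)](m_inv 0 t s) add0r -measureU//.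
  rewrite (addrC t); congr (m _); apply/seteqP; split=> x /=; rewrite !in_itv/=.
    move=> /andP[x0 xst]; have [xs|xs] := leP x s; [left; rewrite x0//|right].
    by rewrite xst.
  by move=> [/andP[-> xs]|/andP[xs ->]]; rewrite ?andbT/=; lra.
apply/seteqP; split=> x //= []; rewrite !in_itv/= => /andP[_ xs] /andP[].
by rewrite ltNge xs.
Qed.

Let m_nat n : (m (oc (0) (n%:R)) < +oo)%E.
Proof.
elim: n => [|n ih]; first by rewrite set_itv_ge ?bnd_simp//= measure0.
by rewrite -natr1 m0D// lte_add_pinfty.
Qed.

Let m_pos t : (m (oc (0) (t)) \is a fin_num).
Proof.
rewrite ge0_fin_numE//; apply: le_lt_trans (m_nat (Num.truncn t).+1).
apply: le_measure; [by rewrite inE; exact: m_itv|by rewrite inE; exact: m_itv|].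
move=> x /=; rewrite !in_itv/= => /andP[-> xt]/=.
by rewrite (le_trans xt)// ltW// truncnS_gt.
Qed.

Let gD s t : 0 <= s -> 0 <= t -> g (s + t) = g s + g t.
Proof. by move=> s0 t0; rewrite /g m0D// fineD. Qed.

Let g_ge0 t : 0 <= g t. Proof. exact: fine_ge0. Qed.

Let g_le s t : 0 <= s -> s <= t -> g s <= g t.
Proof.
by move=> s0 st; rewrite -(subrK s t) addrC gD ?subr_ge0// lerDl.
Qed.

Let gM n t : 0 <= t -> g (n%:R * t) = n%:R * g t.
Proof.
move=> t0; elim: n => [|n ih].
  by rewrite !mul0r /g set_itv_ge ?bnd_simp//= measure0.
by rewrite -natr1 !mulrDl !mul1r gD ?ih// mulr_ge0.
Qed.

(** Cauchy's functional equation for a monotone g: if n t lies between k and k + 1, then n g t lies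
    between k g 1 and (k + 1) g 1, so n |g t - t g 1| <= g 1 for every n. *)
Let g_lin t : 0 <= t -> g t = t * g 1.
Proof.
move=> t0; apply/eqP; rewrite -subr_eq0 -normr_le0; apply/ler_addgt0Pl => e e0.
rewrite addr0.
pose n := (Num.truncn (g 1 / e)).+1.
have n0 : 0 < n%:R :> R by rewrite ltr0n.
pose k := Num.truncn (n%:R * t).
have nt0 : 0 <= n%:R * t by rewrite mulr_ge0.
have /andP[k1 k2] : k%:R <= n%:R * t < k.+1%:R by exact: truncn_itv.
have h1 : k%:R * g 1 <= n%:R * g t.
  by rewrite -!gM//; apply: g_le; rewrite mulr1.
have h2 : n%:R * g t <= k.+1%:R * g 1.
  by rewrite -!gM//; apply: g_le => //; rewrite mulr1 ltW.
have h3 : n%:R * `|g t - t * g 1| <= g 1.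
  rewrite -(gtr0_norm n0) -normrM ler_norml; have := g_ge0 1.
  move: h1 h2 k1 k2; rewrite -natr1 => h1 h2 k1 k2 g0.
  by apply/andP; split; nra.
rewrite -(ler_pM2l n0); apply: le_trans h3 _.
by rewrite -ler_pdivrMr// ltW// truncnS_gt.
Qed.

(** The length function t |-> m ]0, t] is additive and monotone, hence linear, and the half-open
    intervals determine a measure that is finite on them. *)
Lemma translation_invariant_measure A : measurable A ->
  (m A = m (oc (0%R) (1%R)) * lebesgue_measure A)%E.
Proof.
move=> mA; have c0 : 0 <= g 1 by exact: g_ge0.
have -> : (m (oc (0%R) (1%R)) * lebesgue_measure A
    = mscale (NngNum c0) lebesgue_measure A)%E by rewrite /mscale/= fineK.
apply: (@measure_unique _ R mR (@ocitv R) (fun k : nat => oc (- k%:R) k%:R)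
  erefl _ _ _ m (mscale (NngNum c0) lebesgue_measure)) => //.
- exact: ocitvI.
- by move=> k; exists (- k%:R, k%:R).
- rewrite -subTset => x _; exists (Num.truncn `|x|).+1 => //=.
  have : `|x| < (Num.truncn `|x|).+1%:R by exact: truncnS_gt.
  by rewrite in_itv/= ltr_norml => /andP[-> /ltW].
- move=> _ [[a b] _ <-]; rewrite -[RHS]/((g 1)%:E * lebesgue_measure (oc a b))%E.
  rewrite lebesgue_measure_itv/= lte_fin.
  case: ifPn => [ab|]; last first.
    by rewrite -leNgt => ba; rewrite set_itv_ge ?bnd_simp -?leNgt// measure0 mule0.
  rewrite -[in LHS](add0r a) -[in LHS](subrK a b) m_inv -EFinD -EFinM.
  rewrite -(fineK (m_pos _)) -/(g _) g_lin ?subr_ge0 ?ltW//.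
  by rewrite mulrC.
- move=> k; have := m_inv 0 (k%:R - - k%:R) (- k%:R).
  by rewrite add0r subrK => ->; rewrite -ge0_fin_numE.
Qed.

End translation_invariant.

Section translation_invariant2.
Context {R : realType}.
Notation mR := (measurableTypeR R).
Notation mR2 := (mR * mR)%type.
Local Notation oc a b := (`]a%R, b%R]%classic : set mR).
Variable m : {measure set mR2 -> \bar R}.
Hypothesis m_fin : (m (oc 0 1 `*` oc 0 1) < +oo)%E.
Hypothesis m_inv : forall (A : set mR2) (t : R * R), measurable A ->
  m [set p | A (p + t)] = m A.
Notation mu := (@lebesgue_measure R).

Let mfst : measurable_fun setT (fst : mR2 -> mR). Proof. exact: measurable_fst. Qed.
Let msnd : measurable_fun setT (snd : mR2 -> mR). Proof. exact: measurable_snd. Qed.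

Let ocE (a b t : R) : oc (a + t) (b + t) = [set x | oc a b (x - t)].
Proof.
by apply/seteqP; split=> x /=; rewrite !in_itv/= ltrBrDr lerBlDr.
Qed.

Let slab (B : set mR) : measurable B -> (m (oc 0 1 `*` B) < +oo)%E ->
  forall A, measurable A -> m (A `*` B) = (m (oc 0 1 `*` B) * mu A)%E.
Proof.
move=> mB fB A mA.
have mTB : measurable (setT `*` B : set mR2) by exact: measurableX.
have [nu E] : exists nu : {measure set mR -> \bar R}, forall X, nu X = m (X `*` B).
  unshelve eexists (pushforward (mrestr m mTB) (fst : mR2 -> mR)); first exact: mfst.
  move=> X; rewrite -[LHS]/(m (fst @^-1` X `&` (setT `*` B))); congr (m _); apply/seteqP.
  by split=> [[x y] /= [Xx [_ By]]|[x y] /= [Xx By]].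
have := @translation_invariant_measure _ nu _ _ A mA.
rewrite !E; apply=> //.
move=> a b t; rewrite !E -(@m_inv (oc a b `*` B) (- t, 0)); last exact: measurableX.
congr (m _); rewrite ocE; apply/seteqP.
by split=> [[x y] /=|[x y] /=]; rewrite addr0.
Qed.

Let slab' (A : set mR) : measurable A -> (m (A `*` oc 0 1) < +oo)%E ->
  forall B, measurable B -> m (A `*` B) = (m (A `*` oc 0 1) * mu B)%E.
Proof.
move=> mA fA B mB.
have mAT : measurable (A `*` setT : set mR2) by exact: measurableX.
have [nu E] : exists nu : {measure set mR -> \bar R}, forall X, nu X = m (A `*` X).
  unshelve eexists (pushforward (mrestr m mAT) (snd : mR2 -> mR)); first exact: msnd.
  move=> X; rewrite -[LHS]/(m (snd @^-1` X `&` (A `*` setT))); congr (m _); apply/seteqP.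
  by split=> [[x y] /= [Xx [Ay _]]|[x y] /= [Xx By]].
have := @translation_invariant_measure _ nu _ _ B mB.
rewrite !E; apply=> //.
move=> a b t; rewrite !E -(@m_inv (A `*` oc a b) (0, - t)); last exact: measurableX.
congr (m _); rewrite ocE; apply/seteqP.
by split=> [[x y] /=|[x y] /=]; rewrite addr0.
Qed.

(** The one-dimensional result is applied in each variable with the other factor frozen. This
    settles rectangles, which are stable under intersection and generate the sigma-algebra. *)
Lemma translation_invariant_measure2 A : measurable A ->
  m A = (m (oc 0%R 1%R `*` oc 0%R 1%R) * leb2 A)%E.
Proof.
set c := m (oc 0%R 1%R `*` oc 0%R 1%R) => mA.
have m1 X : measurable X -> m (X `*` oc 0 1) = (c * mu X)%E by move=> mX; exact: (slab (measurable_itv _) m_fin mX).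
have c_fin : c \is a fin_num by rewrite ge0_fin_numE; [exact: m_fin|exact: measure_ge0].
have c0 : 0 <= fine c by apply: fine_ge0; exact: measure_ge0.
have mX X Y : measurable X -> measurable Y -> m (X `*` Y) = (c * (mu X * mu Y))%E.
  move=> mX mY; have /sigma_finiteP[F [TF ndF Foo]] := sigma_finiteT mu.
  (* The one-dimensional result needs the strip X x ]0, 1] to have finite measure, so X is first cut
     into countably many disjoint pieces of finite length. *)
  pose D n := X `&` seqD F n.
  have mD n : measurable (D n).
    apply: measurableI => //; case: n => [|n]; first by have [] := Foo 0%N.
    by apply: measurableD; [have [] := Foo n.+1|have [] := Foo n].
  have tD : trivIset setT D by apply: trivIset_setIl; exact: trivIset_seqD.
  have XD : X = \bigcup_n D n by rewrite -setI_bigcupr eq_bigcup_seqD -TF setIT.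
  have muD n : (mu (D n) < +oo)%E.
    have [mF ltF] := Foo n; apply: le_lt_trans ltF; apply: le_measure; rewrite ?inE//.
    by move=> x [_]; case: (n) => //= k [].
  have tDY : trivIset setT (fun n => D n `*` Y).
    apply/trivIsetP => i j _ _ ij; move/trivIsetP : tD => /(_ i j Logic.I Logic.I ij) Dij.
    apply/seteqP; split=> // -[x y] /= [[Dx _] [Dx' _]].
    by have : (D i `&` D j) x; [split|rewrite Dij].
  rewrite {1}XD (_ : _ `*` Y = \bigcup_n (D n `*` Y)); last first.
    apply/seteqP; split=> [[x y] /= [[n _ Dx] Yy]|[x y] /= [n _ [Dx Yy]]]; first by exists n.
    by split=> //; exists n.
  rewrite measure_semi_bigcup//; last 2 first.
  - by move=> n; exact: measurableX.
  - by apply: bigcup_measurable => n _; exact: measurableX.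
  transitivity (\sum_(n <oo) (fine c)%:E * (mu (D n) * mu Y))%E.
    apply: eq_eseriesr => n _; rewrite fineK// slab'//; first by rewrite m1// muleA.
    by rewrite m1// lte_mul_pinfty//; exact: measure_ge0.
  rewrite nneseriesZl; last by move=> n _; exact: mule_ge0.
  rewrite fineK//; congr (c * _)%E.
  transitivity (\sum_(n <oo) (leb2 (D n `*` Y)))%E.
    by apply: eq_eseriesr => n _; rewrite [RHS]product_measure1E.
  rewrite -measure_semi_bigcup//; last 2 first.
  - by move=> n; exact: measurableX.
  - by apply: bigcup_measurable => n _; exact: measurableX.
  rewrite (_ : \bigcup_n _ = X `*` Y); first by rewrite [LHS]product_measure1E.
  rewrite XD; apply/seteqP; split=> [[x y] /= [n _ [Dx Yy]]|[x y] /= [[n _ Dx] Yy]].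
    by split=> //; exists n.
  by exists n.
have -> : (c * leb2 A = mscale (NngNum c0) leb2 A)%E by rewrite /mscale/= fineK.
have /sigma_finiteP[F [TF ndF Foo]] := sigma_finiteT mu.
apply: (@measure_unique _ R mR2
  [set X `*` Y | X in (measurable : set (set mR)) & Y in (measurable : set (set mR))]
  (fun k => F k `*` F k) (measurable_prod_measurableType _ _) _ _ _ m
  (mscale (NngNum c0) leb2)) => //.
- move=> _ _ [X mX' [Y mY <-]] [X' mX'' [Y' mY' <-]].
  exists (X `&` X'); first exact: measurableI.
  by exists (Y `&` Y'); [exact: measurableI|rewrite setXI].
- by move=> k; have [? _] := Foo k; exists (F k) => //; exists (F k).
- rewrite -subTset => -[x y] _.
  have [i _ Fx] : (\bigcup_i F i) x by rewrite -TF.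
  have [j _ Fy] : (\bigcup_i F i) y by rewrite -TF.
  exists (maxn i j) => //; split => /=.
  - by move: x Fx; exact/subsetPset/ndF/leq_maxl.
  - by move: y Fy; exact/subsetPset/ndF/leq_maxr.
- move=> _ [X mX' [Y mY <-]].
  rewrite -[RHS]/((fine c)%:E * leb2 (X `*` Y))%E fineK// mX//.
  by rewrite [leb2 _]product_measure1E.
- move=> k; have [? ?] := Foo k; rewrite mX//.
  apply: lte_mul_pinfty => //; first exact: measure_ge0.
  by apply: lte_mul_pinfty => //; rewrite ge0_fin_numE.
Qed.

End translation_invariant2.

(** Both sides are integrals over Y against push-forward measures, which coincide on the measurable
    subsets of D. It carries surface integrals over a face to planar integrals. *)
Lemma ge0_integral_transfer d1 d2 d (X1 : measurableType d1) (X2 : measurableType d2)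
    (Y : measurableType d) (R : realType) (phi1 : X1 -> Y) (phi2 : X2 -> Y) :
  measurable_fun setT phi1 -> measurable_fun setT phi2 ->
  forall (m1 : {measure set X1 -> \bar R}) (m2 : {measure set X2 -> \bar R})
    (D : set Y) (f : Y -> \bar R), measurable D -> measurable_fun D f ->
  (forall y, D y -> (0 <= f y)%E) ->
  (forall A, measurable A -> A `<=` D -> m1 (phi1 @^-1` A) = m2 (phi2 @^-1` A)) ->
  (\int[m1]_(x in phi1 @^-1` D) f (phi1 x) = \int[m2]_(x in phi2 @^-1` D) f (phi2 x))%E.
Proof.
move=> mphi1 mphi2 m1 m2 D f mD mf f0 m12.
have f0' : {in D, forall y, (0 <= f y)%E} by move=> y /set_mem; exact: f0.
have e1 := ge0_integral_pushforward mphi1 m1 mD mf f0'.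
have e2 := ge0_integral_pushforward mphi2 m2 mD mf f0'.
rewrite -[LHS]e1 -[RHS]e2; apply: eq_measure_integral => *; exact: m12.
Qed.

(** * Hausdorff measure on the coordinate planes *)

Section faces.
Context {R : realType}.
Notation mR := (measurableTypeR R).
Notation mR2 := (mR * mR)%type.
Notation mE3 := (E3 mR).
Notation cE3 := (caratheodory_type (@haus_outer R)).
Notation mu := (@lebesgue_measure R).
Notation H := (@hausdorff2 R).
Local Notation oc a b := (`]a%R, b%R]%classic : set mR).

Definition proj (i : 'I_3) (x : E3 R) : R * R :=
  match val i with 0 => (x.1.2, x.2) | 1 => (x.1.1, x.2) | _ => x.1 end.

Lemma insertK i : cancel (insert i : R * R -> E3 R) (proj i).
Proof. by move=> [a b]; rewrite /proj /insert; case: i => [[|[|m]] ?]. Qed.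

Lemma projK i (x : E3 R) : coord i x = 0 -> insert i (proj i x) = x.
Proof.
by case: x => [[a b] c]; rewrite /proj /insert /coord; case: i => [[|[|m]] ?] /= ->.
Qed.

Lemma coord_insert i (p : R * R) : coord i (insert i p) = 0.
Proof. by rewrite /insert /coord; case: i => [[|[|m]] ?]. Qed.

Lemma image_insert i (A : set (R * R)) :
  insert i @` A = [set x | coord i x = 0] `&` proj i @^-1` A.
Proof.
apply/seteqP; split=> [_ [p Ap <-]|x [/= x0 Ax]]; last by exists (proj i x); rewrite ?projK.
by split; rewrite /= ?coord_insert ?insertK.
Qed.

Lemma measurable_proj i : measurable_fun setT (proj i : mE3 -> mR2).
Proof.
rewrite /proj; case: i => [[|[|m]] ?] /=; last exact: measurable_fst.
- by apply: measurable_fun_pair => //; apply: measurableT_comp.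
- by apply: measurable_fun_pair => //; apply: measurableT_comp.
Qed.

Lemma measurable_insert i : measurable_fun setT (insert i : mR2 -> mE3).
Proof.
rewrite /insert; case: i => [[|[|m]] ?] /=;
  by apply: measurable_fun_pair => //; apply: measurable_fun_pair.
Qed.

Lemma measurable_plane i : measurable ([set x : E3 R | coord i x = 0] : set mE3).
Proof.
apply: closed_measurable3.
apply: (@closed_comp _ _ (coord i) [set y | y = 0]).
  by move=> x _; exact: continuous_coord.
exact: closed_eq.
Qed.

Lemma measurable_image_insert i (A : set mR2) : measurable A ->
  measurable (insert i @` A : set mE3).
Proof.
move=> mA; rewrite image_insert; apply: measurableI; first exact: measurable_plane.
by have := measurable_proj i measurableT mA; rewrite setTI.
Qed.

Lemma insertD i (p t : R * R) : insert i (p + t) = insert i p + insert i t.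
Proof.
by case: p t => [a b] [c d]; rewrite /insert; case: i => [[|[|m]] ?] /=;
  congr (_, _, _); rewrite ?addr0.
Qed.

Lemma enorm_insert_ge i (p q : R * R) : `|p.1 - q.1| <= enorm (insert i p - insert i q) /\
  `|p.2 - q.2| <= enorm (insert i p - insert i q).
Proof.
by rewrite /insert; case: i => [[|[|m]] ?] /=; split;
 [apply: le_trans (coord_le_enorm (@Ordinal 3 1 isT) _)
 |apply: le_trans (coord_le_enorm (@Ordinal 3 2 isT) _)
 |apply: le_trans (coord_le_enorm (@Ordinal 3 0 isT) _)
 |apply: le_trans (coord_le_enorm (@Ordinal 3 2 isT) _)
 |apply: le_trans (coord_le_enorm (@Ordinal 3 0 isT) _)
 |apply: le_trans (coord_le_enorm (@Ordinal 3 1 isT) _)].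
Qed.

Lemma enorm_insert_le i (p q : R * R) :
  enorm (insert i p - insert i q) <= `|p.1 - q.1| + `|p.2 - q.2|.
Proof.
apply: le_trans (enorm_le_sum _) _; rewrite !big_ord_recl big_ord0 addr0.
rewrite /insert /coord; case: i => [[|[|m]] ?] /=;
  by rewrite subrr normr0 ?add0r ?addr0.
Qed.

Local Open Scope ereal_scope.

(** A set of diameter D meets the plane inside a square of side 2 D centred at one of its points,
    and 4 D^2 = (16 / pi) (pi / 4) D^2. This crude form of the isodiametric inequality is enough for
    positivity. *)
Lemma leb2_insert_le i (C : set (E3 R)) : measurable (C : set mE3) ->
  leb2 (insert i @^-1` C) <= (16 / pi)%:E * haus_weight 1 C.
Proof.
move=> mC; rewrite /haus_weight; case: ifPn => [C1|_]; last first.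
  by rewrite gt0_muley ?leey// lte_fin divr_gt0// pi_gt0.
have [[p Cp]|C0] := pselect (insert i @^-1` C !=set0); last first.
  rewrite (_ : _ @^-1` _ = set0).
    by rewrite measure0 !mule_ge0 ?diam_ge0// lee_fin// divr_ge0 ?pi_ge0.
  by apply/seteqP; split=> // x Cx; apply: C0; exists x.
have dfin : diam C \is a fin_num by rewrite ge0_fin_numE ?diam_ge0// (le_lt_trans C1)// ltry.
set D := fine (diam C); have DE : diam C = D%:E by rewrite fineK.
have D0 : (0 <= D)%R by rewrite fine_ge0 ?diam_ge0.
have h : leb2 (insert i @^-1` C) <=
    leb2 ((`[(p.1 - D)%R, (p.1 + D)%R]%classic : set mR) `*`
          (`[(p.2 - D)%R, (p.2 + D)%R]%classic : set mR)).
  apply: le_measure; rewrite ?inE.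
  - by have := measurable_insert i measurableT mC; rewrite setTI.
  - exact: measurableX.
  move=> q /= Cq; have := enorm_le_diam Cp Cq; rewrite DE lee_fin => pq.
  have [h1 h2] := enorm_insert_ge i p q.
  have {}h1 := le_trans h1 pq; have {}h2 := le_trans h2 pq.
  move: h1 h2; rewrite !in_itv/= !ler_norml => /andP[? ?] /andP[? ?].
  by split; apply/andP; split; lra.
have itvE (a : R) : mu (`[(a - D)%R, (a + D)%R]%classic : set mR) = (2 * D)%:E.
  rewrite lebesgue_measure_itv/= lte_fin; case: ifPn => [_|].
    by rewrite -EFinD; congr EFin; ring.
  rewrite -leNgt => aD; have -> : D = 0%R by lra.
  by rewrite mulr0.
apply: le_trans h _.
have -> : leb2 ((`[(p.1 - D)%R, (p.1 + D)%R]%classic : set mR) `*`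
    (`[(p.2 - D)%R, (p.2 + D)%R]%classic : set mR)) = (2 * D)%:E * (2 * D)%:E.
  by rewrite [LHS]product_measure1E//; congr (_ * _); exact: itvE.
rewrite DE -!EFinM lee_fin le_eqVlt; apply/orP; left; apply/eqP.
by have := pi_gt0 R; move: pi => q q0; field; exact: lt0r_neq0.
Qed.

Lemma hausdorff2_unit_gt0 i : 0 < H (insert i @` (oc 0 1 `*` oc 0 1)).
Proof.
suff : (pi / 16)%:E <= H (insert i @` (oc 0 1 `*` oc 0 1)).
  by apply: lt_le_trans; rewrite lte_fin divr_gt0// pi_gt0.
apply: le_trans (mu_ext_le_hausdorff2 _ (ltr01)).
apply: le_ereal_inf_tmp => _ [F [mF AF] <-].
have c0 : (0 < 16 / pi :> R)%R by rewrite divr_gt0// pi_gt0.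
rewrite -(@lee_pmul2l _ (16 / pi)%:E) ?lte_fin//.
rewrite -nneseriesZl; last by move=> *; exact: haus_weight_ge0.
apply: (@le_trans _ _ (\sum_(k <oo) leb2 (insert i @^-1` F k))); last first.
  by apply: lee_nneseries => [k _ _|k _]; [exact: measure_ge0|exact: leb2_insert_le (mF k)].
have mi k : measurable (insert i @^-1` F k : set mR2).
  by have := measurable_insert i measurableT (mF k); rewrite setTI.
apply: (@le_trans _ _ (leb2 (oc 0 1 `*` oc 0 1))); last first.
  apply: measure_sigma_subadditive => //; first exact: measurableX.
  move=> p Ap; have [k _ Fk] := AF (insert i p) ltac:(by exists p).
  by exists k.
have mu01 : mu (oc 0 1) = 1%:E.
  by rewrite lebesgue_measure_itv/= lte_fin ltr01 -EFinD subr0.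
have -> : leb2 (oc 0 1 `*` oc 0 1) = 1%:E * 1%:E.
  by rewrite [LHS]product_measure1E//; congr (_ * _); exact: mu01.
rewrite -!EFinM lee_fin mulr1 le_eqVlt; apply/orP; left; apply/eqP.
by have := pi_gt0 R; move: pi => q q0; field; exact: lt0r_neq0.
Qed.

Lemma diam_insert_le i (a b l : R) : (0 <= l)%R ->
  diam (insert i @` (oc a (a + l) `*` oc b (b + l))) <= (2 * l)%:E.
Proof.
move=> l0; apply: ge_ereal_sup => y [->|].
  by rewrite lee_fin mulr_ge0.
move=> [z [[p [p1 p2] pz] [q [q1 q2] qz]] <-]; rewrite lee_fin -pz -qz.
apply: le_trans (enorm_insert_le i p q) _.
move: p1 p2 q1 q2; rewrite /= !in_itv/= => /andP[? ?] /andP[? ?] /andP[? ?] /andP[? ?].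
by rewrite mulr_natl mulr2n; apply: lerD; rewrite ler_norml; apply/andP; split; lra.
Qed.

(** A grid of n^2 cells of side 1/n and diameter at most 2/n has total weight n^2 (pi / 4) (2 / n)^2
    = pi, whatever n is. *)
Lemma hausdorff2_unit_fin i : H (insert i @` (oc 0 1 `*` oc 0 1)) < +oo.
Proof.
apply: (@le_lt_trans _ _ (pi : R)%:E); last by rewrite ltry.
apply: ge_ereal_sup => _ [d /= d0 <-].
pose n := (Num.truncn (2 / d)).+1.
have n0 : (0 < n%:R :> R)%R by rewrite ltr0n.
have nd : (2 * n%:R^-1 <= d)%R.
  rewrite ler_pdivrMr// -ler_pdivrMl// mulrC ltW//.
  exact: truncnS_gt.
(* The quotient and the remainder of k by n are the two indices of its cell. *)
pose F k := if (k < n * n)%N then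
  insert i @` (oc ((k %/ n)%:R / n%:R) ((k %/ n)%:R / n%:R + n%:R^-1) `*`
               oc ((k %% n)%:R / n%:R) ((k %% n)%:R / n%:R + n%:R^-1)) else set0.
have cell (x : R) : (0 < x <= 1)%R ->
    exists2 a, (a < n)%N & (a%:R / n%:R < x <= a%:R / n%:R + n%:R^-1)%R.
  move=> /andP[x0 x1].
  have ex : exists a, (x <= a%:R / n%:R + n%:R^-1)%R.
    by exists n; rewrite divff ?gt_eqF// (le_trans x1)// lerDl invr_ge0 ltW.
  case: (ex_minnP ex) => a xa amin; have ax : (a%:R / n%:R < x)%R.
    case: a xa amin => [|a] xa amin; first by rewrite mul0r.
    rewrite ltNge; apply/negP => h.
    suff /amin : (x <= a%:R / n%:R + n%:R^-1)%R by rewrite ltnn.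
    by apply: le_trans h _; rewrite -natr1 mulrDl mul1r.
  exists a; last by rewrite ax.
  rewrite -(ltr_nat R) -[ltRHS]mul1r -ltr_pdivrMr//.
  exact: lt_le_trans ax x1.
have mF k : measurable (F k : set mE3).
  by rewrite /F; case: ifP => // _; apply: measurable_image_insert; exact: measurableX.
have FA : insert i @` (oc 0 1 `*` oc 0 1) `<=` \bigcup_k F k.
  move=> _ [[x y] /= [x01 y01] <-]; move: x01 y01; rewrite !in_itv/= => x01 y01.
  have [a an ax] := cell _ x01; have [b bn bY] := cell _ y01.
  exists (a * n + b)%N => //; rewrite /F ifT; last first.
    by apply: (@leq_trans (a.+1 * n)); [rewrite mulSn addnC ltn_add2r|rewrite leq_mul2r an orbT].
  rewrite divnMDl// (divn_small bn) addn0 modnMDl (modn_small bn).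
  by exists (x, y) => //; split; rewrite /= in_itv.
apply: (@le_trans _ _ (\sum_(k <oo) haus_weight d (F k))).
  by apply: ereal_inf_lbound; exists F.
rewrite (nneseries_split _ (n * n)); last by move=> *; exact: haus_weight_ge0.
rewrite [X in _ + X]eseries0 ?adde0; last first.
  by move=> k; rewrite add0n => nk _; rewrite /F ltnNge nk/= haus_weight0.
rewrite add0n.
apply: (@le_trans _ _ (\sum_(0 <= k < n * n) (pi / 4 * (2 * n%:R^-1 * (2 * n%:R^-1)))%:E)).
  apply: lee_sum => k _; rewrite /F; case: ifP => _; last first.
    by rewrite haus_weight0// lee_fin !mulr_ge0 ?invr_ge0 ?pi_ge0 ?(ltW n0).
  set C := insert i @` _.
  have dC : diam C <= (2 * n%:R^-1)%:E by apply: diam_insert_le; rewrite invr_ge0 ltW.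
  rewrite /haus_weight ifT; last by apply: le_trans dC _; rewrite lee_fin.
  rewrite [leRHS]EFinM; apply: lee_pmul => //.
  - by rewrite lee_fin divr_ge0 ?pi_ge0.
  - by rewrite mule_ge0 ?diam_ge0.
  - by rewrite [leRHS]EFinM; apply: lee_pmul => //; exact: diam_ge0.
rewrite sumEFin lee_fin sumr_const_nat subn0 -[leLHS]mulr_natl natrM le_eqVlt.
by apply/orP; left; apply/eqP; move: pi n0 => q; move: (n%:R) => x x0; field; exact: lt0r_neq0.
Qed.

Definition face_cst i : R := fine (H (insert i @` (oc 0 1 `*` oc 0 1))).

Lemma face_cst_gt0 i : (0 < face_cst i)%R.
Proof. by rewrite fine_gt0// hausdorff2_unit_gt0 hausdorff2_unit_fin. Qed.

(** Surface measure restricted to the plane and pushed forward by [proj i] inherits translation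
    invariance from the Hausdorff measure and is finite on the unit square. *)
Lemma hausdorff2_face i (A : set mR2) : measurable A ->
  H (insert i @` A) = (face_cst i)%:E * leb2 A.
Proof.
move=> mA.
have mP : measurable ([set x : E3 R | coord i x = 0%R] : set cE3).
  exact: measurable_surf (measurable_plane i).
have mp : measurable_fun setT (proj i : cE3 -> mR2).
  exact: measurable_funT_surf (measurable_proj i).
have [nu nuE] : exists nu : {measure set mR2 -> \bar R}, forall A, nu A = H (insert i @` A).
  unshelve eexists (pushforward (mrestr (@surf R) mP) (proj i : cE3 -> mR2)) => //.
  by move=> B; rewrite image_insert setIC.
have cf : H (insert i @` (oc 0 1 `*` oc 0 1)) \is a fin_num.
  by rewrite ge0_fin_numE ?hausdorff2_ge0 ?hausdorff2_unit_fin.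
rewrite -nuE (@translation_invariant_measure2 _ nu)//.
- by rewrite nuE fineK.
- by rewrite nuE; exact: hausdorff2_unit_fin.
move=> {mA}A t mA; rewrite !nuE -(hausdorff2_shift (insert i @` A) (insert i t)).
congr (hausdorff2 _); apply/seteqP; split=> [_ [p Ap <-]|x [p Ap px]].
  by exists (p + t)%R => //; rewrite insertD.
exists (p - t)%R; first by rewrite /= subrK.
by apply: (addIr (insert i t)); rewrite -insertD subrK.
Qed.

Lemma ge0_integral_face i (D : set mR2) (g : E3 R -> \bar R) : measurable D ->
  measurable_fun (setT : set mE3) g -> (forall x, 0 <= g x) ->
  \int[surf]_(x in insert i @` D) g x =
  (face_cst i)%:E * \int[leb2]_(p in D) g (insert i p).
Proof.
move=> mD mg g0; pose nc := NngNum (ltW (face_cst_gt0 i)).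
have mi := measurable_insert i.
have mID : measurable (insert i @` D : set mE3) by exact: measurable_image_insert.
have mg' : measurable_fun setT (g \o insert i : mR2 -> \bar R).
  exact: measurableT_comp mg mi.
have DE : insert i @^-1` (insert i @` D) = D.
  apply/seteqP; split=> [p [q Dq]|p Dp]; last by exists p.
  by move=> /(can_inj (insertK i)) <-.
have H (A : set mE3) : measurable A -> A `<=` insert i @` D ->
    surf A = mscale nc leb2 (insert i @^-1` A).
  move=> mA AD; rewrite -[RHS]/((face_cst i)%:E * leb2 (insert i @^-1` A)).
  rewrite -hausdorff2_face; last by have := mi measurableT A mA; rewrite setTI.
  congr (hausdorff2 _); apply/seteqP; split=> [x Ax|_ [p Ap <-]//].
  by have [p Dp px] := AD _ Ax; exists p => //; rewrite /= px.
have e := @ge0_integral_transfer _ _ _ cE3 mR2 mE3 R id (insert i) measurable_id_surf mi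
  surf (mscale nc leb2) (insert i @` D) g mID (measurable_funTS mg) (fun x _ => g0 x) H.
by apply: etrans e _; rewrite DE ge0_integral_mscale//; apply: measurable_funTS; exact: mg'.
Qed.

Lemma Rintegral_face i (D : set mR2) (g : E3 R -> R) : measurable D ->
  measurable_fun (setT : set mE3) g ->
  leb2.-integrable D (fun p => (g (insert i p))%:E) ->
  (\int[surf]_(x in insert i @` D) g x =
  face_cst i * \int[leb2]_(p in D) g (insert i p))%R.
Proof.
move=> mD mg ig; have mgE : measurable_fun (setT : set mE3) (EFin \o g).
  exact/measurable_EFinP.
rewrite /Rintegral integralE ge0_integral_face//; last exact: measurable_funepos.
rewrite ge0_integral_face//; last exact: measurable_funeneg.
rewrite [in RHS]integralE.
have pf := integrable_pos_fin_num mD ig; have nf := integrable_neg_fin_num mD ig.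
have alg (a b : \bar R) : a \is a fin_num -> b \is a fin_num ->
    fine ((face_cst i)%:E * a - (face_cst i)%:E * b) = (face_cst i * fine (a - b))%R.
  by move=> /fineK <- /fineK <-; rewrite -!EFinM -!EFinB /= mulrBr.
have Ep : (fun p => (g (insert i p))%:E)^\+ = (fun p => (EFin \o g)^\+ (insert i p)).
  by apply/funext => p; rewrite !funeposE.
have En : (fun p => (g (insert i p))%:E)^\- = (fun p => (EFin \o g)^\- (insert i p)).
  by apply/funext => p; rewrite !funenegE.
by move: pf nf; rewrite Ep En => pf nf; exact: alg.
Qed.

Lemma integrable_face i (D : set mR2) (g : E3 R -> R) : measurable D ->
  measurable_fun (setT : set mE3) g ->
  leb2.-integrable D (fun p => (g (insert i p))%:E) ->
  surf.-integrable (insert i @` D) (EFin \o g).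
Proof.
move=> mD mg /integrableP[mig ig]; apply/integrableP; split.
  apply/measurable_EFinP/measurable_funTS.
  exact: measurable_funT_surf mg.
rewrite (ge0_integral_face _ (g := fun x => `|(g x)%:E|))//.
  by apply: lte_mul_pinfty => //; rewrite lee_fin ltW ?face_cst_gt0.
by apply: measurableT_comp => //; exact/measurable_EFinP.
Qed.

End faces.

(** * Oscillating exponential profiles *)

Section profiles.
Context {R : realType}.
Notation mu := (@lebesgue_measure R).
Variable r : R.
Hypothesis r0 : 0 < r.

Definition decay (s t : R) : R := expR (- (s * t)).
Definition prof (s t : R) : R := bump r t * decay s t.
(** Together with [profS], the real and imaginary parts of the cut-off exponential exp ((-1 + 3i) s
    t). *)
Definition profC (s t : R) : R := prof s t * cos (3 * s * t).
Definition profS (s t : R) : R := prof s t * sin (3 * s * t).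

Lemma has_derivZ a (f f' : R -> R) : has_deriv f f' ->
  has_deriv (fun t => a * f t) (fun t => a * f' t).
Proof.
move=> ff t.
apply: (is_derive_eq (has_derivM (f := fun=> a) (f' := fun=> 0) _ ff t)).
  by move=> u; exact: is_derive_cst.
by rewrite mulr0 addr0.
Qed.

Lemma has_deriv_near_cst (f g : R -> R) (a b c : R) : has_deriv f g ->
  (forall t, a < t < b -> f t = c) -> forall t, a < t < b -> g t = 0.
Proof.
move=> fg fc t /andP[at_ tb]; case: (fg t) => _ <-.
have -> : 'D_1 f t = 'D_1 (cst c) t.
  apply: near_eq_derive; near=> u; apply: fc; apply/andP; split.
    by near: u; exact: lt_nbhsr.
  by near: u; exact: lt_nbhsl.
exact: derive_cst.
Unshelve. all: by end_near. Qed.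

Lemma continuous_le_itv (f : R -> R) : continuous f ->
  exists2 L : R, 0 <= L & forall t, 0 <= t <= r -> `|f t| <= L.
Proof.
move=> cf; have [M [_ MP]] := @continuous_bounded_on R R `[0, r] `[0, r] f cf
  (@segment_compact _ 0 r) (fun x h => h).
exists (Num.max 0 (M + 1)); first by rewrite le_max lexx.
move=> t tr; rewrite le_max; apply/orP; right.
by apply: MP; [rewrite ltrDl|rewrite /= in_itv].
Qed.

Lemma bump_deriv : exists b1 b2 (L : R),
  [/\ has_deriv (bump r) b1 /\ has_deriv b1 b2, smooth1 b1 /\ smooth1 b2, 0 <= L,
      forall t, 0 < t < r / 2 -> b1 t = 0 /\ b2 t = 0 &
      forall t, 0 <= t <= r -> `|b1 t| <= L /\ `|b2 t| <= L].
Proof.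
have [b1 sb1 db1] := smooth1_deriv (smooth1_bump r).
have [b2 sb2 db2] := smooth1_deriv sb1.
have [L1 L10 L1P] := continuous_le_itv (smooth1_continuous sb1).
have [L2 L20 L2P] := continuous_le_itv (smooth1_continuous sb2).
exists b1, b2, (Num.max L1 L2); split=> //; first by rewrite le_max L10.
  have b1z t : 0 < t < r / 2 -> b1 t = 0.
    apply: (has_deriv_near_cst db1 (c := 1)) => u /andP[u0 ur].
    by rewrite bump1// gtr0_norm// ltW.
  move=> t tr; split; first exact: b1z.
  exact: (has_deriv_near_cst db2 b1z).
by move=> t tr; rewrite !le_max L1P// L2P// orbT.
Qed.

Lemma has_deriv_decay s : has_deriv (decay s) (fun t => - s * decay s t).
Proof.
move=> t; rewrite mulrC.
have := has_deriv_comp (f := expR) (f' := expR) (fun t => is_derive_expR t)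
  (has_deriv_affine (- s) 0) t.
by rewrite /decay addr0 mulNr; under eq_fun do rewrite addr0 mulNr.
Qed.

Lemma decay_gt0 s t : 0 < decay s t. Proof. exact: expR_gt0. Qed.

Lemma decay_le1 s t : 0 <= s -> 0 <= t -> decay s t <= 1.
Proof. by move=> s0 t0; rewrite -expR0 ler_expR oppr_le0 mulr_ge0. Qed.

Lemma decay_le s t u : 0 <= s -> t <= u -> decay s u <= decay s t.
Proof. by move=> s0 tu; rewrite ler_expR lerN2 ler_wpM2l. Qed.

Lemma decay_lel s s' t : 0 <= t -> s <= s' -> decay s' t <= decay s t.
Proof. by move=> t0 ss; rewrite ler_expR lerN2 ler_wpM2r. Qed.

Lemma decay0 s : decay s 0 = 1. Proof. by rewrite /decay mulr0 oppr0 expR0. Qed.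

Lemma bump0r : bump r 0 = 1.
Proof. by rewrite bump1// normr0 divr_ge0// ltW. Qed.

Lemma prof_ge0 s t : 0 <= prof s t.
Proof. by rewrite mulr_ge0 ?bump_ge0// ltW ?decay_gt0. Qed.

Lemma prof_le1 s t : 0 <= s -> 0 <= t -> prof s t <= 1.
Proof.
by move=> s0 t0; rewrite mulr_ile1 ?bump_ge0 ?bump_le1 ?decay_le1// ltW ?decay_gt0.
Qed.

Lemma prof_at0 s : prof s 0 = 1.
Proof. by rewrite /prof bump0r decay0 mulr1. Qed.

Lemma prof_out s t : r <= `|t| -> prof s t = 0.
Proof. by move=> tr; rewrite /prof bump0 ?mul0r. Qed.

Lemma smooth1_decay s : smooth1 (decay s).
Proof.
have := smooth1_comp smooth1_expR (smooth1_affine (- s) 0).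
by under eq_fun do rewrite addr0 mulNr.
Qed.

Lemma smooth1_prof s : smooth1 (prof s).
Proof. by apply: smooth1M; [exact: smooth1_bump|exact: smooth1_decay]. Qed.

Let smooth1_trig (f : R -> R) a : smooth1 f -> smooth1 (fun t => f (a * t)).
Proof.
move=> sf; have := smooth1_comp sf (smooth1_affine a 0).
by under eq_fun do rewrite addr0.
Qed.

Lemma smooth1_profC s : smooth1 (profC s).
Proof.
apply: smooth1M; first exact: smooth1_prof.
by apply: smooth1_trig; have [] := @smooth1_cos_sin R.
Qed.

Lemma smooth1_profS s : smooth1 (profS s).
Proof.
apply: smooth1M; first exact: smooth1_prof.
by apply: smooth1_trig; have [] := @smooth1_cos_sin R.
Qed.

Lemma prof_continuous s : continuous (prof s).
Proof. exact: smooth1_continuous (smooth1_prof s). Qed.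

Lemma profC_le s t : `|profC s t| <= prof s t.
Proof.
rewrite normrM (ger0_norm (prof_ge0 _ _)) ler_piMr ?prof_ge0//.
by rewrite ler_norml cos_geN1 cos_le1.
Qed.

Lemma profS_le s t : `|profS s t| <= prof s t.
Proof.
rewrite normrM (ger0_norm (prof_ge0 _ _)) ler_piMr ?prof_ge0//.
by rewrite ler_norml sin_geN1 sin_le1.
Qed.

Lemma prof_lel s s' t : 0 <= t -> s <= s' -> prof s' t <= prof s t.
Proof. by move=> t0 ss; rewrite ler_wpM2l ?bump_ge0// decay_lel. Qed.

(* The cut-off only contributes away from the corner, hence terms that are
   exponentially small in [s]. *)
Definition tail_decay (s : R) := decay s (r / 2).

Lemma mul_decay_le (b : R -> R) (L s t : R) : 0 <= L -> 0 <= s ->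
  (forall t, 0 < t < r / 2 -> b t = 0) ->
  (forall t, 0 <= t <= r -> `|b t| <= L) -> 0 < t <= r ->
  `|b t| * decay s t <= L * tail_decay s.
Proof.
move=> L0 s0 b0 bL /andP[t0 tr]; have [tr2|tr2] := ltP t (r / 2).
  by rewrite b0 ?t0// normr0 mul0r mulr_ge0// ltW ?decay_gt0.
apply: ler_pM => //; first by rewrite ltW ?decay_gt0.
  by rewrite bL// ltW.
exact: decay_le.
Qed.

Lemma has_deriv_trig s :
  has_deriv (fun t => decay s t * cos (3 * s * t))
    (fun t => s * (- (decay s t * cos (3 * s * t)) - 3 * (decay s t * sin (3 * s * t)))) /\
  has_deriv (fun t => decay s t * sin (3 * s * t))
    (fun t => s * (3 * (decay s t * cos (3 * s * t)) - decay s t * sin (3 * s * t))).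
Proof.
have dc : has_deriv (fun t => cos (3 * s * t)) (fun t => - sin (3 * s * t) * (3 * s)).
  have := has_deriv_comp (f := cos) (fun t => is_derive_cos t) (has_deriv_affine (3 * s) 0).
  by under eq_fun do rewrite addr0; move=> h t; have := h t; rewrite addr0.
have ds : has_deriv (fun t => sin (3 * s * t)) (fun t => cos (3 * s * t) * (3 * s)).
  have := has_deriv_comp (f := sin) (fun t => is_derive_sin t) (has_deriv_affine (3 * s) 0).
  by under eq_fun do rewrite addr0; move=> h t; have := h t; rewrite addr0.
split=> t.
  by apply: (is_derive_eq (has_derivM (has_deriv_decay s) dc t)); ring.
by apply: (is_derive_eq (has_derivM (has_deriv_decay s) ds t)); ring.
Qed.

(** The rate 4 s in the hypothesis serves all three profiles: 1 + 3 bounds the trigonometric ones,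
    and 4 is the exact rate of the third. *)
Lemma bump_mul_deriv2 : exists2 K : R, 0 <= K & forall s, 1 <= s ->
  forall g g1 g2 : R -> R, has_deriv g g1 -> has_deriv g1 g2 ->
  (forall t, 0 < t -> `|g t| <= decay s t /\ `|g1 t| <= 4 * s * decay s t) ->
  exists f1 f2, [/\ has_deriv (fun t => bump r t * g t) f1, has_deriv f1 f2 &
    forall t, 0 < t <= r -> `|f2 t - bump r t * g2 t| <= K * s * tail_decay s].
Proof.
have [b1 [b2 [L [[db db1] _ L0 bz bL]]]] := bump_deriv.
(* The terms containing derivatives of the cut-off are g b2 and 2 g1 b1, bounded by L and 8 s L
   times the tail; 9 s L covers both because 1 <= s. *)
exists (9 * L); first by rewrite mulr_ge0.
move=> s s1 g g1 g2 dg dg1 gle; have s0 : 0 <= s by rewrite (le_trans _ s1).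
exists (fun t => bump r t * g1 t + g t * b1 t).
exists (fun t => (bump r t * g2 t + g1 t * b1 t) + (g t * b2 t + b1 t * g1 t)).
split; [exact: has_derivM|by apply: has_derivD; exact: has_derivM|].
move=> t tr; have /andP[t0 _] := tr; have [gt g1t] := gle _ t0.
rewrite [X in `|X|](_ : _ = g t * b2 t + 2 * (g1 t * b1 t)); last by ring.
have h1 := mul_decay_le L0 s0 (fun t tr => (bz t tr).1) (fun t tr => (bL t tr).1) tr.
have h2 := mul_decay_le L0 s0 (fun t tr => (bz t tr).2) (fun t tr => (bL t tr).2) tr.
apply: le_trans (ler_normD _ _) _; rewrite !normrM (ger0_norm (ler0n R 2)).
have T0 : 0 <= tail_decay s by rewrite ltW ?decay_gt0.
have e1 : `|g t| * `|b2 t| <= L * tail_decay s.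
  by apply: le_trans h2; rewrite mulrC ler_wpM2l.
have e2 : `|g1 t| * `|b1 t| <= 4 * s * (L * tail_decay s).
  apply: (@le_trans _ _ (4 * s * decay s t * `|b1 t|)); first by rewrite ler_wpM2r.
  by rewrite -mulrA ler_wpM2l ?mulr_ge0// mulrC.
have LT : 0 <= L * tail_decay s by rewrite mulr_ge0.
nra.
Qed.

(** The coefficients are those of (-1 + 3i)^2 = -8 - 6i and of 4^2 = 16. *)
Lemma prof_deriv2 : exists2 K : R, 0 <= K & forall s, 1 <= s ->
  [/\ exists f1 f2, [/\ has_deriv (profC s) f1, has_deriv f1 f2 &
        forall t, 0 < t <= r -> `|f2 t - s ^+ 2 * (- 8 * profC s t + 6 * profS s t)|
          <= K * s * tail_decay s],
      exists f1 f2, [/\ has_deriv (profS s) f1, has_deriv f1 f2 &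
        forall t, 0 < t <= r -> `|f2 t - s ^+ 2 * (- 8 * profS s t - 6 * profC s t)|
          <= K * s * tail_decay s] &
      exists f1 f2, [/\ has_deriv (prof (4 * s)) f1, has_deriv f1 f2 &
        forall t, 0 < t <= r -> `|f2 t - s ^+ 2 * (16 * prof (4 * s) t)|
          <= K * s * tail_decay s]].
Proof.
have [K K0 KP] := bump_mul_deriv2; exists K => // s s1.
have s0 : 0 <= s by rewrite (le_trans _ s1).
have [dc ds] := has_deriv_trig s.
have dec0 t : 0 <= decay s t by rewrite ltW ?decay_gt0.
have ct t : `|decay s t * cos (3 * s * t)| <= decay s t.
  by rewrite normrM (ger0_norm (dec0 t)) ler_piMr// ler_norml cos_geN1 cos_le1.
have et t : `|decay s t * sin (3 * s * t)| <= decay s t.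
  by rewrite normrM (ger0_norm (dec0 t)) ler_piMr// ler_norml sin_geN1 sin_le1.
split.
- have d2 : has_deriv
    (fun t => s * (- (decay s t * cos (3 * s * t)) - 3 * (decay s t * sin (3 * s * t))))
    (fun t => s ^+ 2 * (- 8 * (decay s t * cos (3 * s * t)) + 6 * (decay s t * sin (3 * s * t)))).
    have := has_derivZ s (has_derivD (has_derivZ (-1) dc) (has_derivZ (-3) ds)).
    under eq_fun do rewrite mulN1r mulNr; move=> h t.
    by apply: (is_derive_eq (h t)) => /=; ring.
  have [t _|f1 [f2 [df df1 fP]]] := KP s s1 _ _ _ dc d2.
    split=> //; rewrite normrM (ger0_norm s0) [leRHS](_ : _ = s * (4 * decay s t)); last by ring.
    rewrite ler_wpM2l//; apply: le_trans (ler_normB _ _) _.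
    rewrite normrN [X in _ + X]normrM (ger0_norm (ler0n R 3)).
    rewrite [leRHS](_ : _ = decay s t + 3 * decay s t); last by ring.
    by rewrite lerD// ler_wpM2l.
  exists f1, f2; split=> //.
    by move: df; rewrite /profC /prof; under eq_fun do rewrite mulrA.
  move=> t tr; have := fP t tr; congr (`|_| <= _); rewrite /profC /profS /prof.
  by ring.
- have d2 : has_deriv
    (fun t => s * (3 * (decay s t * cos (3 * s * t)) - decay s t * sin (3 * s * t)))
    (fun t => s ^+ 2 * (- 8 * (decay s t * sin (3 * s * t)) - 6 * (decay s t * cos (3 * s * t)))).
    have := has_derivZ s (has_derivD (has_derivZ 3 dc) (has_derivZ (-1) ds)).
    under eq_fun do rewrite mulN1r; move=> h t.
    by apply: (is_derive_eq (h t)) => /=; ring.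
  have [t _|f1 [f2 [df df1 fP]]] := KP s s1 _ _ _ ds d2.
    split=> //; rewrite normrM (ger0_norm s0) [leRHS](_ : _ = s * (4 * decay s t)); last by ring.
    rewrite ler_wpM2l//; apply: le_trans (ler_normB _ _) _.
    rewrite [X in X + _]normrM (ger0_norm (ler0n R 3)).
    rewrite [leRHS](_ : _ = 3 * decay s t + decay s t); last by ring.
    by rewrite lerD// ler_wpM2l.
  exists f1, f2; split=> //.
    by move: df; rewrite /profS /prof; under eq_fun do rewrite mulrA.
  move=> t tr; have := fP t tr; congr (`|_| <= _); rewrite /profC /profS /prof.
  by ring.
- have d1 := has_deriv_decay (4 * s).
  have [t t0|f1 [f2 [df df1 fP]]] := KP s s1 _ _ _ d1 (has_derivZ (- (4 * s)) d1).
    have h : decay (4 * s) t <= decay s t by apply: decay_lel; [exact: ltW|lra].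
    rewrite normrM normrN !(gtr0_norm (decay_gt0 _ _)); split=> //.
    by rewrite ger0_norm ?mulr_ge0// ler_wpM2l// mulr_ge0.
  exists f1, f2; split=> // t tr; have := fP t tr; congr (`|_| <= _).
  by rewrite /prof; ring.
Qed.

Lemma tail_decay_small (n : nat) (C e : R) : 0 <= C -> 0 < e ->
  exists2 S : R, 1 <= S & forall s, S <= s -> C * s ^+ n * tail_decay s <= e.
Proof.
move=> C0 e0; have r20 : 0 < r / 2 by rewrite divr_gt0.
pose M := C * (n.+1)`!%:R / (r / 2) ^+ n.+1.
have M0 : 0 <= M by rewrite divr_ge0 ?mulr_ge0// exprn_ge0// ltW.
exists (1 + M / e); first by rewrite lerDl divr_ge0// ltW.
move=> s Ss; have s0 : 0 < s.
  by apply: lt_le_trans Ss; rewrite ltr_wpDr// divr_ge0// ltW.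
have sM : M / e <= s by apply: le_trans Ss; rewrite lerDr.
have y0 : 0 < s * (r / 2) by rewrite mulr_gt0.
have F0 : 0 < (n.+1)`!%:R :> R by rewrite ltr0n fact_gt0.
have H : (s * (r / 2)) ^+ n.+1 / (n.+1)`!%:R <= expR (s * (r / 2)).
  by apply: le_trans (expR_ge1Dxn n (ltW y0)); rewrite lerDr.
rewrite /tail_decay /decay expRN ler_pdivrMr ?expR_gt0//.
apply: le_trans (ler_wpM2l (ltW e0) H).
rewrite exprMn exprS.
have : M <= s * e by rewrite -ler_pdivrMr.
rewrite /M ler_pdivrMr ?exprn_gt0// => MS.
rewrite mulrA ler_pdivlMr//.
have := ler_wpM2r (exprn_ge0 n (ltW s0)) MS.
by congr (_ <= _); ring.
Qed.

Lemma Rintegral_prof_le s : 0 < s -> \int[mu]_(t in `]0, r]) prof s t <= s^-1.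
Proof.
move=> s0; have cd : continuous (decay s) := smooth1_continuous (smooth1_decay s).
apply: (@le_trans _ _ (\int[mu]_(t in `]0, r]) decay s t)).
  apply: le_Rintegral => //; first exact/continuous_integrable_itv/prof_continuous.
    exact: continuous_integrable_itv.
  by move=> t _; rewrite ler_piMl ?bump_le1// ltW ?decay_gt0.
have dF : has_deriv (fun t => - s^-1 * decay s t) (decay s).
  move=> t; apply: (is_derive_eq (has_derivZ (- s^-1) (has_deriv_decay s) t)).
  by rewrite mulrA mulrNN mulVf ?mul1r// gt_eqF.
rewrite (Rintegral_derive r0 cd dF) decay0 mulr1 opprK gerDr mulNr oppr_le0.
by rewrite mulr_ge0 ?invr_ge0 ?ltW ?decay_gt0.
Qed.

(** The cut-off is 1 at 0 and 0 at r, so the boundary term is -F 0, the integral of f over the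
    half-line when F decays. The remaining integral contains b1, which lives on t >= r / 2. *)
Lemma Rintegral_by_parts_bump (F f b1 : R -> R) (L s C : R) :
  has_deriv (bump r) b1 -> smooth1 b1 -> 0 <= L -> 0 <= s -> 0 <= C ->
  (forall t, 0 < t < r / 2 -> b1 t = 0) ->
  (forall t, 0 <= t <= r -> `|b1 t| <= L) ->
  has_deriv F f -> continuous f -> (forall t, `|F t| <= C * decay s t) ->
  `|\int[mu]_(t in `]0, r]) (bump r t * f t) + F 0| <= r * (C * (L * tail_decay s)).
Proof.
move=> db sb L0 s0 C0 bz bL dF cf FC.
have cF : continuous F := has_deriv_continuous dF.
have cb : continuous (bump r) := smooth1_continuous (smooth1_bump r).
have cb1 : continuous b1 := smooth1_continuous sb.
have c1 : continuous (fun t => bump r t * f t) by move=> t; apply: cvgM; [exact: cb|exact: cf].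
have c2 : continuous (fun t => F t * b1 t) by move=> t; apply: cvgM; [exact: cF|exact: cb1].
have i1 := @continuous_integrable_itv _ _ r c1.
have i2 := @continuous_integrable_itv _ _ r c2.
have c12 : continuous (fun t => bump r t * f t + F t * b1 t).
  by move=> t; apply: cvgD; [exact: c1|exact: c2].
have := Rintegral_derive r0 c12 (has_derivM db dF).
have br : bump r r = 0 by rewrite bump0// gtr0_norm.
rewrite RintegralD// br bump0r mul0r mul1r sub0r => E.
have -> : \int[mu]_(t in `]0, r]) (bump r t * f t) + F 0 =
  - \int[mu]_(t in `]0, r]) (F t * b1 t) by lra.
rewrite normrN; apply: le_trans (le_normr_Rintegral _ i2) _ => //.
have -> : r * (C * (L * tail_decay s)) =
    \int[mu]_(t in `]0, r]) (C * (L * tail_decay s)).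
  have muE : mu (`]0, r]%classic : set (measurableTypeR R)) = r%:E.
    by rewrite lebesgue_measure_itv/= lte_fin r0 -EFinD subr0.
  by rewrite Rintegral_cst// [X in fine X](_ : _ = r%:E) 1?mulrC//; exact: muE.
apply: le_Rintegral => //.
- by apply: (@continuous_integrable_itv _ (fun t => `|F t * b1 t|)) => t;
    apply: cvg_norm; exact: c2.
- by apply: continuous_integrable_itv => t; exact: cvg_cst.
move=> t; rewrite /= in_itv/= => tr; have h := mul_decay_le L0 s0 bz bL tr.
rewrite normrM; apply: (@le_trans _ _ (C * decay s t * `|b1 t|)).
  by rewrite ler_wpM2r.
by rewrite -mulrA ler_wpM2l// mulrC.
Qed.

(** Over the whole half-line and without cut-off the integral is Re (1 / ((1 - 3i) s)) = 1 / (10 s);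
    for large s the cut-off costs at most half of it. *)
Lemma Rintegral_profC_ge : exists2 S : R, 1 <= S & forall s, S <= s ->
  (20 * s)^-1 <= \int[mu]_(t in `]0, r]) profC s t.
Proof.
have [b1 [b2 [L [[db db1] [sb _] L0 bz bL]]]] := bump_deriv.
have [S S1 SP] := @tail_decay_small 0 (8 * (r * L)) 1 ltac:(by rewrite !mulr_ge0// ltW) ltr01.
exists S => // s Ss; have s1 : 1 <= s by exact: le_trans Ss.
have s0 : 0 < s by exact: lt_le_trans s1.
have [dc ds] := has_deriv_trig s.
pose F t := (10 * s)^-1 * (3 * (decay s t * sin (3 * s * t)) - decay s t * cos (3 * s * t)).
pose f t := decay s t * cos (3 * s * t).
have dF : has_deriv F f.
  have := has_derivZ (10 * s)^-1 (has_derivD (has_derivZ 3 ds) (has_derivZ (-1) dc)).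
  under eq_fun do rewrite mulN1r; move=> h t.
  by apply: (is_derive_eq (h t)) => /=; rewrite /f; field; rewrite gt_eqF.
have cf : continuous f := has_deriv_continuous dc.
have dec0 t : 0 <= decay s t by rewrite ltW ?decay_gt0.
have FC t : `|F t| <= (4 * (10 * s)^-1) * decay s t.
  rewrite normrM gtr0_norm ?invr_gt0 ?mulr_gt0// [leRHS](_ : _ = (10 * s)^-1 * (3 * decay s t + decay s t)); last by ring.
  apply: ler_wpM2l; first by rewrite invr_ge0 mulr_ge0// ltW.
  apply: le_trans (ler_normB _ _) _; rewrite !normrM (ger0_norm (dec0 t)) ger0_norm//.
  apply: lerD; first by rewrite ler_wpM2l// ler_piMr// ler_norml sin_geN1 sin_le1.
  by rewrite ler_piMr// ler_norml cos_geN1 cos_le1.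
have C0 : 0 <= 4 * (10 * s)^-1 by rewrite mulr_ge0// invr_ge0 mulr_ge0// ltW.
have := Rintegral_by_parts_bump db sb L0 (ltW s0) C0 (fun t tr => (bz t tr).1)
  (fun t tr => (bL t tr).1) dF cf FC.
have -> : F 0 = - (10 * s)^-1 by rewrite /F !mulr0 sin0 cos0 decay0 mulr0; ring.
have -> : \int[mu]_(t in `]0, r]) (bump r t * f t) = \int[mu]_(t in `]0, r]) profC s t.
  by apply: eq_Rintegral => t _; rewrite /f /profC /prof mulrA.
set I := Rintegral _ _ _; rewrite ler_norml => /andP[h _].
have := SP s Ss; rewrite expr0 mulr1 => T.
have h2 : r * (4 * (10 * s)^-1 * (L * tail_decay s)) <= (20 * s)^-1.
  have -> : r * (4 * (10 * s)^-1 * (L * tail_decay s)) =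
    (20 * s)^-1 * (8 * (r * L) * tail_decay s) by field; rewrite gt_eqF.
  by rewrite ler_piMr// invr_ge0 mulr_ge0// ltW.
have e : (10 * s)^-1 = 2 * (20 * s)^-1 by field; rewrite gt_eqF.
by lra.
Qed.

Lemma Rintegral_prof_ge : exists2 S : R, 1 <= S & forall s, S <= s ->
  (2 * s)^-1 <= \int[mu]_(t in `]0, r]) prof s t.
Proof.
have [b1 [b2 [L [[db db1] [sb _] L0 bz bL]]]] := bump_deriv.
have [S S1 SP] := @tail_decay_small 0 (2 * (r * L)) 1 ltac:(by rewrite !mulr_ge0// ltW) ltr01.
exists S => // s Ss; have s1 : 1 <= s by exact: le_trans Ss.
have s0 : 0 < s by exact: lt_le_trans s1.
pose F t := - s^-1 * decay s t.
have dF : has_deriv F (decay s).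
  move=> t; apply: (is_derive_eq (has_derivZ (- s^-1) (has_deriv_decay s) t)).
  by rewrite mulrA mulrNN mulVf ?mul1r// gt_eqF.
have cf : continuous (decay s) := smooth1_continuous (smooth1_decay s).
have FC t : `|F t| <= s^-1 * decay s t.
  by rewrite normrM normrN (gtr0_norm (decay_gt0 s t)) gtr0_norm ?invr_gt0.
have C0 : 0 <= s^-1 by rewrite invr_ge0 ltW.
have := Rintegral_by_parts_bump db sb L0 (ltW s0) C0 (fun t tr => (bz t tr).1)
  (fun t tr => (bL t tr).1) dF cf FC.
have -> : F 0 = - s^-1 by rewrite /F decay0 mulr1.
rewrite -/(prof s); set I := Rintegral _ _ _; rewrite ler_norml => /andP[h _].
have := SP s Ss; rewrite expr0 mulr1 => T.
have h2 : r * (s^-1 * (L * tail_decay s)) <= (2 * s)^-1.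
  have -> : r * (s^-1 * (L * tail_decay s)) =
    (2 * s)^-1 * (2 * (r * L) * tail_decay s) by field; rewrite gt_eqF.
  by rewrite ler_piMr// invr_ge0 mulr_ge0// ltW.
have e : s^-1 = 2 * (2 * s)^-1 by field; rewrite gt_eqF.
by lra.
Qed.

Lemma prof_deriv : exists2 L : R, 0 <= L & forall s, 0 <= s ->
  exists p1, [/\ has_deriv (prof s) p1, smooth1 p1 &
    forall t, 0 < t <= r -> `|p1 t + s * prof s t| <= L * tail_decay s].
Proof.
have [b1 [b2 [L [[db db1] [sb _] L0 bz bL]]]] := bump_deriv.
exists L => // s s0; exists (fun t => bump r t * (- s * decay s t) + decay s t * b1 t).
split; first exact: has_derivM (has_deriv_decay s).
  apply: smooth1D; first apply: smooth1M; first exact: smooth1_bump.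
    by apply: smooth1M; [exact: smooth1_cst|exact: smooth1_decay].
  by apply: smooth1M => //; exact: smooth1_decay.
move=> t tr; rewrite [X in `|X|](_ : _ = b1 t * decay s t); last by rewrite /prof; ring.
rewrite normrM (gtr0_norm (decay_gt0 _ _)).
exact: mul_decay_le L0 s0 (fun t tr => (bz t tr).1) (fun t tr => (bL t tr).1) tr.
Qed.

End profiles.

(** * Integration by parts and weighted estimates on the box *)

Section L2r.
Context d (T : measurableType d) (R : realType) (m : {measure set T -> \bar R}).
Variable D : set T.
Hypothesis mD : measurable D.
Implicit Types f g : T -> R.

Definition L2r f := measurable_fun D f /\ m.-integrable D (fun x => (f x ^+ 2)%:E).

Definition sqn f : R := \int[m]_(x in D) (f x ^+ 2).

Lemma sqn_ge0 f : 0 <= sqn f.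
Proof. by apply: Rintegral_ge0 => x _; exact: sqr_ge0. Qed.

Lemma le_integrableR f g : measurable_fun D f ->
  m.-integrable D (EFin \o g) -> (forall x, D x -> `|f x| <= g x) ->
  m.-integrable D (EFin \o f).
Proof.
move=> mf ig fg; apply: le_integrable ig => //; first exact/measurable_EFinP.
move=> x Dx /=; rewrite lee_fin; apply: le_trans (fg x Dx) _; exact: ler_norm.
Qed.

Lemma integrableDR f g : m.-integrable D (EFin \o f) ->
  m.-integrable D (EFin \o g) -> m.-integrable D (EFin \o (fun x => f x + g x)).
Proof. by move=> If Ig; have := integrableD mD If Ig; apply: eq_integrable. Qed.

Lemma integrableZR f a : m.-integrable D (EFin \o f) ->
  m.-integrable D (EFin \o (fun x => a * f x)).
Proof. by move=> If; have := integrableZl mD a If; apply: eq_integrable. Qed.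

Lemma L2r_mul f g : L2r f -> L2r g -> m.-integrable D (EFin \o (fun x => f x * g x)).
Proof.
move=> [mf If] [mg Ig]; apply: le_integrableR (integrableDR If Ig) _ => //.
  exact: measurable_funM.
move=> x _ /=; rewrite ler_norml; have := sqr_ge0 (f x - g x).
have := sqr_ge0 (f x + g x); have := sqr_ge0 (f x); have := sqr_ge0 (g x).
by rewrite sqrrB sqrrD => *; apply/andP; split; lra.
Qed.

Lemma L2rZ f a : L2r f -> L2r (fun x => a * f x).
Proof.
move=> [mf If]; split; first exact: measurable_funM.
by have := integrableZR (a ^+ 2) If; under eq_fun do rewrite /= -exprMn.
Qed.

Lemma L2rD f g : L2r f -> L2r g -> L2r (fun x => f x + g x).
Proof.
move=> Lf Lg; have [mf If] := Lf; have [mg Ig] := Lg.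
split; first exact: measurable_funD.
have := integrableDR (integrableDR If (integrableZR 2 (L2r_mul Lf Lg))) Ig.
by apply: eq_integrable => // x _ /=; congr EFin; ring.
Qed.

Lemma L2rB f g : L2r f -> L2r g -> L2r (fun x => f x - g x).
Proof.
move=> Lf Lg; have := L2rD Lf (L2rZ (-1) Lg).
by under [X in L2r X]eq_fun do rewrite mulN1r.
Qed.

Lemma sqn_le2 f g : L2r f -> L2r g -> sqn f <= 2 * sqn g + 2 * sqn (fun x => f x - g x).
Proof.
move=> Lf Lg; have LB := L2rB Lf Lg.
have [_ If] := Lf; have [_ Ig] := Lg; have [_ IB] := LB.
rewrite /sqn -!RintegralZl// -RintegralD//; [|exact: integrableZR..].
apply: le_Rintegral => //; first by apply: integrableDR; exact: integrableZR.
by move=> x _; have := sqr_ge0 (f x - 2 * g x); rewrite !sqrrB; lra.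
Qed.

(** Young's inequality with a free weight a, in the role of Cauchy-Schwarz. *)
Lemma le_normr_RintegralM f g (a : R) : 0 < a -> L2r f -> L2r g ->
  `|\int[m]_(x in D) (f x * g x)| <= (a * sqn g + a^-1 * sqn f) / 2.
Proof.
move=> a0 Lf Lg; have [_ If] := Lf; have [_ Ig] := Lg; have Ifg := L2r_mul Lf Lg.
apply: le_trans (le_normr_Rintegral mD Ifg) _.
have -> : (a * sqn g + a^-1 * sqn f) / 2 =
    \int[m]_(x in D) ((a / 2) * g x ^+ 2 + (a^-1 / 2) * f x ^+ 2).
  rewrite RintegralD//; [|exact: integrableZR..].
  by rewrite !RintegralZl// /sqn; ring.
apply: le_Rintegral => //.
- exact: integrable_norm.
- by apply: integrableDR; exact: integrableZR.
move=> x _; rewrite -(real_normK (num_real (g x))) -(real_normK (num_real (f x))) normrM.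
move: (`|f x|) (`|g x|) => p q; have := sqr_ge0 (a * q - p).
rewrite sqrrB exprMn => h.
have ha : 0 <= (2 * a)^-1 by rewrite invr_ge0 mulr_ge0// ltW.
have := mulr_ge0 ha h.
have -> : (2 * a)^-1 * (a ^+ 2 * q ^+ 2 - a * q * p *+ 2 + p ^+ 2) =
  a / 2 * q ^+ 2 + a^-1 / 2 * p ^+ 2 - p * q by field; rewrite gt_eqF.
by lra.
Qed.

(** For g fixed and f tending to 0 in L^2 this is the continuity of the pairing, with a bound linear
    in e. *)
Lemma pairing_small f g (e : R) : 0 < e -> L2r f -> L2r g -> sqn f <= e ^+ 2 ->
  `|\int[m]_(x in D) (f x * g x)| <= e * (sqn g + 1).
Proof.
move=> e0 Lf Lg fe; apply: le_trans (le_normr_RintegralM e0 Lf Lg) _.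
have g0 := sqn_ge0 g.
have : e^-1 * sqn f <= e.
  by rewrite ler_pdivrMl// -expr2.
have : 0 <= e * sqn g by rewrite mulr_ge0// ltW.
by rewrite mulrDr mulr1; lra.
Qed.

End L2r.

(** * Green's formula on the box *)

Section box_analysis.
Context {R : realType}.
Notation mR := (measurableTypeR R).
Notation mR2 := (mR * mR)%type.
Notation mE3 := (E3 mR).
Notation mu := (@lebesgue_measure R).

Lemma continuousX_real (T : topologicalType) (f : T -> R) :
  continuous f -> continuous (fun x => f x ^+ 2).
Proof. by move=> cf x; under eq_fun do rewrite expr2; apply: cvgM; exact: cf. Qed.

Lemma continuousM_real (T : topologicalType) (f g : T -> R) :
  continuous f -> continuous g -> continuous (fun x => f x * g x).
Proof. by move=> cf cg x; apply: cvgM; [exact: cf|exact: cg]. Qed.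

Lemma continuousD_real (T : topologicalType) (f g : T -> R) :
  continuous f -> continuous g -> continuous (fun x => f x + g x).
Proof. by move=> cf cg x; apply: cvgD; [exact: cf|exact: cg]. Qed.

Lemma continuous_L2r_box (f : E3 R -> R) r : continuous f ->
  L2r leb3 (box r : set mE3) f.
Proof.
move=> cf; split.
  by apply: (@measurable_funTS _ _ mE3 _ _ f); exact: continuous_measurable3.
by apply: (continuous_integrable_box (f := fun x => f x ^+ 2)); exact: continuousX_real.
Qed.

Lemma continuous_L2r_sq (f : R * R -> R) r : continuous f ->
  L2r leb2 (sq r : set mR2) f.
Proof.
move=> cf; split.
  by apply: (@measurable_funTS _ _ mR2 _ _ f); exact: continuous_measurable2.
by apply: (continuous_integrable_sq (f := fun x => f x ^+ 2)); exact: continuousX_real.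
Qed.

(** The inequality is not strict: f then vanishes on the far faces of the box, which contribute no
    boundary term. *)
Definition vanishes_outside (r : R) (f : E3 R -> R) :=
  forall x, (exists i, r <= `|coord i x|) -> f x = 0.

(** Differentiating a function that vanishes outside the cube gives zero at first only on the open
    exterior; continuity along an outward line recovers the boundary of the cube. *)
Lemma vanishes_outside_continuous r (g : E3 R -> R) : continuous g ->
  (forall x, (exists i, r < `|coord i x|) -> g x = 0) -> vanishes_outside r g.
Proof.
move=> cg g0 x [i xr]; apply/eqP; apply/negPn/negP => gx.
pose e : E3 R := (if 0 <= coord i x then 1 else -1) *: vece i.
have cl : continuous (fun t : R => g (x + t *: e)).
  exact: (@continuous_compT R (E3 R) R (fun t => x + t *: e) _ (@continuous_line _ x e) cg).
have g0n : g (x + (0 : R) *: e) != 0 by rewrite scale0r addr0.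
have : \forall t \near (0 : R)^'+, g (x + t *: e) != 0.
  have H := cvg_at_right_filter (cl 0).
  apply: (H [set y | y != 0]); apply: open_nbhs_nbhs; split=> //.
move=> nz; near (0 : R)^'+ => t.
have : g (x + t *: e) != 0 by near: t.
rewrite g0 ?eqxx//; exists i; have t0 : 0 < t by near: t; exact: nbhs_right_gt.
rewrite coordD !coordZ coord_vece eqxx mulr1; case: ifPn => xi.
  by rewrite mulr1; move: xr; rewrite !ger0_norm// ?addr_ge0// ?(ltW t0)//; lra.
rewrite -ltNge in xi; rewrite mulrN1.
by move: xr; rewrite !ltr0_norm//; lra.
Unshelve. all: by end_near. Qed.

Lemma partial_vanishes r f i : smooth f -> vanishes_outside r f ->
  vanishes_outside r (partial i f).
Proof.
move=> sf vf; apply: vanishes_outside_continuous.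
  exact: smooth_continuous (smooth_partial i sf).
move=> x [j xr]; rewrite /partial (_ : 'D_(vece i) f x = 'D_(vece i) (cst 0) x).
  exact: derive_cst.
apply: near_eq_derive.
have cn : continuous (fun y : E3 R => `|coord j y|).
  by move=> y; apply: cvg_norm; exact: continuous_coord.
have : \forall y \near x, r < `|coord j y|.
  by have := cn x [set y : R | r < y]; apply; exact: lt_nbhsr.
by apply: filterS => y yr; apply: vf; exists j; exact: ltW.
Qed.

Lemma Rintegral_ibp r (f psi : E3 R -> R) i : 0 < r -> smooth f -> smooth psi ->
  vanishes_outside r psi ->
  \int[leb3]_(x in box r) (partial i f x * psi x) +
  \int[leb3]_(x in box r) (f x * partial i psi x) =
  - \int[leb2]_(p in sq r) (f (insert i p) * psi (insert i p)).
Proof.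
move=> r0 sf sp vp; have sM := smoothM sf sp.
have cf := smooth_continuous sf; have cp := smooth_continuous sp.
have cdf := smooth_continuous (smooth_partial i sf).
have cdp := smooth_continuous (smooth_partial i sp).
have df x : derivable f x (vece i) by exact: smooth_derivable.
have dp x : derivable psi x (vece i) by exact: smooth_derivable.
have vM x : coord i x = r -> f x * psi x = 0.
  by move=> xr; rewrite vp ?mulr0//; exists i; rewrite xr gtr0_norm.
have E := Rintegral_partial_box r0 (smooth_continuous sM)
  (fun x => @smooth_derivable _ _ i x sM) (smooth_continuous (smooth_partial i sM)) vM.
rewrite -E partialM//.
rewrite -RintegralD.
- by apply: eq_Rintegral => x _; rewrite addrC (mulrC (psi x)).
- exact: measurable_box.
- exact: (continuous_integrable_box r (continuousM_real cdf cp)).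
- exact: (continuous_integrable_box r (continuousM_real cf cdp)).
Qed.

Lemma laplacianE (psi : E3 R -> R) x : laplacian psi x =
  partial ord0 (partial ord0 psi) x +
  (partial (lift ord0 ord0) (partial (lift ord0 ord0) psi) x +
   partial (lift ord0 (lift ord0 ord0)) (partial (lift ord0 (lift ord0 ord0)) psi) x).
Proof.
have H (F : 'I_3 -> R) : \sum_(i < 3) F i =
    F ord0 + (F (lift ord0 ord0) + F (lift ord0 (lift ord0 ord0))).
  by rewrite !big_ord_recl big_ord0 addr0.
exact: (H (fun i => partials [:: i; i] psi x)).
Qed.

Let combine (a b c p q X Y e x y z : R) : a + b = - c -> X = a - p -> Y = b - q ->
  `|X| <= e * x -> `|Y| <= e * y -> `|c| <= e * z ->
  `|p + q| <= e * (x + y + z).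
Proof.
move=> abc EX EY hX hY hc; have -> : p + q = - X - Y - c by lra.
rewrite !mulrDr; apply: le_trans (ler_normB _ _) _; apply: lerD => //.
by apply: le_trans (ler_normB _ _) _; rewrite normrN; apply: lerD.
Qed.

(** [G] is only a weak gradient, so the integration by parts is done for smooth f near u. Its
    boundary term pairs f with a derivative of psi on the near faces, and vanishes in the limit
    because u has zero trace in the sense of the last hypothesis. *)
Lemma green_box r (u : E3 R -> R) (G : 'I_3 -> E3 R -> R) (psi : E3 R -> R) :
  0 < r -> L2r leb3 (box r : set mE3) u ->
  (forall i, L2r leb3 (box r : set mE3) (G i)) ->
  smooth psi -> vanishes_outside r psi ->
  (forall e, 0 < e -> exists f, [/\ smooth f,
    sqn leb3 (box r : set mE3) (fun x => f x - u x) <= e ^+ 2,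
    forall i, sqn leb3 (box r : set mE3) (fun x => partial i f x - G i x) <= e ^+ 2 &
    forall i, sqn leb2 (sq r : set mR2) (f \o insert i) <= e ^+ 2]) ->
  \sum_(i < 3) \int[leb3]_(x in box r) (G i x * partial i psi x) =
  - \int[leb3]_(x in box r) (u x * laplacian psi x).
Proof.
move=> r0 Lu LG sp vp approx; apply/eqP; rewrite -addr_eq0 -normr_le0.
have mB := measurable_box r; have mS := measurable_sq r.
have sdp i := smooth_partial i sp; have cdp i := smooth_continuous (sdp i).
have Ldp i := continuous_L2r_box r (cdp i).
have cddp i : continuous (partial i (partial i psi)).
  exact: smooth_continuous (smooth_partial i (sdp i)).
have Lddp i := continuous_L2r_box r (cddp i).
have Lsp i : L2r leb2 (sq r : set mR2) (partial i psi \o insert i).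
  apply: continuous_L2r_sq; exact: continuous_compT (@continuous_insert _ i) (cdp i).
(* This constant depends on psi and r alone, so the error e C tends to 0 with e. *)
pose C := \sum_(i < 3) ((sqn leb3 (box r : set mE3) (partial i psi) + 1) +
  (sqn leb3 (box r : set mE3) (partial i (partial i psi)) + 1) +
  (sqn leb2 (sq r : set mR2) (partial i psi \o insert i) + 1)).
have C0 : 0 <= C.
  by apply: sumr_ge0 => i _; rewrite !addr_ge0// sqn_ge0.
suff H e : 0 < e -> `|\sum_(i < 3) \int[leb3]_(x in box r) (G i x * partial i psi x) +
    \int[leb3]_(x in box r) (u x * laplacian psi x)| <= e * C.
  apply/ler_addgt0Pl => e e0; rewrite addr0.
  apply: le_trans (H (e / (C + 1)) _) _; first by rewrite divr_gt0// ltr_wpDl.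
  rewrite mulrAC ler_pdivrMr; last by rewrite ltr_wpDl.
  by apply: ler_wpM2l; [exact: ltW|rewrite lerDl].
move=> e0; have [f [sf fu fG fS]] := approx e e0.
have cf := smooth_continuous sf; have Lf := continuous_L2r_box r cf.
have cdf i := smooth_continuous (smooth_partial i sf).
have Ldf i := continuous_L2r_box r (cdf i).
have -> : \int[leb3]_(x in box r) (u x * laplacian psi x) =
    \sum_(i < 3) \int[leb3]_(x in box r) (u x * partial i (partial i psi) x).
  pose a i x := u x * partial i (partial i psi) x.
  have Ia i : leb3.-integrable (box r : set mE3) (EFin \o a i) by exact: L2r_mul.
  rewrite (_ : \int[leb3]_(x in box r) (u x * laplacian psi x) =
    \int[leb3]_(x in box r) (a ord0 x + (a (lift ord0 ord0) x + a (lift ord0 (lift ord0 ord0)) x))).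
    rewrite (RintegralD mB (Ia _) (integrableDR mB (Ia _) (Ia _))).
    rewrite (RintegralD mB (Ia _) (Ia _)).
    have H (F : 'I_3 -> R) : F ord0 + (F (lift ord0 ord0) + F (lift ord0 (lift ord0 ord0))) = \sum_(i < 3) F i.
      by rewrite !big_ord_recl big_ord0 addr0.
    exact: (H (fun i => \int[leb3]_(x in box r) a i x)).
  apply: eq_Rintegral => x _.
  rewrite laplacianE mulrDr mulrDr; exact: erefl.
rewrite -big_split/=; apply: le_trans (ler_norm_sum _ _ _) _.
rewrite mulr_sumr; apply: ler_sum => i _.
have := Rintegral_ibp i r0 sf (sdp i) (partial_vanishes i sp vp).
move=> abc.
have E1 := RintegralB mB (L2r_mul mB (Ldf i) (Ldp i)) (L2r_mul mB (LG i) (Ldp i)).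
have E2 := RintegralB mB (L2r_mul mB Lf (Lddp i)) (L2r_mul mB Lu (Lddp i)).
have B1 := pairing_small mB e0 (L2rB mB (Ldf i) (LG i)) (Ldp i) (fG i).
have B2 := pairing_small mB e0 (L2rB mB Lf Lu) (Lddp i) fu.
have Lfi : L2r leb2 (sq r : set mR2) (f \o insert i).
  by apply: continuous_L2r_sq; exact: continuous_compT (@continuous_insert _ i) cf.
have B3 := pairing_small mS e0 Lfi (Lsp i) (fS i).
apply: (combine abc _ _ B1 B2 B3).
  by rewrite -E1; apply: eq_Rintegral => x _; rewrite mulrBl.
by rewrite -E2; apply: eq_Rintegral => x _; rewrite mulrBl.
Qed.

End box_analysis.

(** * Exponential weights with a separate normal rate *)

Section weights.
Context {R : realType}.
Notation mR := (measurableTypeR R).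
Notation mR2 := (mR * mR)%type.
Notation mE3 := (E3 mR).
Notation mu := (@lebesgue_measure R).
Variable r : R.
Hypothesis r0 : 0 < r.

Definition tensor_at (i : 'I_3) (a b : R -> R) : E3 R -> R :=
  match val i with
  | 0 => tensor a b b | 1 => tensor b a b | _ => tensor b b a
  end.

Lemma smooth_tensor_at i a b : smooth1 a -> smooth1 b -> smooth (tensor_at i a b).
Proof. by rewrite /tensor_at; case: i => [[|[|m]] ilt] sa sb; exact: smooth_tensor. Qed.

Lemma partial_tensor_at i a a' b b' : has_deriv a a' -> has_deriv b b' ->
  partial i (tensor_at i a b) = tensor_at i a' b.
Proof.
move=> da db; rewrite /tensor_at; case: i => [[|[|[|//]]] ilt] /=.
- by rewrite (partial_tensor _ da db db).
- by rewrite (partial_tensor _ db da db).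
- by rewrite (partial_tensor _ db db da).
Qed.

Definition weight s : E3 R -> R := tensor (prof r s) (prof r s) (prof r s).
(** The rate is t in direction i and s in the two others. On the plane x_i = 0 the value does not
    depend on t, so the normal rate can be tuned without changing a face integral. *)
Definition weight_at i s t : E3 R -> R := tensor_at i (prof r t) (prof r s).

Lemma tensor_vanishes (a b c : R -> R) :
  (forall t, r <= `|t| -> a t = 0) -> (forall t, r <= `|t| -> b t = 0) ->
  (forall t, r <= `|t| -> c t = 0) -> vanishes_outside r (tensor a b c).
Proof.
move=> a0 b0 c0 x [i xr]; move: xr; rewrite /tensor /coord.
by case: i => [[|[|m]] ilt] /= xr; rewrite ?(a0 _ xr) ?(b0 _ xr) ?(c0 _ xr) ?mul0r ?mulr0 ?mul0r.
Qed.

Lemma weight_at_vanishes i s t : vanishes_outside r (weight_at i s t).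
Proof.
have p0 u v : r <= `|v| -> prof r u v = 0 by exact: prof_out.
by rewrite /weight_at /tensor_at; case: i => [[|[|m]] ilt]; apply: tensor_vanishes;
  move=> v; exact: p0.
Qed.

Lemma weightE i s : weight s = weight_at i s s.
Proof. by rewrite /weight /weight_at /tensor_at; case: i => [[|[|m]] ilt]. Qed.

Lemma weight_at_insert i s t p : weight_at i s t (insert i p) = weight s (insert i p).
Proof.
rewrite /weight /weight_at /tensor_at /insert; case: i => [[|[|m]] ilt];
  by rewrite /tensor/= !prof_at0.
Qed.

Lemma smooth_weight_at i s t : smooth (weight_at i s t).
Proof. by apply: smooth_tensor_at; exact: smooth1_prof. Qed.

Lemma weight_at_ge0 i s t x : 0 <= weight_at i s t x.
Proof.
rewrite /weight_at /tensor_at; case: i => [[|[|m]] ilt];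
  exact: (mulr_ge0 (mulr_ge0 (prof_ge0 _ _ _) (prof_ge0 _ _ _)) (prof_ge0 _ _ _)).
Qed.

Lemma weight_at_le1 i s t x : 0 <= s -> 0 <= t -> (forall i, 0 <= coord i x) ->
  weight_at i s t x <= 1.
Proof.
move=> s0 t0 x0; have x1 := x0 (@Ordinal 3 0 isT); have x2 := x0 (@Ordinal 3 1 isT).
have x3 := x0 (@Ordinal 3 2 isT); rewrite /coord/= in x1 x2 x3.
have H (a b c : R) : 0 <= a -> 0 <= b -> 0 <= c -> a <= 1 -> b <= 1 -> c <= 1 ->
    a * b * c <= 1.
  by move=> *; rewrite !mulr_ile1// mulr_ge0.
rewrite /weight_at /tensor_at; case: i => [[|[|m]] ilt];
  exact: (H _ _ _ (prof_ge0 _ _ _) (prof_ge0 _ _ _) (prof_ge0 _ _ _)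
    (prof_le1 _ _ _) (prof_le1 _ _ _) (prof_le1 _ _ _)).
Qed.

Lemma Rintegral_weight_at_le i s t : 0 < s -> 0 < t ->
  \int[leb3]_(x in box r) weight_at i s t x <= (s ^+ 2 * t)^-1.
Proof.
move=> s0 t0.
have cs := @prof_continuous _ r s; have ct := @prof_continuous _ r t.
have ps := Rintegral_prof_le r0 s0; have pt := Rintegral_prof_le r0 t0.
have ps0 : 0 <= \int[mu]_(u in `]0, r]) prof r s u.
  by apply: Rintegral_ge0 => u _; exact: prof_ge0.
have pt0 : 0 <= \int[mu]_(u in `]0, r]) prof r t u.
  by apply: Rintegral_ge0 => u _; exact: prof_ge0.
have alg1 (a b : R) : a * b * b = b ^+ 2 * a by ring.
have alg2 (a b : R) : b * a * b = b ^+ 2 * a by ring.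
have alg3 (a b : R) : b * b * a = b ^+ 2 * a by ring.
have E : \int[leb3]_(x in box r) weight_at i s t x =
  (\int[mu]_(u in `]0, r]) prof r s u) ^+ 2 * \int[mu]_(u in `]0, r]) prof r t u.
  rewrite /weight_at /tensor_at; case: i => [[|[|m]] ilt] /=.
  - exact: etrans (Rintegral_box_prod r ct cs cs) (alg1 _ _).
  - exact: etrans (Rintegral_box_prod r cs ct cs) (alg2 _ _).
  - exact: etrans (Rintegral_box_prod r cs cs ct) (alg3 _ _).
rewrite E invfM -exprVn; apply: ler_pM => //; first exact: exprn_ge0.
by rewrite lerXn2r// nnegrE// invr_ge0 ltW.
Qed.

Lemma partial_weight_at : exists2 L : R, 0 <= L & forall i s t, 0 <= s -> 0 <= t ->
  forall x, box r x ->
  `|partial i (weight_at i s t) x + t * weight_at i s t x| <= L * tail_decay r t.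
Proof.
have [L L0 LP] := prof_deriv r0; exists L => // i s t s0 t0 x /boxP xr.
have [p1 [dp _ pP]] := LP t t0; have [q1 [dq _ _]] := LP s s0.
rewrite /weight_at (partial_tensor_at i dp dq).
have bnd (a b c d : R) : `|a| <= L * tail_decay r t -> 0 <= b <= 1 -> 0 <= c <= 1 ->
    `|d| = `|a| * (b * c) -> `|d| <= L * tail_decay r t.
  move=> ha /andP[b0 b1] /andP[c0 c1] ->.
  by apply: le_trans ha; rewrite ler_piMr// mulr_ile1.
have x1 := xr (@Ordinal 3 0 isT); have x2 := xr (@Ordinal 3 1 isT).
have x3 := xr (@Ordinal 3 2 isT); rewrite /coord/= in x1 x2 x3.
have pr v : 0 < v <= r -> 0 <= prof r s v <= 1.
  by move=> /andP[v0 _]; rewrite prof_ge0 prof_le1// ltW.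
have nn v : 0 <= prof r s v := prof_ge0 _ _ _.
rewrite /tensor_at; case: i => [[|[|m]] ilt] /=; rewrite /tensor.
- apply: (bnd _ _ _ _ (pP _ x1) (pr _ x2) (pr _ x3)).
  by rewrite -[in RHS](ger0_norm (mulr_ge0 (nn _) (nn _))) -normrM; congr (`|_|); ring.
- apply: (bnd _ _ _ _ (pP _ x2) (pr _ x1) (pr _ x3)).
  by rewrite -[in RHS](ger0_norm (mulr_ge0 (nn _) (nn _))) -normrM; congr (`|_|); ring.
- apply: (bnd _ _ _ _ (pP _ x3) (pr _ x1) (pr _ x2)).
  by rewrite -[in RHS](ger0_norm (mulr_ge0 (nn _) (nn _))) -normrM; congr (`|_|); ring.
Qed.

End weights.

Section combination.
Context d (T : measurableType d) (R : realType) (m : {measure set T -> \bar R}).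
Variable D : set T.
Hypothesis mD : measurable D.

Lemma le_Rintegral_comb (F a b c : T -> R) (x y z : R) :
  m.-integrable D (EFin \o F) -> m.-integrable D (EFin \o a) ->
  m.-integrable D (EFin \o b) -> m.-integrable D (EFin \o c) ->
  (forall t, D t -> F t <= x * a t + y * b t + z * c t) ->
  \int[m]_(t in D) F t <=
  x * \int[m]_(t in D) a t + y * \int[m]_(t in D) b t + z * \int[m]_(t in D) c t.
Proof.
move=> iF ia ib ic le.
have ixa := integrableZR mD x ia; have iyb := integrableZR mD y ib.
have izc := integrableZR mD z ic; have iab := integrableDR mD ixa iyb.
rewrite -(RintegralZl x mD ia) -(RintegralZl y mD ib) -(RintegralZl z mD ic).
rewrite -(RintegralD mD ixa iyb) -(RintegralD mD iab izc).
by apply: le_Rintegral => //; exact: integrableDR.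
Qed.

End combination.

(** * Weighted Poincare and trace inequalities *)

Section weighted_estimates.
Context {R : realType}.
Notation mR := (measurableTypeR R).
Notation mR2 := (mR * mR)%type.
Notation mE3 := (E3 mR).
Variable r : R.
Hypothesis r0 : 0 < r.
Variables (i : 'I_3) (u G : E3 R -> R).
Hypothesis Lu : L2r leb3 (box r : set mE3) u.
Hypothesis LG : L2r leb3 (box r : set mE3) G.

Let mB := @measurable_box R r.
Let mS := @measurable_sq R r.

Let box_ge0 (x : E3 R) : box r x -> forall j, 0 <= coord j x.
Proof. by move=> /boxP xr j; have /andP[/ltW] := xr j. Qed.

Lemma insert_sq_itv p : sq r p -> forall j, 0 <= coord j (insert i p) <= r.
Proof.
rewrite /sq /= !in_itv /= => -[/andP[p1 p1r] /andP[p2 p2r]] j.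
rewrite /coord /insert; case: i => [[|[|m]] ilt]; case: j => [[|[|n]] jlt] /=;
  by rewrite ?lexx ?(ltW r0)// ?(ltW p1) ?(ltW p2).
Qed.

Let insert_ge0 p : sq r p -> forall j, 0 <= coord j (insert i p).
Proof. by move=> pr j; have /andP[] := insert_sq_itv pr j. Qed.

Lemma ibp_square (f w : E3 R -> R) : smooth f -> smooth w -> vanishes_outside r w ->
  \int[leb2]_(p in sq r) (f (insert i p) ^+ 2 * w (insert i p)) =
  - \int[leb3]_(x in box r)
     (2 * f x * partial i f x * w x + f x ^+ 2 * partial i w x).
Proof.
move=> sf sw vw; have sff := smoothM sf sf.
have cf := smooth_continuous sff; have cw := smooth_continuous sw.
have cdf := smooth_continuous (smooth_partial i sff).
have cdw := smooth_continuous (smooth_partial i sw).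
have E := Rintegral_ibp i r0 sff sw vw.
under eq_Rintegral do rewrite expr2.
rewrite -[LHS]opprK -E.
rewrite -(RintegralD mB (continuous_integrable_box r (continuousM_real cdf cw))
  (continuous_integrable_box r (continuousM_real cf cdw))).
have df y : derivable f y (vece i) by exact: smooth_derivable.
congr (- _); apply: eq_Rintegral => x _; rewrite (partialM df df).
by ring.
Qed.

Let poincare_pointwise (s L t  dw df fx wx : R) : 0 < s -> 0 <= wx -> wx <= 1 ->
  dw + s * wx <= L * t ->
  2 * fx * df * wx + fx ^+ 2 * dw <=
  - (s / 2) * (fx ^+ 2 * wx) + 2 / s * df ^+ 2 + L * t * fx ^+ 2.
Proof.
move=> s0 w0 w1 hd.
have A := ler_wpM2l (sqr_ge0 fx) hd.
have v0 : 0 <= 2 / s by rewrite divr_ge0// ltW.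
have B : 0 <= 2 / s * df ^+ 2 * (1 - wx).
  by apply: mulr_ge0; [apply: mulr_ge0 => //; exact: sqr_ge0|rewrite subr_ge0].
have C : 0 <= wx * (s / 2 * (fx - 2 / s * df) ^+ 2).
  apply: mulr_ge0 => //; apply: mulr_ge0; last exact: sqr_ge0.
  by rewrite divr_ge0// ltW.
have E : wx * (s / 2 * (fx - 2 / s * df) ^+ 2) =
  wx * (s / 2 * fx ^+ 2 - 2 * fx * df) + 2 / s * df ^+ 2 * wx.
  by field; rewrite gt_eqF.
rewrite E in C; move: (2 / s) v0 B C {E} => v v0 B C.
rewrite (_ : s = 2 * (s / 2)) in A; last by rewrite mulrCA divff ?mulr1// pnatr_eq0.
by move: (s / 2) A C => z A C; lra.
Qed.

Let poincare_final (s e A g U L t q B : R) : 1 <= s -> 0 <= g -> 0 <= U -> 0 <= L ->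
  0 <= t -> 
  L * (2 * U + 2) * s ^+ 1 * t <= 1 -> B <= 2 * g + 2 * s^-1 ^+ 2 -> 
  A <= 2 * U + 2 * s^-1 ^+ 2 -> q <= s^-1 ^+ 2 ->
  (s / 2) * e <= (2 / s) * B + L * t * A + q ->
  2 * e + 2 * s^-1 ^+ 2 <= (16 * g + 26) * s^-1 ^+ 2.
Proof.
move=> s1 g0 U0 L0 t0 h1 hB hA hq he.
have s0 : 0 < s := lt_le_trans ltr01 s1.
set v := s^-1 in hB hA hq *; have v0 : 0 < v by rewrite invr_gt0.
have sv : s * v = 1 by rewrite divff// gt_eqF.
have v1 : v <= 1 by rewrite invf_le1.
have v21 : v ^+ 2 <= 1 by rewrite exprn_ile1// ltW.
have hB' : B <= 2 * g + 2 by lra.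
have hA' : A <= 2 * U + 2 by lra.
have h2 : L * t * A <= v.
  have Lt0 : 0 <= L * t by rewrite mulr_ge0.
  apply: (@le_trans _ _ (L * t * (2 * U + 2))); first exact: ler_wpM2l.
  have := ler_wpM2l (ltW v0) h1; rewrite mulr1 expr1.
  rewrite (_ : v * (L * (2 * U + 2) * s * t) = (s * v) * (L * t * (2 * U + 2))); last by ring.
  by rewrite sv mul1r.
have h3 : (2 / s) * B <= 2 * v * (2 * g + 2).
  by apply: ler_wpM2l => //; rewrite mulr_ge0// ltW.
have h4 : s / 2 * e <= v * (4 * g + 6).
  have : v ^+ 2 <= v by rewrite expr2 ler_piMl// ltW.
  by lra.
have h5 : e <= 2 * v * (v * (4 * g + 6)).
  have := ler_wpM2l (ltW (mulr_gt0 (ltr0n R 2) v0)) h4.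
  rewrite (_ : 2 * v * (s / 2 * e) = (s * v) * e); last by field.
  by rewrite sv mul1r.
have v2 := sqr_ge0 v; nra.
Qed.

Let tail_ge0 s : 0 <= tail_decay r s.
Proof. exact: ltW (decay_gt0 _ _). Qed.

Let poincare_mid (a b c x y z t : R) : a = - b -> a <= c ->
  b <= - x * y + z + t -> x * y <= z + t + c.
Proof. by move=> ? ? ?; lra. Qed.

Let poincare_last (a b e : R) : b <= e -> 2 * a + 2 * b <= 2 * a + 2 * e.
Proof. by move=> ?; rewrite lerD2l ler_pM2l. Qed.

(** The normal derivative of the weight supplies - s f^2 w up to an exponentially small error.
    Young's inequality spends half of it on 2 f f' w, at the price (2 / s) f'^2. As the face term is
    small, (s / 2) int f^2 w <= (2 / s) int f'^2 + lower order, which is the gain s^-2. *)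
Lemma poincare :
  (forall e, 0 < e -> exists f, [/\ smooth f,
    sqn leb3 (box r : set mE3) (fun x => f x - u x) <= e ^+ 2,
    sqn leb3 (box r : set mE3) (fun x => partial i f x - G x) <= e ^+ 2 &
    sqn leb2 (sq r : set mR2) (f \o insert i) <= e ^+ 2]) ->
  exists S C : R, forall s, S <= s ->
    \int[leb3]_(x in box r) (u x ^+ 2 * weight r s x) <= C * s^-1 ^+ 2.
Proof.
move=> approx; have [L L0 LP] := partial_weight_at r0.
pose g := sqn leb3 (box r : set mE3) G; pose U := sqn leb3 (box r : set mE3) u.
have g0 : 0 <= g := sqn_ge0 _ _ _; have U0 : 0 <= U := sqn_ge0 _ _ _.
have C0 : 0 <= L * (2 * U + 2) by rewrite mulr_ge0// addr_ge0// mulr_ge0.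
have [S S1 SP] := tail_decay_small r0 1 C0 (@ltr01 R).
(* Twice the bound 2 (4 g + 6) s^-2 obtained for f, plus 2 s^-2 for the squared distance from f to
   u. *)
exists S, (16 * g + 26) => s Ss; have s1 := le_trans S1 Ss.
have s0 : 0 < s := lt_le_trans ltr01 s1; have s0' := ltW s0.
have e0 : 0 < s^-1 by rewrite invr_gt0.
(* Accuracy s^-1 makes all squared errors of size s^-2, the order of the claim. *)
have [f [sf fu fG fS]] := approx s^-1 e0.
pose w := weight_at r i s s; have sw : smooth w by exact: smooth_weight_at.
have vw : vanishes_outside r w by exact: weight_at_vanishes.
have wE : weight r s = w by exact: weightE.
have w0 x : 0 <= w x by exact: weight_at_ge0.
have w1 x : box r x -> w x <= 1.
  by move=> xr; apply: weight_at_le1 => //; exact: box_ge0.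
have cf := smooth_continuous sf; have cw := smooth_continuous sw.
have cdf := smooth_continuous (smooth_partial i sf).
have cdw := smooth_continuous (smooth_partial i sw).
have Lf := continuous_L2r_box r cf; have Ldf := continuous_L2r_box r cdf.
have I1 : leb3.-integrable (box r : set mE3) (EFin \o (fun x => f x ^+ 2 * w x)).
  exact: (continuous_integrable_box r (continuousM_real (continuousX_real cf) cw)).
have [_ If2] := Lf; have [_ Idf2] := Ldf.
have Hs := ibp_square sf sw vw.
have Lfi : L2r leb2 (sq r : set mR2) (f \o insert i).
  by apply: continuous_L2r_sq; exact: continuous_compT (@continuous_insert _ i) cf.
have Hq : \int[leb2]_(p in sq r) (f (insert i p) ^+ 2 * w (insert i p)) <=
    sqn leb2 (sq r : set mR2) (f \o insert i).
  apply: (le_Rintegral mS _ (proj2 Lfi)).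
    exact: (continuous_integrable_sq r (continuous_compT (@continuous_insert _ i)
      (continuousM_real (continuousX_real cf) cw))).
  move=> p pr; rewrite ler_piMr ?sqr_ge0//.
  exact: (weight_at_le1 _ _ s0' s0' (insert_ge0 pr)).
have B := le_trans (sqn_le2 mB Ldf LG) (poincare_last _ fG).
have A := le_trans (sqn_le2 mB Lf Lu) (poincare_last _ fu).
have cneg : continuous (fun x => 2 * f x * partial i f x * w x + f x ^+ 2 * partial i w x).
  apply: continuousD_real; last exact: continuousM_real (continuousX_real cf) cdw.
  apply: continuousM_real => //; apply: continuousM_real => //.
  by apply: continuousM_real => // x; exact: cvg_cst.
have main : \int[leb3]_(x in box r)
     (2 * f x * partial i f x * w x + f x ^+ 2 * partial i w x) <=
   - (s / 2) * \int[leb3]_(x in box r) (f x ^+ 2 * w x) +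
   (2 / s) * \int[leb3]_(x in box r) (partial i f x ^+ 2) +
   (L * tail_decay r s) * \int[leb3]_(x in box r) (f x ^+ 2).
  apply: (le_Rintegral_comb mB _ I1 Idf2 If2).
    exact: (continuous_integrable_box r cneg).
  move=> x xr; have := LP i s s s0' s0' x xr; rewrite -/w ler_norml => /andP[_].
  exact: poincare_pointwise s0 (w0 x) (w1 x xr).
rewrite wE; apply: (le_trans _ (poincare_final s1 g0 U0 L0 (tail_ge0 _) (SP s Ss) B A fS
  (poincare_mid Hs Hq main))).
have mu2w : leb3.-integrable (box r : set mE3) (EFin \o (fun x => u x ^+ 2 * w x)).
  apply: (le_integrableR mB _ (proj2 Lu)).
    apply: measurable_funM; first exact: measurable_funX (proj1 Lu).
    exact: (proj1 (continuous_L2r_box r cw)).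
  move=> x xr; rewrite ger0_norm; last exact: mulr_ge0 (sqr_ge0 _) (w0 x).
  by rewrite ler_piMr ?sqr_ge0// w1.
have Lfu := L2rB mB Lf Lu.
have H3 : \int[leb3]_(x in box r) (u x ^+ 2 * w x) <=
    2 * \int[leb3]_(x in box r) (f x ^+ 2 * w x) +
    2 * \int[leb3]_(x in box r) ((f x - u x) ^+ 2) +
    0 * \int[leb3]_(x in box r) ((f x - u x) ^+ 2).
  apply: (le_Rintegral_comb mB mu2w I1 (proj2 Lfu) (proj2 Lfu)).
  move=> x xr; move: (f x) (u x) (w x) (w0 x) (w1 x xr) => fx ux wx h0 h1.
  have := mulr_ge0 h0 (sqr_ge0 (ux - 2 * fx)).
  have h2 : 0 <= 1 - wx by rewrite subr_ge0.
  have := mulr_ge0 h2 (sqr_ge0 (fx - ux)).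
  by lra.
by apply: le_trans H3 _; rewrite mul0r addr0;
  exact: poincare_last fu.
Qed.

Let trace_pointwise (s L t dw df fx wx : R) : 0 < s -> 0 <= wx -> wx <= 1 ->
  - (L * t) <= dw + s * wx ->
  - (2 * fx * df * wx + fx ^+ 2 * dw) <= s^-1 * df ^+ 2 + (2 * s * wx + L * t) * fx ^+ 2.
Proof.
move=> s0 w0 w1 hd.
have A := ler_wpM2l (sqr_ge0 fx) hd.
have v0 : 0 <= s^-1 by rewrite invr_ge0// ltW.
have B : 0 <= s^-1 * df ^+ 2 * (1 - wx).
  by apply: mulr_ge0; [apply: mulr_ge0 => //; exact: sqr_ge0|rewrite subr_ge0].
have C : 0 <= wx * (s * (fx + s^-1 * df) ^+ 2).
  by apply: mulr_ge0 => //; apply: mulr_ge0; [exact: ltW|exact: sqr_ge0].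
have E : wx * (s * (fx + s^-1 * df) ^+ 2) =
  wx * (s * fx ^+ 2 + 2 * fx * df) + s^-1 * df ^+ 2 * wx.
  by field; rewrite gt_eqF.
by rewrite E in C; move: (s^-1) v0 B C {E} => v v0 B C; lra.
Qed.

Let trace_pointwise2 (eps K M ux fx : R) : 0 <= K -> K <= M -> ux ^+ 2 <= eps ^+ 2 ->
  K * fx ^+ 2 <= 2 * eps ^+ 2 * K + 2 * M * (fx - ux) ^+ 2.
Proof.
move=> K0 KM h.
have A := mulr_ge0 K0 (sqr_ge0 (fx - 2 * ux)).
have B : K * (fx - ux) ^+ 2 <= M * (fx - ux) ^+ 2 by apply: ler_wpM2r => //; exact: sqr_ge0.
have C := ler_wpM2l K0 h; nra.
Qed.

Let trace_final (eps s L M t g B IK IP D E X : R) : 0 < eps -> 1 <= s -> 0 <= g ->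
  0 <= M -> 2 * g / eps ^+ 2 <= s ->
  IK <= 2 * s ^+ 3 * IP + L * t * B + 0 * B -> IP <= (s ^+ 2 * s ^+ 3)^-1 ->
  L * B * (s ^+ 3) ^+ 1 * t <= 1 ->
  X <= (s ^+ 3)^-1 * D + 2 * eps ^+ 2 * IK + 2 * M * E ->
  D <= 2 * g + 2 * (eps * s^-1 / (2 * (1 + M))) ^+ 2 ->
  E <= (eps * s^-1 / (2 * (1 + M))) ^+ 2 ->
  X <= 8 * eps ^+ 2 * s^-1 ^+ 2.
Proof.
move=> e0 s1 g0 M0 sg hIK hIP ht hX hD hE.
have s0 : 0 < s := lt_le_trans ltr01 s1.
set v := s^-1 in hD hE *; have v0 : 0 < v by rewrite invr_gt0.
have sv : s * v = 1 by rewrite divff// gt_eqF.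
have v1 : v <= 1 by rewrite invf_le1.
have M1 : 0 < 1 + M by rewrite ltr_wpDr.
have EE : (eps * v / (2 * (1 + M))) ^+ 2 = (eps ^+ 2 * v ^+ 2) * ((1 + M)^-1 ^+ 2 / 4).
  by field; rewrite gt_eqF.
rewrite EE in hD hE; set y := eps ^+ 2 * v ^+ 2 in hD hE EE.
have y0 : 0 <= y by rewrite mulr_ge0// sqr_ge0.
have hm : (1 + M)^-1 ^+ 2 / 4 * (1 + M) <= 4^-1.
  rewrite (_ : _ * _ = (1 + M)^-1 / 4); last by field; rewrite gt_eqF.
  by rewrite ler_piMl// invf_le1// lerDl.
set m := (1 + M)^-1 ^+ 2 / 4 in hm hD hE.
have m0 : 0 <= m by rewrite divr_ge0// sqr_ge0.
have mM : 0 <= m * M by exact: mulr_ge0.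
have A1 : M * E <= y / 4.
  have := ler_wpM2l M0 hE; have := ler_wpM2l y0 hm; rewrite mulrDr mulr1 mulrDr => h1 h2.
  have := mulr_ge0 y0 m0; lra.
have ym : y * m <= y / 4.
  by have := ler_wpM2l y0 hm; rewrite mulrDr mulr1 mulrDr; have := mulr_ge0 y0 mM; lra.
have sE : (s ^+ 3)^-1 = v ^+ 3 by rewrite exprVn.
have v32 : v ^+ 3 <= v ^+ 2 by rewrite exprSr ler_piMr// sqr_ge0.
have A2 : (s ^+ 3)^-1 * D <= y + y / 2.
  rewrite sE; have v3 : 0 <= v ^+ 3 by rewrite exprn_ge0// ltW.
  have v31 : v ^+ 3 <= 1 by rewrite exprn_ile1// ltW.
  have h1 : v ^+ 3 * (2 * g) <= y.
    move: sg; rewrite ler_pdivrMr ?exprn_gt0// => sg.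
    have := ler_wpM2l v3 sg.
    rewrite (_ : v ^+ 3 * (s * eps ^+ 2) = (s * v) * (eps ^+ 2 * v ^+ 2)); last by ring.
    by rewrite sv mul1r.
  have h2 : v ^+ 3 * (2 * (y * m)) <= y / 2.
    have h : 0 <= 2 * (y * m) by rewrite mulr_ge0// mulr_ge0.
    have := ler_wpM2r h v31; rewrite mul1r; lra.
  have := ler_wpM2l v3 hD; rewrite mulrDr; lra.
have A3 : IK <= 3 * v ^+ 2.
  have s30 : 0 < s ^+ 3 by rewrite exprn_gt0.
  have h1 : s ^+ 3 * IP <= v ^+ 2.
    have := ler_wpM2l (ltW s30) hIP.
    rewrite (_ : s ^+ 3 * (s ^+ 2 * s ^+ 3)^-1 = v ^+ 2)//.
    by rewrite /v; field; rewrite gt_eqF.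
  have h2 : L * t * B <= v ^+ 3.
    rewrite -sE -[leRHS]mul1r ler_pdivlMr//.
    by move: ht; rewrite expr1; lra.
  by move: hIK; rewrite mul0r addr0; lra.
have A4 : eps ^+ 2 * IK <= 3 * y.
  by have := ler_wpM2l (sqr_ge0 eps) A3; rewrite /y; lra.
have -> : 8 * eps ^+ 2 * v ^+ 2 = 8 * y by rewrite /y; ring.
by lra.
Qed.

(** The face integral is unchanged if the weight gets the normal rate z = s^3 inside the box. It is
    then at most z^-1 int f'^2 + 2 z int f^2 w up to small errors. The first term is O(s^-3); as int
    w <= 1 / (s^2 z) and |u| <= eps, the second is of order eps^2 s^-2. With the rate s the gradient
    term would only be O(s^-1). *)
Lemma trace_bound (eps : R) : 0 < eps ->
  (forall x, box r x -> `|u x| <= eps) ->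
  exists2 S : R, 1 <= S & forall s, S <= s -> exists2 e, 0 < e <= eps * s^-1 & forall f,
    smooth f -> sqn leb3 (box r : set mE3) (fun x => f x - u x) <= e ^+ 2 ->
    sqn leb3 (box r : set mE3) (fun x => partial i f x - G x) <= e ^+ 2 ->
    \int[leb2]_(p in sq r) (f (insert i p) ^+ 2 * weight r s (insert i p)) <=
    8 * eps ^+ 2 * s^-1 ^+ 2.
Proof.
move=> eps0 ueps; have [L L0 LP] := partial_weight_at r0.
pose g := sqn leb3 (box r : set mE3) G; pose B := \int[leb3]_(x in box r) (1 : R).
have g0 : 0 <= g := sqn_ge0 _ _ _; have B0 : 0 <= B by exact: Rintegral_ge0.
have [S S1 SP] := tail_decay_small r0 1 (mulr_ge0 L0 B0) (@ltr01 R).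
(* Beyond this threshold the gradient term 2 g s^-3 is at most eps^2 s^-2. *)
exists (Num.max S (2 * g / eps ^+ 2)); first by rewrite le_max S1.
move=> s; rewrite ge_max => /andP[Ss sg].
have s1 := le_trans S1 Ss; have s0 : 0 < s := lt_le_trans ltr01 s1; have s0' := ltW s0.
pose z := s ^+ 3; have z0 : 0 < z by rewrite exprn_gt0.
have Sz : S <= z by apply: le_trans Ss _; rewrite /z -[leLHS]expr1 ler_weXn2l.
pose M := 2 * z + L; have M0 : 0 <= M by rewrite addr_ge0// mulr_ge0// ltW.
(* The error (f - u)^2 gets multiplied by up to M, which is of order s^3, so the accuracy has to
   compensate for it. *)
pose e := eps * s^-1 / (2 * (1 + M)).
have e0 : 0 < e.
  by rewrite divr_gt0// ?mulr_gt0 ?invr_gt0// ltr_wpDr.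
exists e => [|f sf fu fG].
  rewrite e0 /= ler_piMr// ?mulr_ge0 ?invr_ge0 ?(ltW eps0)// invf_le1; last first.
    by rewrite mulr_gt0// ltr_wpDr.
  by rewrite mulrDr mulr1; move: (M) M0 => m m0; lra.
pose w := weight_at r i s z; have sw : smooth w by exact: smooth_weight_at.
have vw : vanishes_outside r w by exact: weight_at_vanishes.
have w0 x : 0 <= w x by exact: weight_at_ge0.
have w1 x : (forall j, 0 <= coord j x) -> w x <= 1.
  by apply: weight_at_le1 => //; exact: ltW.
have wE p : weight r s (insert i p) = w (insert i p) by rewrite /w weight_at_insert.
have cf := smooth_continuous sf; have cw := smooth_continuous sw.
have cdf := smooth_continuous (smooth_partial i sf).
have cdw := smooth_continuous (smooth_partial i sw).
have Lf := continuous_L2r_box r cf; have Ldf := continuous_L2r_box r cdf.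
have [_ If2] := Lf; have [_ Idf2] := Ldf.
have Lfu := L2rB mB Lf Lu; have [_ Ifu2] := Lfu.
have cneg : continuous (fun x => 2 * f x * partial i f x * w x + f x ^+ 2 * partial i w x).
  apply: continuousD_real; last exact: continuousM_real (continuousX_real cf) cdw.
  apply: continuousM_real => //; apply: continuousM_real => //.
  by apply: continuousM_real => // x; exact: cvg_cst.
have Ineg := continuous_integrable_box r cneg.
pose t := tail_decay r z; have t0 : 0 <= t := tail_ge0 z.
have t1 : t <= 1 by apply: decay_le1; [exact: ltW|rewrite divr_ge0// ltW].
pose K x := 2 * z * w x + L * t.
have cK : continuous K.
  apply: continuousD_real; last by move=> x; exact: cvg_cst.
  by apply: continuousM_real => // x; exact: cvg_cst.
have IK := continuous_integrable_box r cK.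
have c1 : continuous (fun _ : E3 R => 1 : R) by move=> x; exact: cvg_cst.
have I1 := continuous_integrable_box r c1.
have Iw := continuous_integrable_box r cw.
have HK : \int[leb3]_(x in box r) K x <= 2 * z * \int[leb3]_(x in box r) w x +
    L * t * B + 0 * B.
  by apply: (le_Rintegral_comb mB IK Iw I1 I1) => x _; rewrite mul0r addr0 mulr1.
have K0 x : 0 <= K x by rewrite addr_ge0// mulr_ge0// mulr_ge0// ltW.
have KM x : box r x -> K x <= M.
  move=> xr; rewrite lerD//; last by rewrite ler_piMr.
  rewrite ler_piMr ?mulr_ge0 ?(ltW z0)//.
  exact: w1 (box_ge0 xr).
have main : \int[leb3]_(x in box r)
     (-1 * (2 * f x * partial i f x * w x + f x ^+ 2 * partial i w x)) <=
   z^-1 * \int[leb3]_(x in box r) (partial i f x ^+ 2) +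
   2 * eps ^+ 2 * \int[leb3]_(x in box r) K x +
   2 * M * \int[leb3]_(x in box r) ((f x - u x) ^+ 2).
  apply: (le_Rintegral_comb mB (integrableZR mB (-1) Ineg) Idf2 IK Ifu2).
  move=> x xr; have := LP i s z s0' (ltW z0) x xr; rewrite -/w ler_norml => /andP[h _].
  have h1 := trace_pointwise (partial i f x) (f x) z0 (w0 x) (w1 _ (box_ge0 xr)) h.
  have h2 : u x ^+ 2 <= eps ^+ 2.
    by rewrite -real_normK ?num_real// lerXn2r ?nnegrE ?(ltW eps0)// ueps.
  have h3 := trace_pointwise2 (f x) (K0 x) (KM x xr) h2.
  by rewrite mulN1r -addrA; apply: le_trans h1 _; rewrite lerD2l.
rewrite (RintegralZl (-1) mB Ineg) mulN1r -(ibp_square sf sw vw) in main.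
rewrite (_ : \int[leb2]_(p in sq r) (f (insert i p) ^+ 2 * weight r s (insert i p)) =
  \int[leb2]_(p in sq r) (f (insert i p) ^+ 2 * w (insert i p))); last first.
  by apply: eq_Rintegral => p _; rewrite wE.
exact: (trace_final eps0 s1 g0 M0 sg HK (Rintegral_weight_at_le r0 i s0 z0) (SP z Sz) main
  (le_trans (sqn_le2 mB Ldf LG) (poincare_last _ fG)) fu).
Qed.

Notation F := (insert i @` sq r).

Lemma measurable_face_surf : measurable (F : set (caratheodory_type (@haus_outer R))).
Proof. exact: measurable_surf (measurable_image_insert i mS). Qed.

Let mF := measurable_face_surf.

Lemma continuous_integrable_face (f : E3 R -> R) : continuous f ->
  surf.-integrable (F : set (caratheodory_type (@haus_outer R))) (EFin \o f).
Proof.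
move=> cf; apply: (integrable_face mS).
  exact: continuous_measurable3.
exact: (continuous_integrable_sq r (continuous_compT (@continuous_insert _ i) cf)).
Qed.

Lemma continuous_Rintegral_face (f : E3 R -> R) : continuous f ->
  \int[surf]_(x in F) f x = face_cst i * \int[leb2]_(p in sq r) f (insert i p).
Proof.
move=> cf; apply: (Rintegral_face mS).
  exact: continuous_measurable3.
exact: (continuous_integrable_sq r (continuous_compT (@continuous_insert _ i) cf)).
Qed.

Lemma continuous_L2r_face (f : E3 R -> R) : continuous f ->
  L2r surf (F : set (caratheodory_type (@haus_outer R))) f.
Proof.
move=> cf; split; last exact: continuous_integrable_face (continuousX_real cf).
apply: (@measurable_funTS _ _ (caratheodory_type (@haus_outer R)) _ _ f).
by apply: measurable_funT_surf; exact: continuous_measurable3.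
Qed.

Lemma face_ge0 x : F x -> forall j, 0 <= coord j x.
Proof. by move=> [p pr <-]; exact: insert_ge0. Qed.

(** The trace t is known only as a limit of restrictions, so the bound is proved for a smooth f and
    transferred by t^2 <= 2 f^2 + 2 (f - t)^2; this turns 8 into 16 [face_cst i] + 2. *)
Lemma surf_trace_bound (eps : R) (t : E3 R -> R) : 0 < eps ->
  L2r surf (F : set (caratheodory_type (@haus_outer R))) t ->
  (forall x, box r x -> `|u x| <= eps) ->
  (forall e, 0 < e -> exists f, [/\ smooth f,
    sqn leb3 (box r : set mE3) (fun x => f x - u x) <= e ^+ 2,
    sqn leb3 (box r : set mE3) (fun x => partial i f x - G x) <= e ^+ 2 &
    sqn surf (F : set (caratheodory_type (@haus_outer R))) (fun x => f x - t x) <= e ^+ 2]) ->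
  exists2 S : R, 1 <= S & forall s, S <= s ->
    \int[surf]_(x in F) (t x ^+ 2 * weight r s x) <=
    (16 * face_cst i + 2) * eps ^+ 2 * s^-1 ^+ 2.
Proof.
move=> eps0 Lt ueps approx; have [S S1 SP] := trace_bound eps0 ueps.
exists S => // s Ss; have [e /andP[e0 ee] eP] := SP s Ss.
have s0 : 0 < s := lt_le_trans ltr01 (le_trans S1 Ss).
have [f [sf fu fG ft]] := approx e e0; have {eP fu fG} fw := eP f sf fu fG.
have w0 x : 0 <= weight r s x by rewrite (weightE r i) weight_at_ge0.
have w1 x : F x -> weight r s x <= 1.
  move=> Fx; rewrite (weightE r i); apply: weight_at_le1; [exact: ltW|exact: ltW|].
  exact: face_ge0.
have cf := smooth_continuous sf.
have cw : continuous (weight r s).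
  by rewrite (weightE r i); exact: smooth_continuous (smooth_weight_at r i s s).
have cfw := continuousM_real (continuousX_real cf) cw.
have Ltw : surf.-integrable (F : set (caratheodory_type (@haus_outer R)))
    (EFin \o (fun x => t x ^+ 2 * weight r s x)).
  apply: (le_integrableR mF _ (proj2 Lt)).
    apply: measurable_funM; first exact: measurable_funX (proj1 Lt).
    exact: (proj1 (continuous_L2r_face cw)).
  move=> x Fx; rewrite ger0_norm; last exact: mulr_ge0 (sqr_ge0 _) (w0 _).
  by rewrite ler_piMr ?sqr_ge0// w1.
have Lft := L2rB mF (continuous_L2r_face cf) Lt.
have Hq : \int[surf]_(x in F) (t x ^+ 2 * weight r s x) <=
    2 * \int[surf]_(x in F) (f x ^+ 2 * weight r s x) +
    2 * \int[surf]_(x in F) ((f x - t x) ^+ 2) +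
    0 * \int[surf]_(x in F) ((f x - t x) ^+ 2).
  apply: (le_Rintegral_comb mF Ltw (continuous_integrable_face cfw) (proj2 Lft) (proj2 Lft)).
  move=> x Fx; have := w0 x; have := w1 _ Fx.
  move: (f x) (t x) (weight r s x) => fx ux wx h1 h0.
  have := mulr_ge0 h0 (sqr_ge0 (ux - 2 * fx)).
  have h2 : 0 <= 1 - wx by rewrite subr_ge0.
  have := mulr_ge0 h2 (sqr_ge0 (fx - ux)).
  by lra.
rewrite (continuous_Rintegral_face cfw) in Hq.
have last_step (a b c d X q : R) : 0 <= c -> 0 < e -> e <= d -> a <= 8 * X -> X = d ^+ 2 -> b <= e ^+ 2 ->
    q <= 2 * (c * a) + 2 * b + 0 * b -> q <= (16 * c + 2) * X.
  move=> c0 h0 h1 h2 h3 h4 h5; have := ler_wpM2l c0 h2.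
  have : e ^+ 2 <= d ^+ 2 by rewrite lerXn2r// nnegrE ltW// (lt_le_trans h0).
  by rewrite -h3; lra.
rewrite -mulrA; apply: (last_step _ _ _ _ _ _ (ltW (face_cst_gt0 i)) e0 ee _ _ ft Hq).
  by rewrite mulrA.
by rewrite exprMn.
Qed.

End weighted_estimates.

(** * The test functions and the core estimate *)

Section test_function.
Context {R : realType}.
Notation mR := (measurableTypeR R).
Notation mR2 := (mR * mR)%type.
Notation mE3 := (E3 mR).
Notation mu := (@lebesgue_measure R).
Variable r : R.
Hypothesis r0 : 0 < r.

(* Up to the cut-off at distance r this is the harmonic function
   [expR (- s * (x1 + x2 + 4 * x3)) * cos (3 * s * (x1 - x2))]. *)
Definition testf s : E3 R -> R := fun x =>
  tensor (profC r s) (profC r s) (prof r (4 * s)) x +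
  tensor (profS r s) (profS r s) (prof r (4 * s)) x.

Lemma smooth_testf s : smooth (testf s).
Proof.
apply: smoothD; apply: smooth_tensor; do ?exact: smooth1_prof;
  by [exact: smooth1_profC|exact: smooth1_profS].
Qed.

Lemma testf_vanishes s : vanishes_outside r (testf s).
Proof.
move=> x xr; rewrite /testf.
rewrite (tensor_vanishes _ _ _ xr) ?(tensor_vanishes _ _ _ xr) ?addr0// => t tr;
  by rewrite /profC /profS prof_out ?mul0r.
Qed.

Lemma testf_le s x : 0 <= s -> (forall i, 0 <= coord i x) ->
  `|testf s x| <= 2 * weight r s x.
Proof.
move=> s0 x0; have x3 := x0 (@Ordinal 3 2 isT); rewrite /coord/= in x3.
have H (a b c p q w : R) : `|a| <= p -> `|b| <= q -> 0 <= c -> c <= w ->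
    `|a * b * c| <= p * q * w.
  move=> ha hb hc hw; rewrite !normrM (ger0_norm hc); apply: ler_pM => //.
  exact: ler_pM.
have h4 : prof r (4 * s) x.2 <= prof r s x.2.
  by apply: prof_lel => //; rewrite ler_peMl// ler1n.
rewrite mulr_natl mulr2n; apply: le_trans (ler_normD _ _) _; apply: lerD.
  exact: (H _ _ _ _ _ _ (profC_le _ _ _) (profC_le _ _ _) (prof_ge0 _ _ _) h4).
exact: (H _ _ _ _ _ _ (profS_le _ _ _) (profS_le _ _ _) (prof_ge0 _ _ _) h4).
Qed.

Lemma partial2D (f g : E3 R -> R) i : smooth f -> smooth g ->
  partial i (partial i (fun x => f x + g x)) =
  (fun x => partial i (partial i f) x + partial i (partial i g) x).
Proof.
move=> sf sg; rewrite partialD; do ?by move=> y; exact: smooth_derivable.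
rewrite partialD//; move=> y.
  exact: (smooth_derivable (smooth_partial i sf)).
exact: (smooth_derivable (smooth_partial i sg)).
Qed.

(** Each second derivative is replaced by its main part. The main parts cancel: -8 - 8 + 16 = 0 on
    the products c1 c2 and s1 s2, and the mixed products carry +6 and -6. *)
Let harmonic_error (E s c1 c2 s1 s2 d C1 C2 S1 S2 D : R) :
  `|c1| <= 1 -> `|c2| <= 1 -> `|s1| <= 1 -> `|s2| <= 1 -> `|d| <= 1 ->
  `|C1 - s ^+ 2 * (- 8 * c1 + 6 * s1)| <= E ->
  `|C2 - s ^+ 2 * (- 8 * c2 + 6 * s2)| <= E ->
  `|S1 - s ^+ 2 * (- 8 * s1 - 6 * c1)| <= E ->
  `|S2 - s ^+ 2 * (- 8 * s2 - 6 * c2)| <= E ->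
  `|D - s ^+ 2 * (16 * d)| <= E ->
  `|(C1 * c2 * d + S1 * s2 * d) + ((c1 * C2 * d + s1 * S2 * d) +
     (c1 * c2 * D + s1 * s2 * D))| <= 6 * E.
Proof.
move=> hc1 hc2 hs1 hs2 hd h1 h2 h3 h4 h5.
have bnd (a b c : R) : `|a| <= E -> `|b| <= 1 -> `|c| <= 1 -> `|a * (b * c)| <= E.
  move=> ha hb hc; rewrite normrM; apply: le_trans ha.
  by rewrite ler_piMr// normrM mulr_ile1.
rewrite (_ : _ + _ =
  (C1 - s ^+ 2 * (- 8 * c1 + 6 * s1)) * (c2 * d) +
  (S1 - s ^+ 2 * (- 8 * s1 - 6 * c1)) * (s2 * d) +
  (C2 - s ^+ 2 * (- 8 * c2 + 6 * s2)) * (c1 * d) +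
  (S2 - s ^+ 2 * (- 8 * s2 - 6 * c2)) * (s1 * d) +
  (D - s ^+ 2 * (16 * d)) * (c1 * c2) + (D - s ^+ 2 * (16 * d)) * (s1 * s2)); last by ring.
rewrite (_ : 6 * E = E + E + E + E + E + E); last by ring.
do 5![apply: le_trans (ler_normD _ _) _; apply: lerD; last exact: bnd].
exact: bnd.
Qed.

Lemma laplacian_testf : exists2 K : R, 0 <= K & forall s, 1 <= s ->
  forall x, box r x -> `|laplacian (testf s) x| <= K * s * tail_decay r s.
Proof.
have [K K0 KP] := prof_deriv2 r0; exists (6 * K); first by rewrite mulr_ge0.
move=> s s1 x /boxP xr; have s0 : 0 <= s := le_trans ler01 s1.
have [[f1 [f2 [df df1 ef]]] [g1 [g2 [dg dg1 eg]]] [h1 [h2 [dh dh1 eh]]]] := KP s s1.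
have x1 := xr (@Ordinal 3 0 isT); have x2 := xr (@Ordinal 3 1 isT).
have x3 := xr (@Ordinal 3 2 isT); rewrite /coord/= in x1 x2 x3.
have p1 u v : 0 <= u -> 0 < v <= r -> prof r u v <= 1.
  by move=> u0 /andP[v0 _]; rewrite prof_le1// ltW.
have sC : smooth (tensor (profC r s) (profC r s) (prof r (4 * s))).
  by apply: smooth_tensor; [exact: smooth1_profC|exact: smooth1_profC|exact: smooth1_prof].
have sS : smooth (tensor (profS r s) (profS r s) (prof r (4 * s))).
  by apply: smooth_tensor; [exact: smooth1_profS|exact: smooth1_profS|exact: smooth1_prof].
rewrite laplacianE /testf !(partial2D _ sC sS).
rewrite !(partial_tensor _ df df dh) !(partial_tensor _ dg dg dh) /=.
rewrite (partial_tensor _ df1 df dh) (partial_tensor _ dg1 dg dh).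
rewrite (partial_tensor _ df df1 dh) (partial_tensor _ dg dg1 dh).
rewrite (partial_tensor _ df df dh1) (partial_tensor _ dg dg dh1) /=.
have cb u : 0 < u <= r -> `|profC r s u| <= 1.
  by move=> ur; apply: le_trans (profC_le _ _ _) (p1 _ _ s0 ur).
have sb u : 0 < u <= r -> `|profS r s u| <= 1.
  by move=> ur; apply: le_trans (profS_le _ _ _) (p1 _ _ s0 ur).
have db : `|prof r (4 * s) x.2| <= 1.
  by rewrite ger0_norm ?prof_ge0// p1// mulr_ge0.
rewrite -!mulrA (mulrA K).
exact: (harmonic_error (cb _ x1) (cb _ x2) (sb _ x1) (sb _ x2) db
  (ef _ x1) (ef _ x2) (eg _ x1) (eg _ x2) (eh _ x3)).
Qed.

(** The sine profile vanishes at 0, so one product survives on each of the first two faces. On the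
    third, cos (a - b) = cos a cos b + sin a sin b yields two squares. *)
Lemma Rintegral_testf_insert i s : 0 < s ->
  \int[leb2]_(p in sq r) testf s (insert i p) =
  if (val i < 2)%N then
    (\int[mu]_(t in `]0, r]) profC r s t) * \int[mu]_(t in `]0, r]) prof r (4 * s) t
  else (\int[mu]_(t in `]0, r]) profC r s t) ^+ 2 + (\int[mu]_(t in `]0, r]) profS r s t) ^+ 2.
Proof.
move=> s0.
have cC : continuous (profC r s) := smooth1_continuous (smooth1_profC r s).
have cS : continuous (profS r s) := smooth1_continuous (smooth1_profS r s).
have cD : continuous (prof r (4 * s)) := @prof_continuous _ r (4 * s).
have C0 : profC r s 0 = 1 by rewrite /profC prof_at0 ?mulr0 ?cos0 ?mulr1.
have S0 : profS r s 0 = 0 by rewrite /profS mulr0 sin0 mulr0.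
have D0 : prof r (4 * s) 0 = 1 by rewrite prof_at0.
rewrite /insert; case: i => [[|[|[|//]]] ilt] /=.
- rewrite -(Rintegral_sq_prod r cC cD); apply: eq_Rintegral => p _.
  by rewrite /testf /tensor /= C0 S0 mul1r !mul0r addr0.
- rewrite -(Rintegral_sq_prod r cC cD); apply: eq_Rintegral => p _.
  by rewrite /testf /tensor /= C0 S0 mulr1 mulr0 mul0r addr0.
- rewrite !expr2 -(Rintegral_sq_prod r cC cC) -(Rintegral_sq_prod r cS cS).
  have cp (a : R -> R) : continuous a -> continuous (fun p : R * R => a p.1 * a p.2).
    move=> ca; apply: continuousM_real.
      exact: (continuous_compT (@continuous_fst _ _) ca).
    exact: (continuous_compT (@continuous_snd _ _) ca).
  rewrite -(RintegralD (measurable_sq r) (continuous_integrable_sq r (cp _ cC))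
    (continuous_integrable_sq r (cp _ cS))).
  by apply: eq_Rintegral => p _; rewrite /testf /tensor /= D0 !mulr1.
Qed.

(* The lower bound on the first face is what makes the argument work: it
   dominates all error terms. *)
Lemma Rintegral_testf_faces : exists2 S : R, 1 <= S & forall s, S <= s ->
  [/\ (160 * s ^+ 2)^-1 <= \int[leb2]_(p in sq r) testf s (insert ord0 p) &
      forall i, 0 <= \int[leb2]_(p in sq r) testf s (insert i p)].
Proof.
have [S1 S11 H1] := Rintegral_profC_ge r0; have [S2 S21 H2] := Rintegral_prof_ge r0.
exists (Num.max S1 S2); first by rewrite le_max S11.
move=> s; rewrite ge_max => /andP[Ss1 Ss2].
have s0 : 0 < s := lt_le_trans ltr01 (le_trans S11 Ss1).
have hC := H1 s Ss1.
have hD : (8 * s)^-1 <= \int[mu]_(t in `]0, r]) prof r (4 * s) t.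
  rewrite (_ : 8 * s = 2 * (4 * s)); last by ring.
  by apply: H2; apply: le_trans Ss2 _; rewrite ler_peMl ?(ltW s0)// ler1n.
have pC : 0 <= (20 * s)^-1 by rewrite invr_ge0 mulr_ge0// ltW.
have pD : 0 <= (8 * s)^-1 by rewrite invr_ge0 mulr_ge0// ltW.
split.
  rewrite Rintegral_testf_insert//=.
  rewrite (_ : (160 * s ^+ 2)^-1 = (20 * s)^-1 * (8 * s)^-1); last by field; rewrite gt_eqF.
  exact: (ler_pM pC pD hC hD).
move=> i; rewrite Rintegral_testf_insert//; case: ifP => _.
  exact: mulr_ge0 (le_trans pC hC) (le_trans pD hD).
exact: addr_ge0 (sqr_ge0 _) (sqr_ge0 _).
Qed.

End test_function.

Section domination.
Context d (T : measurableType d) (R : realType) (m : {measure set T -> \bar R}).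
Variable D : set T.
Hypothesis mD : measurable D.

Lemma normr_Rintegral_comb (F a b c : T -> R) (x y z : R) : measurable_fun D F ->
  m.-integrable D (EFin \o a) -> m.-integrable D (EFin \o b) ->
  m.-integrable D (EFin \o c) ->
  (forall t, D t -> `|F t| <= x * a t + y * b t + z * c t) ->
  m.-integrable D (EFin \o F) /\
  `|\int[m]_(t in D) F t| <=
  x * \int[m]_(t in D) a t + y * \int[m]_(t in D) b t + z * \int[m]_(t in D) c t.
Proof.
move=> mF ia ib ic le.
have iF : m.-integrable D (EFin \o F).
  apply: (le_integrableR mD mF _ le).
  exact: (integrableDR mD (integrableDR mD (integrableZR mD x ia) (integrableZR mD y ib))
    (integrableZR mD z ic)).
split=> //; apply: le_trans (le_normr_Rintegral mD iF) _.
apply: (le_Rintegral_comb mD _ ia ib ic le).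
by apply: (le_integrableR mD _ (integrable_norm iF)) => [|t _];
  [exact: measurableT_comp|rewrite normr_id].
Qed.

Lemma L2r_integrable_weight (f w : T -> R) : L2r m D f -> measurable_fun D w ->
  (forall t, D t -> 0 <= w t <= 1) -> m.-integrable D (EFin \o (fun t => f t ^+ 2 * w t)).
Proof.
move=> [mf If] mw w01; apply: (le_integrableR mD _ If).
  by apply: measurable_funM => //; exact: measurable_funX.
move=> t Dt; have /andP[w0 w1] := w01 t Dt.
rewrite ger0_norm; last exact: mulr_ge0 (sqr_ge0 _) w0.
by rewrite ler_piMr ?sqr_ge0.
Qed.

End domination.

(** * Size of the interior and face terms as s grows *)

Section core_estimate.
Context {R : realType}.
Notation mR := (measurableTypeR R).
Notation mR2 := (mR * mR)%type.
Notation mE3 := (E3 mR).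
Notation cE3 := (caratheodory_type (@haus_outer R)).
Notation mu := (@lebesgue_measure R).
Variable r : R.
Hypothesis r0 : 0 < r.

Let mB := @measurable_box R r.
Let mS := @measurable_sq R r.
Notation face i := (insert i @` sq r).

Lemma weight_01 s x : 0 <= s -> (forall i, 0 <= coord i x) -> 0 <= weight r s x <= 1.
Proof. by move=> s0 x0; rewrite (weightE r ord0) weight_at_ge0 weight_at_le1. Qed.

Lemma smooth_weight s : smooth (weight r s).
Proof. by rewrite (weightE r ord0); exact: smooth_weight_at. Qed.

Lemma box_coord_ge0 (x : E3 R) : box r x -> forall i, 0 <= coord i x.
Proof. by move=> /boxP xr i; have /andP[/ltW] := xr i. Qed.

Lemma continuous_measurable_box (f : E3 R -> R) : continuous f ->
  measurable_fun (box r : set mE3) f.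
Proof. by move=> cf; exact: (proj1 (continuous_L2r_box r cf)). Qed.

Lemma continuous_measurable_face i (f : E3 R -> R) : continuous f ->
  measurable_fun (face i : set cE3) f.
Proof. by move=> cf; exact: (proj1 (continuous_L2r_face r i cf)). Qed.

Lemma Rintegral_weight_face i s : 0 < s ->
  \int[surf]_(x in face i) weight r s x <= face_cst i * s^-1 ^+ 2.
Proof.
move=> s0; have cw := smooth_continuous (smooth_weight s).
rewrite (continuous_Rintegral_face r i cw) ler_pM2l ?face_cst_gt0//.
have cp := @prof_continuous _ r s.
rewrite (_ : \int[leb2]_(p in sq r) weight r s (insert i p) =
  \int[leb2]_(p in sq r) (prof r s p.1 * prof r s p.2)); last first.
  apply: eq_Rintegral => p _; rewrite /weight /tensor /insert.
  by case: i => [[|[|m]] ilt] /=; rewrite prof_at0// ?mul1r ?mulr1.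
rewrite (Rintegral_sq_prod r cp cp) -expr2 lerXn2r// ?nnegrE ?invr_ge0 ?(ltW s0)//.
  by apply: Rintegral_ge0 => t _; exact: prof_ge0.
exact: Rintegral_prof_le.
Qed.

Lemma laplacian_term (u : E3 R -> R) (e : R) : L2r leb3 (box r : set mE3) u -> 0 < e ->
  exists2 S : R, 1 <= S & forall s, S <= s ->
    `|\int[leb3]_(x in box r) (u x * laplacian (testf r s) x)| <= e * s^-1 ^+ 2.
Proof.
move=> Lu e0; have [K K0 KP] := laplacian_testf r0.
pose N := \int[leb3]_(x in box r) (1 : R) + \int[leb3]_(x in box r) (u x ^+ 2).
have N0 : 0 <= N.
  by apply: addr_ge0; apply: Rintegral_ge0 => // x _; exact: sqr_ge0.
(* Exponent 3: one power of s from the bound on the Laplacian, two more to reach s^-2. *)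
have [S S1 SP] := tail_decay_small r0 3 (mulr_ge0 K0 N0) e0.
exists S => // s Ss; have s1 := le_trans S1 Ss; have s0 : 0 < s := lt_le_trans ltr01 s1.
have c1 : continuous (fun _ : E3 R => 1 : R) by move=> x; exact: cvg_cst.
have I1 := continuous_integrable_box r c1.
have cL : continuous (laplacian (testf r s)).
  have sf := smooth_testf r s.
  have c i := smooth_continuous (smooth_partial i (smooth_partial i sf)).
  have -> : laplacian (testf r s) = (fun x => partial ord0 (partial ord0 (testf r s)) x +
     (partial (lift ord0 ord0) (partial (lift ord0 ord0) (testf r s)) x +
      partial (lift ord0 (lift ord0 ord0)) (partial (lift ord0 (lift ord0 ord0)) (testf r s)) x)).
    by apply/funext => x; exact: laplacianE.
  exact: (continuousD_real (c _) (continuousD_real (c _) (c _))).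
have M0 : 0 <= K * s * tail_decay r s.
  by rewrite mulr_ge0 ?mulr_ge0// ltW// decay_gt0.
have mul : measurable_fun (box r : set mE3) (fun x => u x * laplacian (testf r s) x).
  by apply: measurable_funM; [exact: (proj1 Lu)|exact: continuous_measurable_box].
have [|_ H] := normr_Rintegral_comb mB (x := K * s * tail_decay r s)
    (y := K * s * tail_decay r s) (z := 0) mul I1 (proj2 Lu) I1.
  move=> x xr; rewrite mul0r addr0 mulr1 normrM.
  have h := KP s s1 x xr; have h' := ler_wpM2l (normr_ge0 (u x)) h.
  apply: le_trans h' _; rewrite -{2}[K * s * tail_decay r s]mulr1 -mulrDr mulrC.
  apply: ler_wpM2l => //; rewrite -(real_normK (num_real (u x))).
  by move: (`|u x|) => a; have := sqr_ge0 (a - 1); rewrite sqrrB; have := sqr_ge0 a; lra.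
apply: le_trans H _; rewrite mul0r addr0 -mulrDr -/N.
rewrite exprVn ler_pdivlMr ?exprn_gt0//.
by have := SP s Ss; rewrite (_ : K * N * s ^+ 3 * tail_decay r s =
  K * s * tail_decay r s * N * s ^+ 2)//; ring.
Qed.

Let source_final (C0 C C' e s IW IU IU' X : R) : 0 <= C0 -> 0 <= C -> 0 <= C' -> 0 < e ->
  0 < s -> let dl := e / (4 * C0 * (C + C') + 1) in
  4 * C0 * (dl^-1 + 1) / e <= s -> IW <= (s ^+ 2 * s)^-1 ->
  IU <= C * s^-1 ^+ 2 -> IU' <= C' * s^-1 ^+ 2 ->
  X <= 2 * C0 * (dl^-1 + 1) * IW + 2 * C0 * dl * IU + 2 * C0 * dl * IU' ->
  X <= e * s^-1 ^+ 2.
Proof.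
move=> C00 C0' C0'' e0 s0 dl.
have q0 : 0 < 4 * C0 * (C + C') + 1.
  by apply: ltr_wpDl => //; apply: mulr_ge0; [exact: mulr_ge0|exact: addr_ge0].
have d0 : 0 < dl by rewrite divr_gt0.
have h1 : 4 * C0 * (C + C') * dl <= e.
  rewrite /dl mulrA ler_pdivrMr// mulrC; apply: ler_wpM2l; first exact: ltW.
  by rewrite lerDl.
have i0 : 0 <= dl^-1 + 1 by rewrite addr_ge0// invr_ge0 ltW.
have v0 : 0 < s^-1 by rewrite invr_gt0.
move=> hs hW hU hU'; move: (dl^-1 + 1) i0 hs => p p0 hs.
move: (dl) d0 h1 => l l0 h1 hX.
rewrite ler_pdivrMr// in hs.
have k1 : 0 <= 2 * C0 * p by rewrite mulr_ge0// mulr_ge0.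
have k2 : 0 <= 2 * C0 * l by rewrite mulr_ge0 ?(ltW l0)// mulr_ge0.
have a1 := ler_wpM2l k1 hW; have a2 := ler_wpM2l k2 hU; have a3 := ler_wpM2l k2 hU'.
have a4 : 2 * C0 * p * (s ^+ 2 * s)^-1 <= e / 2 * s^-1 ^+ 2.
  have E : (s ^+ 2 * s)^-1 = s^-1 ^+ 2 * s^-1 by rewrite invfM exprVn.
  rewrite E mulrCA mulrC; apply: ler_wpM2r; first exact: sqr_ge0.
  by rewrite ler_pdivrMr//; lra.
have a5 := ler_wpM2r (sqr_ge0 s^-1) h1.
by lra.
Qed.

(** The linear bound on F is traded for a quadratic one by y <= dl y^2 + 1 / (2 dl). The squares
    have weighted integrals O(s^-2) and get the small factor dl; the constant only meets the
    integral of the weight, which is O(s^-3). So dl is fixed before s. *)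
Lemma source_term (u u' F : E3 R -> R) (C0 C C' S0 e : R) :
  L2r leb3 (box r : set mE3) u -> L2r leb3 (box r : set mE3) u' ->
  measurable_fun (box r : set mE3) F -> 0 <= C0 -> 0 <= C -> 0 <= C' ->
  (forall x, box r x -> `|F x| <= C0 * (`|u x| + `|u' x| + 1)) ->
  (forall s, S0 <= s -> \int[leb3]_(x in box r) (u x ^+ 2 * weight r s x) <= C * s^-1 ^+ 2) ->
  (forall s, S0 <= s -> \int[leb3]_(x in box r) (u' x ^+ 2 * weight r s x) <= C' * s^-1 ^+ 2) ->
  0 < e ->
  exists2 S : R, 1 <= S & forall s, S <= s ->
    `|\int[leb3]_(x in box r) (F x * testf r s x)| <= e * s^-1 ^+ 2.
Proof.
move=> Lu Lu' mF C00 C0' C0'' FP uP uP' e0.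
(* With this choice the two quadratic terms cost at most half of e s^-2; the + 1 keeps the
   denominator positive. *)
pose dl := e / (4 * C0 * (C + C') + 1).
have q0 : 0 < 4 * C0 * (C + C') + 1.
  by apply: ltr_wpDl => //; apply: mulr_ge0; [exact: mulr_ge0|exact: addr_ge0].
have d0 : 0 < dl by rewrite divr_gt0.
exists (Num.max 1 (Num.max S0 (4 * C0 * (dl^-1 + 1) / e))); first by rewrite le_max lexx.
move=> s; rewrite !ge_max => /andP[s1 /andP[Ss0 hs]].
have s0 : 0 < s := lt_le_trans ltr01 s1; have s0' := ltW s0.
have cw := smooth_continuous (smooth_weight s).
have w01 x (xr : box r x) := weight_01 s0' (box_coord_ge0 xr).
have mw := continuous_measurable_box cw.
have Iw := continuous_integrable_box r cw.
have IU := L2r_integrable_weight mB Lu mw w01.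
have IU' := L2r_integrable_weight mB Lu' mw w01.
have mFf : measurable_fun (box r : set mE3) (fun x => F x * testf r s x).
  apply: measurable_funM => //; apply: continuous_measurable_box.
  exact: smooth_continuous (smooth_testf r s).
have [|_ H] := normr_Rintegral_comb mB (x := 2 * C0 * (dl^-1 + 1))
    (y := 2 * C0 * dl) (z := 2 * C0 * dl) mFf Iw IU IU'.
  move=> x xr; have hF := FP x xr; have hf := testf_le r s0' (box_coord_ge0 xr).
  have /andP[w0 _] := w01 x xr.
  rewrite normrM; apply: le_trans (ler_pM (normr_ge0 _) (normr_ge0 _) hF hf) _.
  rewrite -(real_normK (num_real (u x))) -(real_normK (num_real (u' x))).
  move: (`|u x|) (`|u' x|) (weight r s x) w0 => a b w w0.
  have key (y : R) : y <= dl * y ^+ 2 + dl^-1 / 2.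
    have := mulr_ge0 (ltW d0) (sqr_ge0 (y - dl^-1 / 2)).
    rewrite (_ : dl * (y - dl^-1 / 2) ^+ 2 = dl * y ^+ 2 - y + dl^-1 / 4); last first.
      by field; rewrite gt_eqF.
    have i0 : 0 < dl^-1 by rewrite invr_gt0.
    by move: (dl^-1) (dl) i0 => p l ? ?; lra.
  have cw0 : 0 <= 2 * C0 * w by rewrite mulr_ge0// mulr_ge0.
  have := ler_wpM2l cw0 (lerD (key a) (key b)).
  by move: (dl^-1) (dl) => p l; lra.
apply: (source_final C00 C0' C0'' e0 s0 hs _ (uP s Ss0) (uP' s Ss0) H).
by rewrite (weightE r ord0); exact: Rintegral_weight_at_le.
Qed.

(** By 2 y <= y^2 / e + e, the trace bounds with their factor e^2 and the integral of the weight all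
    give terms of order e s^-2. The constant is 4 c from the weight plus 2 (16 c + 2) from the two
    traces, with c the face constant. *)
Lemma face_term i (g t t' : E3 R -> R) (a A S0 e : R) : 0 <= A -> 0 < e ->
  L2r surf (face i : set cE3) t -> L2r surf (face i : set cE3) t' ->
  measurable_fun (face i : set cE3) g ->
  (forall x, face i x -> `|g x - a| <= A * (e + `|t x| + `|t' x|)) ->
  (forall s, S0 <= s -> \int[surf]_(x in face i) (t x ^+ 2 * weight r s x) <=
     (16 * face_cst i + 2) * e ^+ 2 * s^-1 ^+ 2) ->
  (forall s, S0 <= s -> \int[surf]_(x in face i) (t' x ^+ 2 * weight r s x) <=
     (16 * face_cst i + 2) * e ^+ 2 * s^-1 ^+ 2) ->
  forall s, 1 <= s -> S0 <= s ->
  `|\int[surf]_(x in face i) (g x * testf r s x) -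
    a * (face_cst i * \int[leb2]_(p in sq r) testf r s (insert i p))| <=
  A * (36 * face_cst i + 4) * e * s^-1 ^+ 2.
Proof.
move=> A0 e0 Lt Lt' mg gP tP tP' s s1 Ss0.
have s0 : 0 < s := lt_le_trans ltr01 s1; have s0' := ltW s0.
have mF := measurable_face_surf r i.
have cw := smooth_continuous (smooth_weight s).
have w01 x (xr : face i x) := weight_01 s0' (face_ge0 r0 xr).
have mw : measurable_fun (face i : set cE3) (weight r s) by exact: continuous_measurable_face.
have Iw := continuous_integrable_face r i cw.
have IU := L2r_integrable_weight mF Lt mw w01.
have IU' := L2r_integrable_weight mF Lt' mw w01.
have cf := smooth_continuous (smooth_testf r s).
have mf : measurable_fun (face i : set cE3) (testf r s) by exact: continuous_measurable_face.
have mFf : measurable_fun (face i : set cE3) (fun x => (g x - a) * testf r s x).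
  exact: (measurable_funM (measurable_funB mg (measurable_cst a)) mf).
have [IF H] : surf.-integrable (face i : set cE3) (EFin \o (fun x => (g x - a) * testf r s x)) /\
    `|\int[surf]_(x in face i) ((g x - a) * testf r s x)| <=
    4 * A * e * \int[surf]_(x in face i) weight r s x +
    A / e * \int[surf]_(x in face i) (t x ^+ 2 * weight r s x) +
    A / e * \int[surf]_(x in face i) (t' x ^+ 2 * weight r s x).
  apply: (normr_Rintegral_comb mF mFf Iw IU IU').
  move=> x xr; have hF := gP x xr; have hf := testf_le r s0' (face_ge0 r0 xr).
  have /andP[w0 _] := w01 x xr.
  rewrite normrM; apply: le_trans (ler_pM (normr_ge0 _) (normr_ge0 _) hF hf) _.
  rewrite -(real_normK (num_real (t x))) -(real_normK (num_real (t' x))).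
  move: (`|t x|) (`|t' x|) (weight r s x) w0 => b c w w0.
  have key (y : R) : 2 * y <= y ^+ 2 / e + e.
    have ie : 0 <= e^-1 by rewrite invr_ge0 ltW.
    have := mulr_ge0 ie (sqr_ge0 (y - e)).
    by rewrite (_ : e^-1 * (y - e) ^+ 2 = y ^+ 2 / e - 2 * y + e); [lra|field; rewrite gt_eqF].
  have cw0 : 0 <= A * w by rewrite mulr_ge0.
  have := ler_wpM2l cw0 (lerD (key b) (key c)).
  by move: (e^-1) => p; lra.
have If := continuous_integrable_face r i cf.
have Igf : surf.-integrable (face i : set cE3) (EFin \o (fun x => g x * testf r s x)).
  have := integrableDR mF IF (integrableZR mF a If).
  by apply: eq_integrable => // x _ /=; congr EFin; ring.
rewrite -(continuous_Rintegral_face r i cf) -(RintegralZl a mF If).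
rewrite -(RintegralB mF Igf (integrableZR mF a If)).
rewrite (_ : \int[surf]_(x in face i) (g x * testf r s x - a * testf r s x) =
  \int[surf]_(x in face i) ((g x - a) * testf r s x)); last first.
  by apply: eq_Rintegral => x _; rewrite mulrBl.
apply: le_trans H _.
have fin (c v I1 I2 I3 : R) : 0 <= v -> I1 <= c * v -> I2 <= (16 * c + 2) * e ^+ 2 * v ->
    I3 <= (16 * c + 2) * e ^+ 2 * v ->
    4 * A * e * I1 + A / e * I2 + A / e * I3 <= A * (36 * c + 4) * e * v.
  move=> v0 h1 h2 h3; have Ae0 : 0 <= A / e by rewrite divr_ge0// ltW.
  have Ae1 : 0 <= 4 * A * e by rewrite mulr_ge0 ?(ltW e0)// mulr_ge0.
  have := ler_wpM2l Ae1 h1; have := ler_wpM2l Ae0 h2; have := ler_wpM2l Ae0 h3.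
  rewrite (_ : A / e * ((16 * c + 2) * e ^+ 2 * v) = A * (16 * c + 2) * e * v); last first.
    by field; rewrite gt_eqF.
  by lra.
exact: (fin _ _ _ _ _ (sqr_ge0 _) (Rintegral_weight_face i s0) (tP s Ss0) (tP' s Ss0)).
Qed.

End core_estimate.

Section core_bound.
Context {R : realType}.
Notation mR := (measurableTypeR R).
Notation mR2 := (mR * mR)%type.
Notation mE3 := (E3 mR).
Notation cE3 := (caratheodory_type (@haus_outer R)).
Notation mu := (@lebesgue_measure R).
Notation face r i := (insert i @` sq r).

(** The face integrals of the test function are nonnegative, so the first alone bounds their sum
    from below. *)
Let combine_faces (X Y B c : 'I_3 -> R) (P Q a e v : R) : 0 < v ->
  (forall i, `|X i - a * Y i| <= B i * e * v) -> `|P| <= e * v -> `|Q| <= e * v ->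
  \sum_(i < 3) X i = - P + Q -> c ord0 * (v / 160) <= Y ord0 -> (forall i, 0 <= Y i) ->
  `|a| * (c ord0 / 160) <= (2 + \sum_(i < 3) B i) * e.
Proof.
move=> v0 hX hP hQ hs hY Y0; rewrite -(ler_pM2r v0).
have h1 : `|\sum_(i < 3) X i - a * \sum_(i < 3) Y i| <= (\sum_(i < 3) B i) * e * v.
  rewrite mulr_sumr -sumrB !mulr_suml; apply: le_trans (ler_norm_sum _ _ _) _.
  by apply: ler_sum => i _; exact: hX.
have h2 : Y ord0 <= \sum_(i < 3) Y i.
  by rewrite big_ord_recl lerDl sumr_ge0.
have h3 : `|a| * (c ord0 / 160) * v <= `|a * \sum_(i < 3) Y i|.
  rewrite normrM -mulrA; apply: ler_wpM2l => //.
  rewrite ger0_norm ?sumr_ge0//; apply: le_trans h2; apply: le_trans hY.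
  by rewrite -mulrA (mulrC v).
apply: le_trans h3 _; rewrite hs in h1.
move: h1 hP hQ; rewrite !ler_norml => /andP[h1 h2'] /andP[p1 p2] /andP[q1 q2].
by apply/andP; split; lra.
Qed.

(** Every term scales like s^-2, so a single sufficiently large s is enough and it drops out: what
    remains bounds the apex value by a multiple of e. *)
Lemma core_bound r (u u' F g t t' : E3 R -> R) (a A C0 C C' S0 e : R) : 0 < r ->
  L2r leb3 (box r : set mE3) u -> L2r leb3 (box r : set mE3) u' ->
  measurable_fun (box r : set mE3) F -> 0 <= C0 -> 0 <= C -> 0 <= C' ->
  (forall x, box r x -> `|F x| <= C0 * (`|u x| + `|u' x| + 1)) ->
  (forall s, S0 <= s -> \int[leb3]_(x in box r) (u x ^+ 2 * weight r s x) <= C * s^-1 ^+ 2) ->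
  (forall s, S0 <= s -> \int[leb3]_(x in box r) (u' x ^+ 2 * weight r s x) <= C' * s^-1 ^+ 2) ->
  0 <= A -> 0 < e ->
  (forall i, L2r surf (face r i : set cE3) t) ->
  (forall i, L2r surf (face r i : set cE3) t') ->
  (forall i, measurable_fun (face r i : set cE3) g) ->
  (forall i x, face r i x -> `|g x - a| <= A * (e + `|t x| + `|t' x|)) ->
  (forall i s, S0 <= s -> \int[surf]_(x in face r i) (t x ^+ 2 * weight r s x) <=
     (16 * face_cst i + 2) * e ^+ 2 * s^-1 ^+ 2) ->
  (forall i s, S0 <= s -> \int[surf]_(x in face r i) (t' x ^+ 2 * weight r s x) <=
     (16 * face_cst i + 2) * e ^+ 2 * s^-1 ^+ 2) ->
  (forall psi, smooth psi -> vanishes_outside r psi ->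
     \sum_(i < 3) \int[surf]_(x in face r i) (g x * psi x) =
     - (\int[leb3]_(x in box r) (u x * laplacian psi x)) +
     \int[leb3]_(x in box r) (F x * psi x)) ->
  `|a| * (@face_cst R ord0 / 160) <=
  (2 + \sum_(i < 3) A * (36 * @face_cst R i + 4)) * e.
Proof.
move=> r0 Lu Lu' mF C00 C0' C0'' FP uP uP' A0 e0 Lt Lt' mg gP tP tP' green.
have [S1 S11 H1] := laplacian_term r0 Lu e0.
have [S2 S21 H2] := source_term r0 Lu Lu' mF C00 C0' C0'' FP uP uP' e0.
have [S3 S31 H3] := Rintegral_testf_faces r0.
pose s := Num.max S0 (Num.max S1 (Num.max S2 S3)).
have Ss0 : S0 <= s by rewrite /s le_max lexx.
have Ss1 : S1 <= s by rewrite /s !le_max lexx orbT.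
have Ss2 : S2 <= s by rewrite /s !le_max lexx !orbT.
have Ss3 : S3 <= s by rewrite /s !le_max lexx !orbT.
have s1 := le_trans S11 Ss1; have s0 : 0 < s := lt_le_trans ltr01 s1.
have v0 : 0 < s^-1 ^+ 2 by rewrite exprn_gt0// invr_gt0.
have [Hf Hf0] := H3 s Ss3.
pose Y (i : 'I_3) := face_cst i * \int[leb2]_(p in sq r) testf r s (insert i p).
pose X (i : 'I_3) := \int[surf]_(x in face r i) (g x * testf r s x).
pose B (i : 'I_3) := A * (36 * @face_cst R i + 4).
have HG := green _ (smooth_testf r s) (testf_vanishes r0 s).
have HC := @combine_faces X Y B (@face_cst R) _ _ a e _ v0 _ (H1 s Ss1) (H2 s Ss2) HG.
apply: HC.
- move=> i.
  exact: (face_term r0 A0 e0 (Lt i) (Lt' i) (mg i) (gP i) (tP i) (tP' i) s1 Ss0).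
- rewrite /Y; apply: ler_wpM2l; first exact: ltW (face_cst_gt0 _).
  by apply: le_trans Hf; rewrite invfM exprVn mulrC.
- by move=> i; rewrite mulr_ge0// ltW// face_cst_gt0.
Qed.

End core_bound.

(** * From test functions supported inside the box to those that reach its faces *)

Section interior_pairing.
Context {R : realType}.
Notation mR := (measurableTypeR R).
Notation mR2 := (mR * mR)%type.
Notation mE3 := (E3 mR).

Lemma Rintegral_subset d (T : measurableType d) (m : {measure set T -> \bar R})
    (D O : set T) (f : T -> R) : D `<=` O -> (forall x, O x -> ~ D x -> f x = 0) ->
  \int[m]_(x in O) f x = \int[m]_(x in D) f x.
Proof.
move=> DO f0; rewrite Rintegral_mkcond [in RHS]Rintegral_mkcond; congr Rintegral.
apply/funext => x; rewrite !patchE; case: ifPn => [|nO].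
  rewrite inE => Ox; case: ifPn => // nD; apply: f0 => // Dx.
  by move/negP: nD; rewrite inE.
by case: ifPn => // /set_mem /DO Ox; move/negP: nO; rewrite inE.
Qed.

(* Test functions supported inside the box are dense enough: multiply psi by
   cut-offs vanishing near the faces and use dominated convergence. *)
Lemma pairing_zero r (O : set (E3 R)) (g : E3 R -> R) : 0 < r -> box r `<=` O ->
  L2r leb3 (box r : set mE3) g ->
  (forall phi, test_fun O phi -> vanishes_outside r phi ->
    \int[leb3]_(x in box r) (g x * phi x) = 0) ->
  forall psi, smooth psi -> vanishes_outside r psi ->
  \int[leb3]_(x in box r) (g x * psi x) = 0.
Proof.
move=> r0 BO Lg g0 psi sp vp; have mB := measurable_box r.
pose c (n : nat) (t : R) := bump_half (- (n.+1%:R) * t + 3).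
have sc n : smooth1 (c n).
  exact: smooth1_comp smooth1_bump_half (smooth1_affine _ _).
have c0 n t : t <= n.+1%:R^-1 -> c n t = 0.
  move=> tn; apply: bump_half0.
  have : n.+1%:R * t <= 1 :> R by rewrite mulrC -ler_pdivlMr ?div1r.
  by rewrite mulNr; lra.
have c1 n t : 2 / n.+1%:R <= t -> c n t = 1.
  move=> tn; apply: bump_half1.
  have : 2 <= n.+1%:R * t :> R by rewrite mulrC -ler_pdivrMr.
  by rewrite mulNr; lra.
have c01 n t : 0 <= c n t <= 1 by rewrite bump_half_ge0 bump_half_le1.
pose chi n := tensor (c n) (c n) (c n).
have schi n : smooth (chi n) by exact: smooth_tensor.
have chi01 n x : 0 <= chi n x <= 1.
  have /andP[p0 p1] := c01 n x.1.1; have /andP[q0 q1] := c01 n x.1.2.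
  have /andP[s0 s1] := c01 n x.2.
  apply/andP; split; first exact: mulr_ge0 (mulr_ge0 p0 q0) s0.
  exact: mulr_ile1 (mulr_ge0 p0 q0) s0 (mulr_ile1 p0 q0 p1 q1) s1.
pose phi n x := psi x * chi n x.
have sphi n : smooth (phi n) by exact: smoothM.
have vphi n x : (exists i, coord i x < n.+1%:R^-1) \/ (exists i, r < coord i x) -> phi n x = 0.
  case=> [[i xi]|[i xi]]; last first.
    by rewrite /phi vp ?mul0r//; exists i; rewrite (le_trans (ltW xi))// ler_norm.
  have := c0 n _ (ltW xi); rewrite /phi /chi /tensor /coord.
  by case: i {xi} => [[|[|m]] ilt] /= ->; rewrite ?mul0r ?mulr0 ?mul0r ?mulr0.
have tphi n : test_fun O (phi n).
  split=> //; pose K : set (E3 R) := (`[n.+1%:R^-1, r] `*` `[n.+1%:R^-1, r]) `*` `[n.+1%:R^-1, r].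
  have n0 : 0 < n.+1%:R^-1 :> R by rewrite invr_gt0.
  exists K; split.
  - by do 2?apply: compact_setX; exact: segment_compact.
  - move=> x; rewrite /K /= !in_itv /= => -[[/andP[a1 a2] /andP[b1 b2]] /andP[d1 d2]].
    apply: BO; rewrite /box /sq /= !in_itv /= a2 b2 d2 !(lt_le_trans n0)//.
  - move=> x nK; apply: vphi; apply: contrapT => /not_orP[h1 h2]; apply: nK.
    have b i : n.+1%:R^-1 <= coord i x <= r.
      apply/andP; split; rewrite leNgt; apply/negP => h; [apply: h1|apply: h2]; by exists i.
    have := b (@Ordinal 3 0 isT); have := b (@Ordinal 3 1 isT); have := b (@Ordinal 3 2 isT).
    by rewrite /K /= !in_itv /coord /=.
have z n : \int[leb3]_(x in box r) (g x * phi n x) = 0.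
  by apply: g0 => // x xr; rewrite /phi vp ?mul0r.
have Lp := continuous_L2r_box r (smooth_continuous sp).
have Igp := L2r_mul mB Lg Lp.
have mphi n : measurable_fun (box r : set mE3) (fun x => g x * phi n x).
  exact: (measurable_funM (proj1 Lg)
    (proj1 (continuous_L2r_box r (smooth_continuous (sphi n))))).
have bnd n x : `|g x * phi n x| <= `|g x * psi x|.
  have /andP[h0 h1] := chi01 n x.
  by rewrite /phi mulrA normrM (ger0_norm h0) ler_piMr.
have Iphi n : leb3.-integrable (box r : set mE3) (EFin \o (fun x => g x * phi n x)).
  exact: (le_integrableR mB (mphi n) (integrable_norm Igp) (fun x _ => bnd n x)).
have cvg_pt x : box r x -> (fun n => (g x * phi n x)%:E) @ \oo --> (g x * psi x)%:E.
  move=> /boxP xr; apply: cvg_near_cst.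
  have E i : \forall n \near \oo, c n (coord i x) = 1.
    have /andP[xi _] := xr i; near=> n; apply: c1.
    rewrite ler_pdivrMr// mulrC -ler_pdivrMr//.
    apply: (@le_trans _ _ n%:R); last by rewrite ler_nat.
    by near: n; exact: nbhs_infty_ger.
  have E0 := E (@Ordinal 3 0 isT); have E1 := E (@Ordinal 3 1 isT).
  have E2 := E (@Ordinal 3 2 isT); rewrite /coord /= in E0 E1 E2.
  have [n0 _ h0] := E0; have [n1 _ h1] := E1; have [n2 _ h2] := E2.
  exists (maxn n0 (maxn n1 n2)) => // n /=; rewrite !geq_max => /and3P[l0 l1 l2].
  by rewrite /phi /chi /tensor (h0 n l0) (h1 n l1) (h2 n l2) !mulr1.
pose fn n : mE3 -> \bar R := EFin \o (fun x => g x * phi n x).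
pose fl : mE3 -> \bar R := EFin \o (fun x => g x * psi x).
have A1 : {ae leb3, forall x : mE3, box r x -> (fun n => fn n x) @ \oo --> fl x}.
  exact: aeW.
have A2 : {ae leb3, forall (x : mE3) n, box r x -> (`|fn n x| <= `|fl x|)%E}.
  by apply: aeW => x n _; exact: bnd.
have [_ _ H] := dominated_convergence mB (fun n => measurable_int _ (Iphi n))
  (measurable_int _ Igp) A1 (integrable_abse Igp) A2.
have E n : (\int[leb3]_(x in box r) fn n x = 0)%E.
  rewrite -(fineK (integrable_fin_num mB (Iphi n))); congr EFin; exact: z.
have H0 : (fun n => \int[leb3]_(x in box r) fn n x)%E @ \oo --> 0%E.
  by under eq_fun do rewrite E; exact: cvg_cst.
have HE := cvg_unique _ H H0.
by rewrite /Rintegral [X in fine X]HE.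
Unshelve. all: by end_near.
Qed.

End interior_pairing.

(** * Weak derivatives and traces near the corner *)

Section complex_parts.
Context {R : realType}.

Definition part (b : bool) (z : R[i]) : R := if b then complex.Re z else complex.Im z.

Lemma partD b z y : part b (z + y) = part b z + part b y.
Proof. by case: b z y => [] [? ?] [? ?]. Qed.

Lemma partN b z : part b (- z) = - part b z.
Proof. by case: b z => [] [? ?]. Qed.

Lemma partB b z y : part b (z - y) = part b z - part b y.
Proof. by rewrite partD partN. Qed.

Lemma partMr b z (a : R) : part b (z * a%:C) = part b z * a.
Proof. by case: b z => [] [x y] /=; rewrite !mulr0 ?subr0 ?add0r. Qed.

Lemma partMl b z (a : R) : part b (a%:C * z) = a * part b z.
Proof. by rewrite mulrC partMr mulrC. Qed.

Lemma part_sum b n (F : 'I_n -> R[i]) : part b (\sum_(i < n) F i) = \sum_(i < n) part b (F i).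
Proof.
elim/big_rec2: _ => [|i x y _ <-]; first by case: b.
by rewrite partD.
Qed.

Lemma normc_sqr (z : R[i]) : ComplexField.Normc.normc z ^+ 2 = part true z ^+ 2 + part false z ^+ 2.
Proof. by case: z => x y; rewrite sqr_sqrtr// addr_ge0// sqr_ge0. Qed.

Lemma normc_nonneg (z : R[i]) : 0 <= ComplexField.Normc.normc z.
Proof. by case: z => x y; exact: sqrtr_ge0. Qed.

Lemma part_le_normc b z : `|part b z| <= ComplexField.Normc.normc z.
Proof.
rewrite -(@ler_pXn2r _ 2)// ?nnegrE ?normc_nonneg// real_normK ?num_real// normc_sqr.
by case: b; rewrite ?lerDl ?lerDr sqr_ge0.
Qed.

Lemma normc_le_parts (z : R[i]) :
  ComplexField.Normc.normc z <= `|part true z| + `|part false z|.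
Proof.
rewrite -(@ler_pXn2r _ 2)// ?nnegrE ?normc_nonneg ?addr_ge0// normc_sqr sqrrD.
by rewrite !real_normK ?num_real// -addrA lerD2l lerDr mulrn_wge0// mulr_ge0.
Qed.

Lemma part_cintegral b d (T : measurableType d) (m : {measure set T -> \bar R})
    (D : set T) f : part b (cintegral m D f) = \int[m]_(x in D) part b (f x).
Proof. by case: b. Qed.

Lemma part_inj (z y : R[i]) : (forall b, part b z = part b y) -> z = y.
Proof. by case: z y => [a b] [c e] H; have /= -> := H true; have /= -> := H false. Qed.

Section L2_parts.
Context d (T : measurableType d) (m : {measure set T -> \bar R}).
Variables (O D : set T).
Hypotheses (mO : measurable O) (mD : measurable D) (DO : D `<=` O).

Lemma cmeasurable_part (f : T -> R[i]) b : cmeasurable O f ->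
  measurable_fun D (fun x => part b (f x)).
Proof. by move=> [mr mi]; apply: (measurable_funS mO DO); case: b. Qed.

Lemma sqL2_part (f : T -> R[i]) b (e : R) : cmeasurable O f -> (sqL2 m O f <= e%:E)%E ->
  L2r m D (fun x => part b (f x)) /\ sqn m D (fun x => part b (f x)) <= e.
Proof.
move=> cf le; have mf := cmeasurable_part b cf.
have mp b' : measurable_fun O (fun x => part b' (f x)) by case: b'; case: cf.
have mn : measurable_fun O (fun x => (ComplexField.Normc.normc (f x) ^+ 2)%:E).
  apply/measurable_EFinP; under eq_fun do rewrite normc_sqr.
  by apply: measurable_funD; exact: measurable_funX.
have m2 : measurable_fun D (fun x => (part b (f x) ^+ 2)%:E).
  by apply/measurable_EFinP; exact: measurable_funX.
have H : (\int[m]_(x in D) (part b (f x) ^+ 2)%:E <= e%:E)%E.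
  apply: le_trans le; rewrite /sqL2.
  apply: (@le_trans _ _ (\int[m]_(x in D) (ComplexField.Normc.normc (f x) ^+ 2)%:E)%E).
    apply: ge0_le_integral => //.
    - by move=> x _; rewrite lee_fin sqr_ge0.
    - exact: measurable_funS mn.
    - move=> x _; rewrite lee_fin normc_sqr.
      by case: (b); rewrite ?lerDl ?lerDr sqr_ge0.
  by apply: ge0_subset_integral => // x _; rewrite lee_fin sqr_ge0.
have I : m.-integrable D (fun x => (part b (f x) ^+ 2)%:E).
  apply/integrableP; split => //.
  under eq_integral do rewrite gee0_abs ?lee_fin ?sqr_ge0//.
  exact: le_lt_trans H (ltry _).
split; first by split.
by rewrite -lee_fin /sqn /Rintegral fineK//; exact: integrable_fin_num.
Qed.

Lemma L2_part (f : T -> R[i]) b : L2 m O f -> L2r m D (fun x => part b (f x)).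
Proof.
move=> [cf fin]; have f0 : (0 <= sqL2 m O f)%E.
  by apply: integral_ge0 => x _; rewrite lee_fin sqr_ge0.
have le : (sqL2 m O f <= (fine (sqL2 m O f))%:E)%E by rewrite fineK// ge0_fin_numE.
exact: (sqL2_part b cf le).1.
Qed.

End L2_parts.

Lemma cmeasurableB d (T : measurableType d) (O : set T) (f g : T -> R[i]) :
  cmeasurable O f -> cmeasurable O g -> cmeasurable O (fun x => f x - g x).
Proof.
move=> [fr fi] [gr gi]; split.
  rewrite (_ : (fun x => _) = (fun x => complex.Re (f x) - complex.Re (g x))); last first.
    by apply/funext => x; exact: (partB true).
  exact: measurable_funB.
rewrite (_ : (fun x => _) = (fun x => complex.Im (f x) - complex.Im (g x))); last first.
  by apply/funext => x; exact: (partB false).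
exact: measurable_funB.
Qed.

End complex_parts.

(** * Normal derivatives tested near the corner *)

Section normal_derivative.
Context {R : realType}.
Notation mR := (measurableTypeR R).
Notation mR2 := (mR * mR)%type.
Notation mE3 := (E3 mR).

Variables (Omega Gamma : set (E3 R)) (r : R).
Hypotheses (r0 : 0 < r) (mO : measurable (Omega : set mE3)) (BO : box r `<=` Omega).
Hypothesis OB : forall x, Omega x -> (forall i, `|coord i x| < r) -> box r x.
Hypothesis cube_Gamma : forall x, (forall i, `|coord i x| <= r) -> bdry Omega x -> Gamma x.

Let mB := @measurable_box R r.

Lemma vanishes_outside_box (f : E3 R -> R) x : vanishes_outside r f -> Omega x ->
  ~ box r x -> f x = 0.
Proof.
move=> vf Ox nB; apply: vf; apply: contrapT => h; apply: nB; apply: OB => // i.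
by rewrite ltNge; apply/negP => hi; apply: h; exists i.
Qed.

(** The cube where psi lives may leave Omega, but it meets the boundary of Omega only inside Gamma,
    which is what a boundary test function must satisfy. *)
Lemma vanishes_outside_bdry_test psi : smooth psi -> vanishes_outside r psi ->
  bdry_test_fun Omega Gamma psi.
Proof.
move=> sp vp; split=> //.
pose K : set (E3 R) := (`[- r, r] `*` `[- r, r]) `*` `[- r, r].
have KP x : K x <-> forall i, `|coord i x| <= r.
  rewrite /K /= !in_itv /= -!ler_norml; split=> [[[x1 x2] x3] i|h].
    by rewrite /coord; case: i => [[|[|m]] ilt].
  have := h (@Ordinal 3 0 isT); have := h (@Ordinal 3 1 isT); have := h (@Ordinal 3 2 isT).
  by rewrite /coord /=.
exists K; split.
- by do 2?apply: compact_setX; exact: segment_compact.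
- by move=> x /KP xr [bx nG]; apply: nG; exact: cube_Gamma.
- move=> x nK; apply: vp; apply: contrapT => h; apply: nK; apply/KP => i.
  by rewrite leNgt; apply/negP => hi; apply: h; exists i; exact: ltW.
Qed.

(** Distributional identities are tested with functions supported inside Omega; for L^2 functions
    they persist for psi that does not vanish on the faces, by [pairing_zero]. *)
Lemma pairing_eq (f g : E3 R -> R[i]) b : L2r leb3 (box r : set mE3) (fun x => part b (f x)) ->
  L2r leb3 (box r : set mE3) (fun x => part b (g x)) ->
  (forall phi, test_fun Omega phi -> cintegral leb3 Omega (fun x => f x * (phi x)%:C) =
     cintegral leb3 Omega (fun x => g x * (phi x)%:C)) ->
  forall psi, smooth psi -> vanishes_outside r psi ->
  \int[leb3]_(x in box r) (part b (f x) * psi x) =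
  \int[leb3]_(x in box r) (part b (g x) * psi x).
Proof.
move=> Lf Lg fg psi sp vp.
have Lfg := L2rB mB Lf Lg.
have red (h : E3 R -> R[i]) phi : vanishes_outside r phi ->
    part b (cintegral leb3 Omega (fun x => h x * (phi x)%:C)) =
    \int[leb3]_(x in box r) (part b (h x) * phi x).
  move=> vphi; rewrite part_cintegral.
  rewrite (@Rintegral_subset _ _ mE3 leb3 (box r) Omega)//.
    by apply: eq_Rintegral => x _; rewrite partMr.
  by move=> x Ox nB; rewrite partMr (vanishes_outside_box vphi)// mulr0.
have split_int phi : continuous phi ->
    \int[leb3]_(x in box r) ((part b (f x) - part b (g x)) * phi x) =
    \int[leb3]_(x in box r) (part b (f x) * phi x) -
    \int[leb3]_(x in box r) (part b (g x) * phi x).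
  move=> cp; have Lp := continuous_L2r_box r cp.
  rewrite -(RintegralB mB (L2r_mul mB Lf Lp) (L2r_mul mB Lg Lp)).
  by apply: eq_Rintegral => x _; rewrite mulrBl.
apply/eqP; rewrite -subr_eq0; apply/eqP.
rewrite -(split_int _ (smooth_continuous sp)).
apply: (pairing_zero r0 BO Lfg _ sp vp) => phi tphi vphi.
rewrite (split_int _ (smooth_continuous tphi.1)).
by apply/eqP; rewrite subr_eq0 -!red// fg.
Qed.

Lemma Rintegral_sum3 (a : 'I_3 -> E3 R -> R) (c : E3 R -> R) :
  (forall i, leb3.-integrable (box r : set mE3) (EFin \o a i)) ->
  leb3.-integrable (box r : set mE3) (EFin \o c) ->
  \int[leb3]_(x in box r) (\sum_(i < 3) a i x + c x) =
  \sum_(i < 3) \int[leb3]_(x in box r) a i x + \int[leb3]_(x in box r) c x.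
Proof.
move=> Ia Ic; rewrite !big_ord_recl big_ord0 addr0.
rewrite -(RintegralD mB (Ia _) (Ia _)) -(RintegralD mB (Ia _) (integrableDR mB (Ia _) (Ia _))).
rewrite -(RintegralD mB (integrableDR mB (Ia _) (integrableDR mB (Ia _) (Ia _))) Ic).
by apply: eq_Rintegral => x _; rewrite !big_ord_recl big_ord0 addr0.
Qed.

(** [N] comes with a gradient and a Laplacian of its own. Both are determined by their pairings, so
    they can be exchanged for the gradient G of the trace approximation and the right-hand side F of
    the equation. *)
Lemma normal_identity (v F : E3 R -> R[i]) (N : (E3 R -> R) -> R[i])
    (G : 'I_3 -> E3 R -> R[i]) b psi :
  is_normal_derivative Omega Gamma v N -> weak_laplacian Omega v F ->
  L2r leb3 (box r : set mE3) (fun x => part b (F x)) ->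
  weak_gradient Omega v G -> smooth psi -> vanishes_outside r psi ->
  part b (N psi) =
  \sum_(i < 3) \int[leb3]_(x in box r) (part b (G i x) * partial i psi x) +
  \int[leb3]_(x in box r) (part b (F x) * psi x).
Proof.
move=> [G0 [L [wG0 L2L wL NE]]] wF LF wG sp vp.
rewrite NE; last exact: vanishes_outside_bdry_test.
have LG0 i := L2_part mO mB BO b (wG0 i).1; have LG i := L2_part mO mB BO b (wG i).1.
have LL := L2_part mO mB BO b L2L.
have sdp i := smooth_partial i sp; have vdp i := partial_vanishes i sp vp.
have Ldp i := continuous_L2r_box r (smooth_continuous (sdp i)).
have Lp := continuous_L2r_box r (smooth_continuous sp).
rewrite part_cintegral.
have pE x : part b (\sum_(i < 3) G0 i x * (partial i psi x)%:C + L x * (psi x)%:C) =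
    \sum_(i < 3) (part b (G0 i x) * partial i psi x) + part b (L x) * psi x.
  rewrite partD part_sum partMr; congr (_ + _).
  by apply: eq_bigr => i _; rewrite partMr.
rewrite (@Rintegral_subset _ _ mE3 leb3 (box r) Omega)//; last first.
  move=> x Ox nB; rewrite pE (vanishes_outside_box vp)// mulr0 addr0 big1// => i _.
  by rewrite (vanishes_outside_box (vdp i))// mulr0.
transitivity (\int[leb3]_(x in box r)
    (\sum_(i < 3) (part b (G0 i x) * partial i psi x) + part b (L x) * psi x)).
  by apply: eq_Rintegral => x _; exact: pE.
rewrite (Rintegral_sum3 (fun i => L2r_mul mB (LG0 i) (Ldp i)) (L2r_mul mB LL Lp)).
congr (_ + _).
  apply: eq_bigr => i _; apply: (pairing_eq (LG0 i) (LG i)) => // phi tphi.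
  by apply: oppr_inj; rewrite -(wG0 i).2// -(wG i).2.
by apply: (pairing_eq LL LF) => // phi tphi; rewrite -wL// -wF.
Qed.

End normal_derivative.

Section pieces.
Context d (T : measurableType d) (R : realType) (m : {measure set T -> \bar R}).

(** The null set [Z] is meant for the edges of the corner, which belong to no face. *)
Lemma Rintegral_pieces (G Z : set T) (F : 'I_3 -> set T) (k : T -> R) :
  measurable G -> (forall i, measurable (F i)) -> m.-negligible Z ->
  measurable_fun G k -> (forall i, m.-integrable (F i) (EFin \o k)) ->
  (forall i, F i `<=` G) -> (forall i j x, F i x -> F j x -> i = j) ->
  (forall x, G x -> k x != 0 -> ~ Z x -> exists i, F i x) ->
  \int[m]_(x in G) k x = \sum_(i < 3) \int[m]_(x in F i) k x.
Proof.
move=> mG mF [N [mN N0 ZN]] mk Ik FG Fd cover.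
pose f i := k \_ (F i).
have If i : m.-integrable setT (EFin \o f i).
  by have /(integrable_mkcond _ (mF i)) := Ik i; apply: eq_integrable => // x _;
    rewrite /f /= restrict_EFin.
have S3 (a : 'I_3 -> R) : \sum_(i < 3) a i =
    a ord0 + (a (lift ord0 ord0) + a (lift ord0 (lift ord0 ord0))).
  by rewrite !big_ord_recl big_ord0 addr0.
pose S x := f ord0 x + (f (lift ord0 ord0) x + f (lift ord0 (lift ord0 ord0)) x).
have SE x : S x = \sum_(i < 3) f i x by rewrite (S3 (fun i => f i x)).
have mkG : measurable_fun setT (k \_ G) by apply/(measurable_restrictT _ mG).
have IS : m.-integrable setT (EFin \o S).
  exact: (integrableDR measurableT (If _) (integrableDR measurableT (If _) (If _))).
have ES : forall x, ~ N x -> (k \_ G) x = S x.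
  move=> x nN; rewrite SE.
  have [[i Fi]|nF] := pselect (exists i, F i x).
    rewrite (bigD1 i)//= big1 ?addr0.
      by rewrite /f !patchE !mem_set//; exact: FG Fi.
    move=> j ji; rewrite /f patchE ifF//; apply/negbTE/negP => /set_mem Fj.
    by move/eqP: ji; apply; exact: Fd Fj Fi.
  rewrite big1 => [|j _]; last first.
    rewrite /f patchE ifF//; apply/negbTE/negP => /set_mem Fj.
    by apply: nF; exists j.
  rewrite patchE; case: ifPn => // /set_mem Gx.
  apply/eqP/negPn/negP => k0; apply: nF; apply: cover => // Zx.
  by apply: nN; exact: ZN.
rewrite Rintegral_mkcond.
have -> : \int[m]_x (k \_ G) x = \int[m]_x S x.
  rewrite /Rintegral; congr fine; apply: ae_eq_integral => //.
  - exact/measurable_EFinP.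
  - exact: measurable_int IS.
  exists N; split=> // x /= h; apply: contrapT => nN; apply: h => _.
  by rewrite ES.
rewrite S3 (Rintegral_mkcond _ (F ord0)) (Rintegral_mkcond _ (F (lift ord0 ord0))).
rewrite (Rintegral_mkcond _ (F (lift ord0 (lift ord0 ord0)))).
rewrite -(RintegralD measurableT (If _) (If _)).
by rewrite -(RintegralD measurableT (If _) (integrableDR measurableT (If _) (If _))).
Qed.

End pieces.

(** * Smooth approximation of a function together with its trace *)

Section trace_approximation.
Context {R : realType}.
Notation mR := (measurableTypeR R).
Notation mR2 := (mR * mR)%type.
Notation mE3 := (E3 mR).
Notation cE3 := (caratheodory_type (@haus_outer R)).
Notation face r i := (insert i @` sq r).

Lemma near_le_of_cvg0 (f : nat -> \bar R) (e : R) : 0 < e ->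
  f @ \oo --> 0%E -> \forall n \near \oo, (f n <= e%:E)%E.
Proof.
move=> e0 cf; have : \forall n \near \oo, (f n < e%:E)%E.
  by apply: (cf [set y | (y < e%:E)%E]); apply: open_ereal_lt'; rewrite lte_fin.
by apply: filterS => n /ltW.
Qed.

Variables (Omega : set (E3 R)) (r : R).
Hypotheses (mO : measurable (Omega : set mE3)) (BO : box r `<=` Omega).
Hypothesis mbd : measurable (bdry Omega : set cE3).
Hypothesis face_bdry : forall i, face r i `<=` bdry Omega.

Lemma csmooth_part (f : E3 R -> R[i]) b : csmooth f -> smooth (fun x => part b (f x)).
Proof. by case: b => sf; [exact: sf.1|exact: sf.2]. Qed.

Lemma part_cpartial b i (f : E3 R -> R[i]) x :
  part b (cpartial i f x) = partial i (fun y => part b (f y)) x.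
Proof. by case: b. Qed.

Let csmooth_cmeasurable (f : E3 R -> R[i]) (D : set (E3 R)) : csmooth f ->
  cmeasurable (D : set mE3) f.
Proof.
move=> sf; split; apply: measurable_funTS; apply: continuous_measurable3.
  exact: smooth_continuous (csmooth_part true sf).
exact: smooth_continuous (csmooth_part false sf).
Qed.

Let csmooth_cmeasurable_surf (f : E3 R -> R[i]) (D : set (E3 R)) : csmooth f ->
  cmeasurable (D : set cE3) f.
Proof.
move=> sf; split; apply: measurable_funTS; apply: measurable_funT_surf;
  apply: continuous_measurable3.
  exact: smooth_continuous (csmooth_part true sf).
exact: smooth_continuous (csmooth_part false sf).
Qed.

Lemma cpartial_cmeasurable (f : E3 R -> R[i]) i (D : set (E3 R)) : csmooth f ->
  cmeasurable (D : set mE3) (cpartial i f).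
Proof.
move=> sf; split; apply: measurable_funTS; apply: continuous_measurable3.
  exact: smooth_continuous (smooth_partial i (csmooth_part true sf)).
exact: smooth_continuous (smooth_partial i (csmooth_part false sf)).
Qed.

(** The point is that one smooth U is close to v, to its gradient and to its trace at the same time,
    and for both the real and the imaginary part. *)
Lemma trace_approx (v tv : E3 R -> R[i]) : L2 leb3 Omega v -> is_trace Omega v tv ->
  L2 surf (bdry Omega) tv /\
  exists G, weak_gradient Omega v G /\ forall e, 0 < e -> exists2 U, csmooth U & forall b,
   [/\ sqn leb3 (box r : set mE3) (fun x => part b (U x) - part b (v x)) <= e,
    forall i, sqn leb3 (box r : set mE3)
      (fun x => partial i (fun y => part b (U y)) x - part b (G i x)) <= e &
    forall i, sqn surf (face r i : set cE3) (fun x => part b (U x) - part b (tv x)) <= e].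
Proof.
move=> L2v [L2t [G [un [wG sun cu cG ct]]]]; split=> //; exists G; split=> // e e0.
have mB := @measurable_box R r.
have H1 := near_le_of_cvg0 e0 cu; have H3 := near_le_of_cvg0 e0 ct.
have H2 i := near_le_of_cvg0 e0 (cG i).
have [n1 _ K1] := H1; have [n2 _ K2] := filter_forall _ H2; have [n3 _ K3] := H3.
pose n := maxn n1 (maxn n2 n3).
have h1 := K1 n (leq_maxl _ _); have h3 := K3 n (leq_trans (leq_maxr _ _) (leq_maxr _ _)).
have h2 := K2 n (leq_trans (leq_maxl _ _) (leq_maxr _ _)); exists (un n) => // b.
have mu := sun n; split.
- have [_] := sqL2_part mO mB BO b (cmeasurableB (csmooth_cmeasurable _ mu) L2v.1) h1.
  by under [X in X <= _ -> _]eq_Rintegral do rewrite partB.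
- move=> i; have [_] := sqL2_part mO mB BO b
    (cmeasurableB (cpartial_cmeasurable i _ mu) (wG i).1.1) (h2 i).
  by under [X in X <= _ -> _]eq_Rintegral do rewrite partB part_cpartial.
- move=> i; have [_] := sqL2_part mbd (measurable_face_surf r i) (@face_bdry i) b
    (cmeasurableB (csmooth_cmeasurable_surf _ mu) L2t.1) h3.
  by under [X in X <= _ -> _]eq_Rintegral do rewrite partB.
Qed.

End trace_approximation.

(** * Geometry of the corner and of its faces *)

Section corner_geometry.
Context {R : realType}.
Notation mR := (measurableTypeR R).
Notation mR2 := (mR * mR)%type.
Notation mE3 := (E3 mR).
Notation cE3 := (caratheodory_type (@haus_outer R)).
Notation face r i := (insert i @` sq r).

Lemma nbhs_line (x e : E3 R) (B : set (E3 R)) (d : R) : 0 < d -> nbhs x B ->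
  exists2 t, 0 < t <= d & B (x + t *: e).
Proof.
move=> d0 Bx; have cl := @continuous_line R x e.
have B0 : nbhs (x + (0 : R) *: e) B by rewrite scale0r addr0.
have H : \forall t \near (0 : R)^'+, B (x + t *: e).
  exact: (cvg_at_right_filter (cl 0) B0).
have H1 : \forall t \near (0 : R)^'+, 0 < t <= d.
  near=> t; apply/andP; split; first by near: t; exact: nbhs_right_gt.
  by near: t; exact: nbhs_right_le.
have [t [Bt td]] := filter_ex (filterI H H1).
by exists t.
Unshelve. all: by end_near. Qed.

Lemma closure_line (A : set (E3 R)) x e (d : R) : 0 < d ->
  (forall t, 0 < t <= d -> A (x + t *: e)) -> closure A x.
Proof.
by move=> d0 H B Bx; have [t td Bt] := nbhs_line e d0 Bx; exists (x + t *: e); split => //; exact: H.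
Qed.

Lemma bdry_line (A : set (E3 R)) x e (d : R) : 0 < d ->
  (forall t, 0 < t <= d -> A (x + t *: e)) -> (forall t, 0 < t <= d -> ~ A (x - t *: e)) ->
  bdry A x.
Proof.
move=> d0 H1 H2; split; first exact: closure_line H1.
move=> Ax; have [t td] := nbhs_line (- e) d0 Ax.
by rewrite scalerN; exact: H2.
Qed.

Lemma near_coord_lt i (x : E3 R) (a : R) : coord i x < a -> \forall y \near x, coord i y < a.
Proof.
move=> xa; have := @continuous_coord R i x [set y : R | y < a].
by apply; exact: lt_nbhsl.
Qed.

Lemma near_coord_gt i (x : E3 R) (a : R) : a < coord i x -> \forall y \near x, a < coord i y.
Proof.
move=> xa; have := @continuous_coord R i x [set y : R | a < y].
by apply; exact: lt_nbhsr.
Qed.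

Lemma enorm_cube (x : E3 R) (r : R) : (forall i, `|coord i x| <= r) -> enorm x <= 3 * r.
Proof.
move=> xr; apply: le_trans (enorm_le_sum x) _.
apply: le_trans (ler_sum _ (fun i _ => xr i)) _.
by rewrite sumr_const card_ord mulr_natl.
Qed.

Variables (Omega Gamma U : set (E3 R)) (h r : R).
Hypotheses (corner : Omega `&` eball h = octant_trunc h) (r0 : 0 < r) (rh : 3 * r < h).
Hypothesis GammaE : Gamma = bdry Omega `&` U.
Hypothesis cube_U : forall x, (forall i, `|coord i x| <= r) -> U x.

Lemma cube_eball x : (forall i, `|coord i x| <= r) -> eball h x.
Proof. by move=> xr; apply: le_lt_trans (enorm_cube xr) rh. Qed.

Lemma cube_octant x : (forall i, `|coord i x| <= r) -> (Omega x <-> octant x).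
Proof.
move=> xr; have xh := cube_eball xr.
have E : (Omega `&` eball h) x = octant_trunc h x by rewrite corner.
by split=> H; [have : octant_trunc h x by rewrite -E|have : (Omega `&` eball h) x by rewrite E];
  case.
Qed.

Lemma box_cube x : box r x -> forall i, `|coord i x| <= r.
Proof. by move=> /boxP xr i; have /andP[x0 xi] := xr i; rewrite gtr0_norm. Qed.

Lemma box_octant_trunc : box r `<=` octant_trunc h.
Proof.
move=> x xr; split; last exact: cube_eball (box_cube xr).
by move=> i; have /boxP /(_ i) /andP[] := xr.
Qed.

Lemma box_Omega : box r `<=` Omega.
Proof. by move=> x xr; apply/(cube_octant (box_cube xr)); have [] := box_octant_trunc xr. Qed.

Lemma Omega_box x : Omega x -> (forall i, `|coord i x| < r) -> box r x.
Proof.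
move=> Ox xr; have xr' i : `|coord i x| <= r := ltW (xr i).
have oc := (cube_octant xr').1 Ox.
by apply/boxP => i; rewrite oc/= (le_trans (ler_norm _)).
Qed.

Lemma cube_Gamma x : (forall i, `|coord i x| <= r) -> bdry Omega x -> Gamma x.
Proof. by move=> xr bx; rewrite GammaE; split=> //; exact: cube_U. Qed.

Lemma face_coord i x : face r i x -> forall j,
  coord j x = 0 /\ j = i \/ 0 < coord j x <= r /\ j != i.
Proof.
move=> [p + <-] j; rewrite /sq /= !in_itv/= => -[/andP[p1 p1r] /andP[p2 p2r]].
rewrite /coord /insert; case: i => [[|[|[|//]]] ilt]; case: j => [[|[|[|//]]] jlt] /=;
  by [left; split=> //; apply: val_inj|right; split=> //; apply/andP].
Qed.

Lemma face_line i x t : face r i x -> 0 < t <= r ->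
  [/\ forall j, `|coord j (x + t *: vece i)| <= r, octant (x + t *: vece i),
    forall j, `|coord j (x - t *: vece i)| <= r & ~ octant (x - t *: vece i)].
Proof.
move=> fx; have C := face_coord fx; move: fx => [p pr px] /andP[t0 tr]; move: C; rewrite -px => C.
have E j (s : R) : coord j (insert i p + s *: vece i) = coord j (insert i p) + s * (j == i)%:R.
  by rewrite coordD coordZ coord_vece.
split.
- move=> j; rewrite E; have [[-> ->]|[/andP[c0 cr] /negbTE ji]] := C j.
    by rewrite eqxx mulr1 add0r gtr0_norm.
  by rewrite ji mulr0 addr0 gtr0_norm.
- move=> j; rewrite E; have [[-> ->]|[/andP[c0 cr] /negbTE ji]] := C j.
    by rewrite eqxx mulr1 add0r.
  by rewrite ji mulr0 addr0.
- move=> j; rewrite -scaleNr E; have [[-> ->]|[/andP[c0 cr] /negbTE ji]] := C j.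
    by rewrite eqxx mulr1 add0r normrN gtr0_norm.
  by rewrite ji mulr0 addr0 gtr0_norm.
- move=> /(_ i); rewrite -scaleNr E eqxx mulr1 coord_insert add0r => h0.
  by move: h0; rewrite oppr_gt0 => /(lt_trans t0); rewrite ltxx.
Qed.

Lemma face_bdry_Omega i : face r i `<=` bdry Omega.
Proof.
move=> x fx; apply: (bdry_line (e := vece i) r0) => t tr.
  by have [c oc _ _] := face_line fx tr; apply/(cube_octant c).
by have [_ _ c noc] := face_line fx tr => Ox; apply: noc; apply/(cube_octant c).
Qed.

Lemma face_cube i x : face r i x -> forall j, `|coord j x| <= r.
Proof. by move=> [p pr <-] j; have /andP[a b] := insert_sq_itv r0 i pr j; rewrite ger0_norm. Qed.

Lemma face_Gamma i : face r i `<=` Gamma.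
Proof. by move=> x fx; apply: cube_Gamma (face_cube fx) _; exact: face_bdry_Omega fx. Qed.

Lemma face_octant_faces i : face r i `<=` octant_faces h.
Proof.
move=> x fx; split; last exact: cube_eball (face_cube fx).
apply: (bdry_line (e := vece i) r0) => t tr.
  by have [c oc _ _] := face_line fx tr.
by have [_ _ c noc] := face_line fx tr.
Qed.

Let coord_ones i : coord i (((1, 1), 1) : E3 R) = 1.
Proof. by rewrite /coord; case: (val i) => [|[|m]]. Qed.

Lemma octant0_line (t : R) : 0 < t -> octant (0 + t *: ((1, 1), 1)) /\
  ~ octant (0 - t *: ((1, 1), 1) : E3 R).
Proof.
move=> t0; split.
  by move=> i; rewrite add0r coordZ coord_ones mulr1.
move=> /(_ ord0); rewrite sub0r coordN coordZ coord_ones mulr1 oppr_gt0 => t1.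
by have := lt_trans t0 t1; rewrite ltxx.
Qed.

(** Puts the apex into the set on which v is Hoelder continuous, so that values near the corner can
    be compared with v 0. *)
Lemma closure_octant_trunc0 : closure (octant_trunc h) (0 : E3 R).
Proof.
apply: (closure_line (e := ((1, 1), 1)) r0) => t /andP[t0 tr].
split; first by have [] := octant0_line t0.
by apply: cube_eball => i; rewrite add0r coordZ coord_ones mulr1 gtr0_norm.
Qed.

Lemma closure_octant_faces0 : closure (octant_faces h) (0 : E3 R).
Proof.
apply: subset_closure; split.
  by apply: (bdry_line (e := ((1, 1), 1)) r0) => t /andP[t0 tr];
    have [] := octant0_line t0.
by apply: cube_eball => i; rewrite /coord; case: (val i) => [|[|m]] /=; rewrite normr0 ltW.
Qed.

Lemma face_inj i j x : face r i x -> face r j x -> i = j.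
Proof.
move=> fi fj; have [[_ ->]//|[/andP[x0 _] _]] := face_coord fi j.
have [p _ px] := fj; move: x0; rewrite -px coord_insert ltxx//.
Qed.

Lemma proj_coord i (x : E3 R) : (exists j, (proj i x).1 = coord j x) /\
  (exists j, (proj i x).2 = coord j x).
Proof.
rewrite /proj /coord; case: i => [[|[|m]] ilt] /=; split.
- by exists (lift ord0 ord0).
- by exists (lift ord0 (lift ord0 ord0)).
- by exists ord0.
- by exists (lift ord0 (lift ord0 ord0)).
- by exists ord0.
- by exists (lift ord0 ord0).
Qed.

Let cross : set (R * R) := [set p : R * R | p.1 = 0] `|` [set p | p.2 = 0].

(** The three coordinate axes, written as crosses inside the coordinate planes so that
    [hausdorff2_face] reduces their surface measure to planar measure. *)
Definition axes : set (E3 R) := (insert ord0 @` cross) `|`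
  ((insert (lift ord0 ord0) @` cross) `|` (insert (lift ord0 (lift ord0 ord0)) @` cross)).

Lemma insert_axes i p : p.1 = 0 \/ p.2 = 0 -> axes (insert i p).
Proof.
rewrite /axes /insert; case: i => [[|[|m]] ilt] /= p0.
- by left; exists p.
- by right; left; exists p.
- by right; right; exists p.
Qed.

Lemma axes_negligible : (surf : {measure set cE3 -> \bar R}).-negligible (axes : set cE3).
Proof.
have E1 : [set p : R * R | p.1 = 0] = [set 0] `*` setT.
  by apply/seteqP; split=> p /=; [|case].
have E2 : [set p : R * R | p.2 = 0] = setT `*` [set 0].
  by apply/seteqP; split=> p /=; [|case].
have mz : measurable ([set 0 : mR]) := measurable_set1 _.
have mA1 : measurable ([set p : R * R | p.1 = 0] : set mR2).
  by rewrite E1; apply: measurableX.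
have mA2 : measurable ([set p : R * R | p.2 = 0] : set mR2).
  by rewrite E2; apply: measurableX.
have mc : measurable (cross : set mR2) by exact: measurableU.
have n2 : leb2 ([set p : R * R | p.2 = 0] : set mR2) = 0%E.
  by rewrite E2 [leb2 _]product_measure1E//; rewrite [X in (_ * X)%E](lebesgue_measure_set1 0) mule0.
have n1 : leb2 ([set p : R * R | p.1 = 0] : set mR2) = 0%E.
  by rewrite E1 [leb2 _]product_measure1E//; rewrite [X in (X * _)%E](lebesgue_measure_set1 0) mul0e.
have nc : leb2 (cross : set mR2) = 0%E by rewrite /cross measureU0.
have H i : (surf : {measure set cE3 -> \bar R}).-negligible (insert i @` cross : set cE3).
  exists (insert i @` cross); split=> //.
    exact: measurable_surf (measurable_image_insert i mc).
  by have := hausdorff2_face i mc; rewrite nc mule0.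
exact: negligibleU (H _) (negligibleU (H _) (H _)).
Qed.

Lemma near_cube x : (forall i, `|coord i x| < r) ->
  \forall y \near x, forall i, `|coord i y| < r.
Proof.
move=> xr; have H i : \forall y \near x, `|coord i y| < r.
  have := xr i; rewrite ltr_norml => /andP[x1 x2].
  apply: filterS2 (near_coord_gt x1) (near_coord_lt x2) => y y1 y2.
  by rewrite ltr_norml y1.
exact: (filter_forall _ H).
Qed.

(** Coordinates are nonnegative, x being a limit of points of Omega; one of them vanishes, since
    otherwise x would be interior; and off the axes no second one does. *)
Lemma Gamma_cube_cover x : Gamma x -> (forall i, `|coord i x| < r) -> ~ axes x ->
  exists i, face r i x.
Proof.
rewrite GammaE => -[[cx nx] _] xr nax.
have xpos i : 0 <= coord i x.
  rewrite leNgt; apply/negP => xi.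
  have [y [Oy [yi yr]]] := cx _ (filterI (near_coord_lt xi) (near_cube xr)).
  have /boxP/(_ i)/andP[yi0 _] := Omega_box Oy yr.
  by have := lt_trans yi0 yi; rewrite ltxx.
have [i xi] : exists i, coord i x = 0.
  apply: contrapT => nz; apply: nx.
  have p i : 0 < coord i x.
    by rewrite lt_neqAle xpos andbT eq_sym; apply/eqP => xi; apply: nz; exists i.
  have N : \forall y \near x, forall j, 0 < coord j y.
    exact: (filter_forall _ (fun j => near_coord_gt (p j))).
  apply: filterS2 N (near_cube xr) => y y0 yr; apply: box_Omega; apply/boxP => j.
  by rewrite y0/= (le_trans (ler_norm _))// ltW.
have xE := projK xi; have [[j1 e1] [j2 e2]] := proj_coord i x.
exists i; exists (proj i x) => //.
have n1 : (proj i x).1 != 0.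
  by apply/eqP => h0; apply: nax; rewrite -xE; apply: insert_axes; left.
have n2 : (proj i x).2 != 0.
  by apply/eqP => h0; apply: nax; rewrite -xE; apply: insert_axes; right.
have c j : coord j x != 0 -> 0 < coord j x <= r.
  move=> cj; rewrite lt_neqAle eq_sym cj xpos/= (le_trans (ler_norm _))//.
  exact: ltW.
by rewrite /sq /= !in_itv /= e1 e2 !c// -?e1 -?e2.
Qed.

End corner_geometry.

Section smooth_subtraction.
Context {R : realType}.

Lemma smooth_cst (c : R) : smooth (fun _ : E3 R => c).
Proof. exact: (@smooth_lift R (fun=> c) ord0 (smooth1_cst c)). Qed.

Lemma smoothB (f g : E3 R -> R) : smooth f -> smooth g -> smooth (fun x => f x - g x).
Proof.
move=> sf sg; have := smoothD sf (smoothM (smooth_cst (-1)) sg).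
by under [X in smooth X -> _]eq_fun do rewrite mulN1r.
Qed.

Lemma partialB (f g : E3 R -> R) i x : smooth f -> smooth g ->
  partial i (fun y => f y - g y) x = partial i f x - partial i g x.
Proof. by move=> sf sg; apply: deriveB; exact: smooth_derivable. Qed.

Lemma partial_cst i (c : R) (x : E3 R) : partial i (fun=> c) x = 0.
Proof. exact: derive_cst. Qed.

End smooth_subtraction.

Section L2_bounds.
Context d (T : measurableType d) (R : realType) (m : {measure set T -> \bar R}).
Variable D : set T.
Hypothesis mD : measurable D.

Lemma L2r_le (M : R) (f g h : T -> R) : measurable_fun D f -> L2r m D g -> L2r m D h ->
  (forall x, D x -> `|f x| <= M * (`|g x| + `|h x|)) -> L2r m D f.
Proof.
move=> mf [mg Ig] [mh Ih] le; split=> //.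
apply: (le_integrableR (g := fun x => 2 * M ^+ 2 * (g x ^+ 2) + 2 * M ^+ 2 * (h x ^+ 2)) mD).
- exact: measurable_funX.
- exact: (integrableDR mD (integrableZR mD _ Ig) (integrableZR mD _ Ih)).
move=> x Dx; rewrite ger0_norm ?sqr_ge0// -real_normK ?num_real//.
rewrite -(real_normK (num_real (g x))) -(real_normK (num_real (h x))).
have := le x Dx; move: (`|f x|) (`|g x|) (`|h x|) (normr_ge0 (f x)) => a b c a0 le1.
have : a ^+ 2 <= (M * (b + c)) ^+ 2 by rewrite lerXn2r// nnegrE// (le_trans a0).
have := mulr_ge0 (sqr_ge0 M) (sqr_ge0 (b - c)); lra.
Qed.

Lemma sqnB_le (f g : T -> R) : L2r m D f -> L2r m D g ->
  sqn m D (fun x => f x - g x) <= 2 * sqn m D f + 2 * sqn m D g.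
Proof.
move=> Lf Lg; have [_ IB] := L2rB mD Lf Lg.
have := le_Rintegral_comb (F := fun x => (f x - g x) ^+ 2) (x := 2) (y := 2) (z := 0)
  mD IB Lf.2 Lg.2 Lf.2.
rewrite mul0r addr0; apply=> x _; rewrite mul0r addr0.
by have := sqr_ge0 (f x + g x); rewrite sqrrB sqrrD; lra.
Qed.

End L2_bounds.

Section complex_functions.
Context {R : realType} d (T : measurableType d).
Implicit Types (D : set T) (f g : T -> R[i]).
Local Notation normc := ComplexField.Normc.normc.

Lemma cmeasurableM D f g : cmeasurable D f -> cmeasurable D g ->
  cmeasurable D (fun x => f x * g x).
Proof.
move=> [fr fi] [gr gi]; split.
  rewrite (_ : (fun x => _) = (fun x => complex.Re (f x) * complex.Re (g x) -
    complex.Im (f x) * complex.Im (g x))); last first.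
    by apply/funext => x; case: (f x) (g x) => ? ? [? ?].
  by apply: measurable_funB; apply: measurable_funM.
rewrite (_ : (fun x => _) = (fun x => complex.Re (f x) * complex.Im (g x) +
    complex.Im (f x) * complex.Re (g x))); last first.
  by apply/funext => x; case: (f x) (g x) => ? ? [? ?].
by apply: measurable_funD; apply: measurable_funM.
Qed.

Lemma cmeasurable_cst D (c : R[i]) : cmeasurable D (fun=> c).
Proof. by split; exact: measurable_cst. Qed.

Lemma cmeasurableN D f : cmeasurable D f -> cmeasurable D (fun x => - f x).
Proof.
move=> mf; have := cmeasurableB (cmeasurable_cst D 0) mf.
by under [X in cmeasurable D X -> _]eq_fun do rewrite sub0r.
Qed.

Lemma normc_real (a : R) : 0 <= a -> normc a%:C = a.
Proof. by move=> a0; rewrite /normc /= expr0n /= addr0 sqrtr_sqr ger0_norm. Qed.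

End complex_functions.

(** * The estimate at the corner *)

Section corner_estimate.
Context {R : realType}.
Notation mR := (measurableTypeR R).
Notation mR2 := (mR * mR)%type.
Notation mE3 := (E3 mR).
Notation cE3 := (caratheodory_type (@haus_outer R)).
Notation face r i := (insert i @` sq r).
Local Notation normc := ComplexField.Normc.normc.

Variables (Omega Gamma : set (E3 R)) (r : R).
Hypotheses (r0 : 0 < r) (mO : measurable (Omega : set mE3)) (BO : box r `<=` Omega).
Hypothesis OB : forall x, Omega x -> (forall i, `|coord i x| < r) -> box r x.
Hypothesis cube_G : forall x, (forall i, `|coord i x| <= r) -> bdry Omega x -> Gamma x.
Hypotheses (mbd : measurable (bdry Omega : set cE3)) (mG : measurable (Gamma : set cE3)).
Hypotheses (Gbd : Gamma `<=` bdry Omega) (faceG : forall i, face r i `<=` Gamma).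
Hypothesis coverG : forall x, Gamma x -> (forall i, `|coord i x| < r) -> ~ axes x ->
  exists i, face r i x.

Let mB := @measurable_box R r.
Let mS := @measurable_sq R r.
Let mF i : measurable (face r i : set cE3) := measurable_face_surf r i.
Let face_bd i : face r i `<=` bdry Omega := fun x fx => Gbd (faceG fx).

Lemma surf_Rintegral_faces (g psi : E3 R -> R) : measurable_fun (Gamma : set cE3) g ->
  (forall i, L2r surf (face r i : set cE3) g) -> smooth psi -> vanishes_outside r psi ->
  \int[surf]_(x in Gamma) (g x * psi x) =
  \sum_(i < 3) \int[surf]_(x in face r i) (g x * psi x).
Proof.
move=> mg Lg sp vp; have cp := smooth_continuous sp.
apply: (@Rintegral_pieces _ cE3 R surf Gamma axes (fun i => face r i)).
- exact: mG.
- exact: mF.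
- exact: axes_negligible.
- apply: measurable_funM => //; apply: measurable_funTS.
  by apply: measurable_funT_surf; exact: continuous_measurable3.
- move=> i; exact: (L2r_mul (mF i) (Lg i) (continuous_L2r_face r i cp)).
- exact: faceG.
- by move=> i j x; exact: face_inj.
- move=> x Gx nz nax; apply: coverG => // i; rewrite ltNge; apply/negP => h.
  by move/eqP: nz; apply; rewrite vp ?mulr0//; exists i.
Qed.

Variables (k Q : R) (v w q eta tv tw : E3 R -> R[i]) (Nv Nw : (E3 R -> R) -> R[i]).
Hypotheses (L2v : L2 leb3 Omega v) (L2w : L2 leb3 Omega w).
Hypotheses (trv : is_trace Omega v tv) (trw : is_trace Omega w tw).
Hypotheses (nv : is_normal_derivative Omega Gamma v Nv)
  (nw : is_normal_derivative Omega Gamma w Nw).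
Hypothesis (wLv : weak_laplacian Omega v (fun x => - ((k ^+ 2)%:C * v x))).
Hypothesis (wLw : weak_laplacian Omega w (fun x => - ((k ^+ 2)%:C * q x * w x))).
Hypotheses (mq : cmeasurable (Omega : set mE3) q) (qQ : forall x, box r x -> normc (q x) <= Q).
Hypothesis (twtv : {ae surf, forall x, Gamma x -> tw x = tv x}).
Hypothesis transmission : forall phi, bdry_test_fun Omega Gamma phi ->
  Nw phi = Nv phi + cintegral surf Gamma (fun x => eta x * tv x * (phi x)%:C).
Hypothesis meta : cmeasurable (bdry Omega : set cE3) eta.
Variable e : R.
Hypotheses (e0 : 0 < e) (e1 : e <= 1).
Hypothesis v_osc : forall x, box r x -> normc (v x - v 0) <= e.
Hypothesis eta_osc : forall i x, face r i x -> normc (eta x - eta 0) <= e.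

Let pv b x := part b (v x).
Let pw b x := part b (w x).
Let u b x := pw b x - pv b x.
Let Lpv b : L2r leb3 (box r : set mE3) (pv b) := L2_part mO mB BO b L2v.
Let Lpw b : L2r leb3 (box r : set mE3) (pw b) := L2_part mO mB BO b L2w.
Let Lu b : L2r leb3 (box r : set mE3) (u b) := L2rB mB (Lpw b) (Lpv b).
Let Fv x := - ((k ^+ 2)%:C * v x).
Let Fw x := - ((k ^+ 2)%:C * q x * w x).

Let Q0 : 0 <= Q.
Proof.
have xb : box r ((r, r), r) by rewrite /box /sq /= !in_itv /= r0 lexx.
exact: le_trans (normc_nonneg _) (qQ xb).
Qed.

Let normc_k2 : normc (k ^+ 2)%:C = k ^+ 2.
Proof. by rewrite normc_real// sqr_ge0. Qed.

Let LFv b : L2r leb3 (box r : set mE3) (fun x => part b (Fv x)).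
Proof.
have := L2rZ mB (- k ^+ 2) (Lpv b).
by under [X in L2r _ _ X -> _]eq_fun do rewrite mulNr -partMl -partN.
Qed.

Let LFw b : L2r leb3 (box r : set mE3) (fun x => part b (Fw x)).
Proof.
have mFw : cmeasurable (Omega : set mE3) Fw.
  apply: cmeasurableN; apply: cmeasurableM; last exact: L2w.1.
  by apply: cmeasurableM => //; exact: cmeasurable_cst.
apply: (L2r_le (M := k ^+ 2 * Q) mB (cmeasurable_part mO BO b mFw) (Lpw true) (Lpw false)).
move=> x xr; apply: le_trans (part_le_normc _ _) _.
rewrite /Fw normcN !ComplexField.Normc.normcM normc_k2.
apply: ler_pM; [exact: mulr_ge0 (sqr_ge0 _) (normc_nonneg _)|exact: normc_nonneg| |
  exact: normc_le_parts].
by apply: ler_wpM2l; [exact: sqr_ge0|exact: qQ].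
Qed.

(** In q (w - v) + (q - 1) v the second term is bounded since v stays close to v 0 on the box, and
    the first is controlled by u. Multiplication by a complex q mixes real and imaginary parts,
    hence both parts of u on the right. *)
Let source_bound b x : box r x -> `|part b (Fw x) - part b (Fv x)| <=
  k ^+ 2 * (Q + 1) * (normc (v 0) + 2) * (`|u b x| + `|u (~~ b) x| + 1).
Proof.
move=> xr; rewrite -partB; apply: le_trans (part_le_normc _ _) _.
have -> : Fw x - Fv x = - ((k ^+ 2)%:C * (q x * (w x - v x) + (q x - 1) * v x)).
  by rewrite /Fw /Fv; ring.
rewrite normcN ComplexField.Normc.normcM normc_k2.
have reassoc (a c d g : R) : a * c * d * g = a * (c * d * g) by ring.
rewrite reassoc; apply: ler_wpM2l; first exact: sqr_ge0.
apply: le_trans (le_normcD _ _) _; rewrite !ComplexField.Normc.normcM.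
have hq := qQ xr.
have hq1 : normc (q x - 1) <= Q + 1.
  apply: le_trans (le_normcD _ _) _; rewrite normcN ComplexField.Normc.normc1.
  by rewrite lerD2r.
have hv : normc (v x) <= normc (v 0) + 1.
  rewrite -[v x](subrK (v 0)); apply: le_trans (le_normcD _ _) _.
  by rewrite addrC lerD2l (le_trans (v_osc xr)).
have hu : normc (w x - v x) <= `|u b x| + `|u (~~ b) x|.
  apply: le_trans (normc_le_parts _) _; rewrite !partB /u /pw /pv.
  by case: b => //=; rewrite addrC.
have n0 := normc_nonneg (v 0); have nv0 := normc_nonneg (v x).
have nq := normc_nonneg (q x); have nq1 := normc_nonneg (q x - 1).
have nu := normc_nonneg (w x - v x).
have A1 : normc (q x) * normc (w x - v x) <= (Q + 1) * (`|u b x| + `|u (~~ b) x|).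
  by apply: ler_pM => //; rewrite (le_trans hq)// lerDl.
have A2 : normc (q x - 1) * normc (v x) <= (Q + 1) * (normc (v 0) + 1) by exact: ler_pM.
have s0 : 0 <= `|u b x| + `|u (~~ b) x| by exact: addr_ge0.
apply: le_trans (lerD A1 A2) _.
move: n0 Q0 s0; move: (`|u b x| + `|u (~~ b) x|) (normc (v 0)) Q => a c q1 c0 q0 a0.
have h2 : 0 <= q1 + 1 by rewrite addr_ge0.
have h1 : 0 <= c + 1 by rewrite addr_ge0.
by have := mulr_ge0 (mulr_ge0 h2 h1) a0; lra.
Qed.

(** Converts smallness on a face for surface measure into smallness for planar measure, at a cost
    common to the three faces. *)
Let kappa_exists : exists2 kp : R, 0 < kp <= 1 & forall i, kp <= @face_cst R i.
Proof.
pose S := 1 + \sum_(i < 3) (@face_cst R i)^-1.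
have c0 i : 0 <= (@face_cst R i)^-1 by rewrite invr_ge0 ltW// face_cst_gt0.
have S1 : 1 <= S by rewrite lerDl sumr_ge0.
have S0 : 0 < S := lt_le_trans ltr01 S1.
exists S^-1; first by rewrite invr_gt0 S0 invf_le1.
move=> i; rewrite -[leRHS]invrK lef_pV2 ?posrE ?invr_gt0 ?face_cst_gt0//.
rewrite /S (bigD1 i)//= addrCA lerDl addr_ge0// sumr_ge0//.
Qed.

Lemma eq_sqn_face i (f g : E3 R -> R) : L2r surf (face r i : set cE3) f ->
  L2r surf (face r i : set cE3) g -> {ae surf, forall x, Gamma x -> f x = g x} ->
  sqn surf (face r i : set cE3) f = sqn surf (face r i : set cE3) g.
Proof.
move=> [mf _] [mg _] [N [mN N0 sN]]; rewrite /sqn /Rintegral; congr fine.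
apply: ae_eq_integral; [exact: mF| | |].
- by apply/measurable_EFinP; exact: measurable_funX.
- by apply/measurable_EFinP; exact: measurable_funX.
exists N; split=> // x /= h; apply: sN => /= h'; apply: h => fx.
by rewrite h'//; exact: faceG fx.
Qed.

Let Ltv b i : L2r surf (face r i : set cE3) (fun x => part b (tv x)) :=
  L2_part mbd (mF i) (@face_bd i) b trv.1.
Let Ltw b i : L2r surf (face r i : set cE3) (fun x => part b (tw x)) :=
  L2_part mbd (mF i) (@face_bd i) b trw.1.

(** The approximations of w and v are subtracted. Their traces agree almost everywhere on the faces,
    so the difference is small there: this is the zero trace of u in the form used by [poincare] and
    [green_box]. *)
Lemma difference_approx (Gv Gw : 'I_3 -> E3 R -> R[i]) b :
  weak_gradient Omega v Gv -> weak_gradient Omega w Gw ->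
  (forall d, 0 < d -> exists2 U, csmooth U & forall b,
   [/\ sqn leb3 (box r : set mE3) (fun x => part b (U x) - part b (v x)) <= d,
    forall i, sqn leb3 (box r : set mE3)
      (fun x => partial i (fun y => part b (U y)) x - part b (Gv i x)) <= d &
    forall i, sqn surf (face r i : set cE3) (fun x => part b (U x) - part b (tv x)) <= d]) ->
  (forall d, 0 < d -> exists2 U, csmooth U & forall b,
   [/\ sqn leb3 (box r : set mE3) (fun x => part b (U x) - part b (w x)) <= d,
    forall i, sqn leb3 (box r : set mE3)
      (fun x => partial i (fun y => part b (U y)) x - part b (Gw i x)) <= d &
    forall i, sqn surf (face r i : set cE3) (fun x => part b (U x) - part b (tw x)) <= d]) ->
  forall d, 0 < d -> exists f, [/\ smooth f,
    sqn leb3 (box r : set mE3) (fun x => f x - u b x) <= d ^+ 2,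
    forall i, sqn leb3 (box r : set mE3)
      (fun x => partial i f x - (part b (Gw i x) - part b (Gv i x))) <= d ^+ 2 &
    forall i, sqn leb2 (sq r : set mR2) (f \o insert i) <= d ^+ 2].
Proof.
move=> wGv wGw Av Aw d d0; have [kp /andP[kp0 kp1] kpc] := kappa_exists.
(* The square of a difference costs the factor 4, and [kp] pays for the division by the face
   constant. *)
pose z := d ^+ 2 * kp / 4.
have z0 : 0 < z by rewrite divr_gt0// mulr_gt0// exprn_gt0.
have z4 : 4 * z <= d ^+ 2.
  rewrite (_ : 4 * z = d ^+ 2 * kp); last by rewrite /z; field.
  by rewrite ler_piMr// sqr_ge0.
have [Uv sUv /(_ b)[v1 v2 v3]] := Av z z0; have [Uw sUw /(_ b)[w1 w2 w3]] := Aw z z0.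
have spv := csmooth_part b sUv; have spw := csmooth_part b sUw.
pose f x := part b (Uw x) - part b (Uv x).
have sf : smooth f by exact: smoothB.
have add4 (X Y Z : R) : X <= 2 * Y + 2 * Z -> Y <= z -> Z <= z -> X <= 4 * z by lra.
have LUv := continuous_L2r_box r (smooth_continuous spv).
have LUw := continuous_L2r_box r (smooth_continuous spw).
exists f; split=> //.
- apply: le_trans z4; apply: (add4 _ _ _ _ w1 v1).
  have := sqnB_le mB (L2rB mB LUw (Lpw b)) (L2rB mB LUv (Lpv b)).
  apply: le_trans; rewrite le_eqVlt; apply/orP; left; apply/eqP.
  by apply: eq_Rintegral => x _; rewrite /f /u; congr (_ ^+ 2); ring.
- move=> i; apply: le_trans z4; apply: (add4 _ _ _ _ (w2 i) (v2 i)).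
  have Ldv := continuous_L2r_box r (smooth_continuous (smooth_partial i spv)).
  have Ldw := continuous_L2r_box r (smooth_continuous (smooth_partial i spw)).
  have := sqnB_le mB (L2rB mB Ldw (L2_part mO mB BO b (wGw i).1))
    (L2rB mB Ldv (L2_part mO mB BO b (wGv i).1)).
  apply: le_trans; rewrite le_eqVlt; apply/orP; left; apply/eqP.
  by apply: eq_Rintegral => x _; rewrite /f partialB//; congr (_ ^+ 2); ring.
- move=> i; have cf := smooth_continuous sf.
  have Lf := continuous_L2r_face r i cf.
  have LDv := L2rB (mF i) (continuous_L2r_face r i (smooth_continuous spv)) (Ltv b i).
  have LDw := L2rB (mF i) (continuous_L2r_face r i (smooth_continuous spw)) (Ltw b i).
  have E : sqn surf (face r i : set cE3) f = sqn surf (face r i : set cE3)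
      (fun x => (part b (Uw x) - part b (tw x)) - (part b (Uv x) - part b (tv x))).
    apply: (eq_sqn_face Lf (L2rB (mF i) LDw LDv)).
    have [N [mN N0 sN]] := twtv; exists N; split=> // x /= h; apply: sN => /= h'; apply: h => Gx.
    by rewrite h'// /f; ring.
  have B := add4 _ _ _ (sqnB_le (mF i) LDw LDv) (w3 i) (v3 i); rewrite -E in B.
  have FE : sqn surf (face r i : set cE3) f =
      face_cst i * sqn leb2 (sq r : set mR2) (f \o insert i).
    exact: (continuous_Rintegral_face r i (continuousX_real cf)).
  rewrite FE in B; have c0 := @face_cst_gt0 R i.
  rewrite -(ler_pM2l c0); apply: le_trans B _.
  rewrite (_ : 4 * z = kp * d ^+ 2); last by rewrite /z; field.
  by apply: ler_wpM2r; [exact: sqr_ge0|exact: kpc].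
Qed.

Let A := normc (v 0) + normc (eta 0) + 1.
Let A0 : 0 <= A. Proof. by rewrite !addr_ge0// normc_nonneg. Qed.
Let g b x := part b (eta x * tv x).
Let t b x := part b (tv x) - part b (v 0).

Let eta_bound i x : face r i x -> normc (eta x) <= normc (eta 0) + 1.
Proof.
move=> fx; rewrite -[eta x](subrK (eta 0)); apply: le_trans (le_normcD _ _) _.
by rewrite addrC lerD2l (le_trans (eta_osc fx)).
Qed.

Let mg b : measurable_fun (bdry Omega : set cE3) (g b).
Proof. exact: (cmeasurable_part mbd (@subset_refl _ _) b (cmeasurableM meta trv.1.1)). Qed.

Let Lg b i : L2r surf (face r i : set cE3) (g b).
Proof.
apply: (L2r_le (M := normc (eta 0) + 1) (mF i) _ (Ltv true i) (Ltv false i)).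
  exact: (measurable_funS mbd (@face_bd i) (mg b)).
move=> x fx; apply: le_trans (part_le_normc _ _) _; rewrite ComplexField.Normc.normcM.
by apply: ler_pM; [exact: normc_nonneg|exact: normc_nonneg|exact: eta_bound fx|exact: normc_le_parts].
Qed.

Let Lt b i : L2r surf (face r i : set cE3) (t b).
Proof.
by apply: (L2rB (mF i) (Ltv b i)); apply: continuous_L2r_face => x; exact: cvg_cst.
Qed.

(** eta tv - eta 0 v 0 = (eta - eta 0) v 0 + eta (tv - v 0): eta is controlled pointwise, whereas v
    enters through its trace, whose oscillation is left to the integral bounds. *)
Let g_osc b i x : face r i x ->
  `|g b x - part b (eta 0 * v 0)| <= A * (e + `|t b x| + `|t (~~ b) x|).
Proof.
move=> fx; rewrite /g -partB; apply: le_trans (part_le_normc _ _) _.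
have -> : eta x * tv x - eta 0 * v 0 = (eta x - eta 0) * v 0 + eta x * (tv x - v 0) by ring.
apply: le_trans (le_normcD _ _) _; rewrite !ComplexField.Normc.normcM.
have ht : normc (tv x - v 0) <= `|t b x| + `|t (~~ b) x|.
  apply: le_trans (normc_le_parts _) _; rewrite !partB /t.
  by case: b => //=; rewrite addrC.
have n0 := normc_nonneg (v 0); have n1 := normc_nonneg (eta 0).
have A1 : normc (eta x - eta 0) * normc (v 0) <= e * normc (v 0).
  by apply: ler_wpM2r => //; exact: eta_osc fx.
have A2 : normc (eta x) * normc (tv x - v 0) <=
    (normc (eta 0) + 1) * (`|t b x| + `|t (~~ b) x|).
  by apply: ler_pM => //; [exact: normc_nonneg|exact: normc_nonneg|exact: eta_bound fx].
apply: le_trans (lerD A1 A2) _.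
have s0 : 0 <= `|t b x| + `|t (~~ b) x| by exact: addr_ge0.
rewrite -addrA /A; move: n0 n1 s0 (ltW e0).
move: (`|t b x| + `|t (~~ b) x|) (normc (v 0)) (normc (eta 0)) (e) => a c1 c2 d h1 h2 h3 h4.
by have := mulr_ge0 h1 h3; have := mulr_ge0 h2 h4; lra.
Qed.

(** A constant is smooth with zero gradient, so v 0 can be subtracted from v, from its
    approximations and from its trace; on the box what remains of v is at most e. *)
Let trace_bounds Gv : weak_gradient Omega v Gv ->
  (forall d, 0 < d -> exists2 U, csmooth U & forall b,
   [/\ sqn leb3 (box r : set mE3) (fun x => part b (U x) - part b (v x)) <= d,
    forall i, sqn leb3 (box r : set mE3)
      (fun x => partial i (fun y => part b (U y)) x - part b (Gv i x)) <= d &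
    forall i, sqn surf (face r i : set cE3) (fun x => part b (U x) - part b (tv x)) <= d]) ->
  forall b i, exists2 S : R, 1 <= S & forall s, S <= s ->
    \int[surf]_(x in face r i) (t b x ^+ 2 * weight r s x) <=
    (16 * face_cst i + 2) * e ^+ 2 * s^-1 ^+ 2.
Proof.
move=> wGv Av b i.
pose c : R := part b (v 0).
have Lc : L2r leb3 (box r : set mE3) (fun=> c).
  by apply: continuous_L2r_box => x; exact: cvg_cst.
have Lvc := L2rB mB (Lpv b) Lc.
apply: (surf_trace_bound r0 Lvc (L2_part mO mB BO b (wGv i).1) e0 (Lt b i)).
  by move=> x xr; rewrite /pv /c -partB; apply: le_trans (part_le_normc _ _) _; exact: v_osc.
move=> d d0; have [U sU /(_ b)[h1 h2 h3]] := Av (d ^+ 2) (exprn_gt0 _ d0).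
have sp := csmooth_part b sU.
exists (fun x => part b (U x) - c); split.
- exact: smoothB sp (smooth_cst c).
- apply: le_trans h1; rewrite le_eqVlt; apply/orP; left; apply/eqP.
  by apply: eq_Rintegral => x _; congr (_ ^+ 2); rewrite /pv; ring.
- apply: le_trans (h2 i); rewrite le_eqVlt; apply/orP; left; apply/eqP.
  apply: eq_Rintegral => x _; congr (_ ^+ 2).
  by rewrite (partialB _ _ sp (smooth_cst c)) partial_cst subr0.
- apply: le_trans (h3 i); rewrite le_eqVlt; apply/orP; left; apply/eqP.
  by apply: eq_Rintegral => x _; congr (_ ^+ 2); rewrite /t /c; ring.
Qed.

Let assemble (Nv' Nw' I X Y X' Y' : R) : Nv' = X + Y -> Nw' = X' + Y' -> Nw' = Nv' + I ->
  I = X' - X + (Y' - Y).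
Proof. by move=> -> -> ?; lra. Qed.

(** The transmission condition makes the difference of the two normal derivatives equal to the
    integral of eta times the trace over Gamma. The gradient term of that difference is integrated
    by parts once more, onto u. *)
Lemma corner_bound b : `|part b (eta 0 * v 0)| * (@face_cst R ord0 / 160) <=
  (2 + \sum_(i < 3) A * (36 * @face_cst R i + 4)) * e.
Proof.
have [_ [Gv [wGv Av]]] := trace_approx mO BO mbd (@face_bd) L2v trv.
have [_ [Gw [wGw Aw]]] := trace_approx mO BO mbd (@face_bd) L2w trw.
have Au b' := difference_approx b' wGv wGw Av Aw.
have LGd b' i : L2r leb3 (box r : set mE3) (fun x => part b' (Gw i x) - part b' (Gv i x)).
  have h1 := L2_part mO mB BO b' (wGw i).1; have h2 := L2_part mO mB BO b' (wGv i).1.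
  exact: (L2rB mB h1 h2).
have Hp b' : exists S C : R, 0 <= C /\ forall s, S <= s ->
    \int[leb3]_(x in box r) (u b' x ^+ 2 * weight r s x) <= C * s^-1 ^+ 2.
  (* Any one of the three directions would give the bound, as u vanishes on every face. *)
  have [|S [C SC]] := @poincare R r r0 ord0 (u b') _ (Lu b') (LGd b' ord0).
    move=> d d0; have [f [sf f1 f2 f3]] := Au b' d d0.
    by exists f; split.
  (* The constant from [poincare] has no known sign, and the source estimate requires a nonnegative
     one. *)
  exists S, `|C|; split=> // s Ss; apply: le_trans (SC s Ss) _.
  by apply: ler_wpM2r; [exact: sqr_ge0|exact: ler_norm].
have [S1 [C1 [C10 P1]]] := Hp b; have [S2 [C2 [C20 P2]]] := Hp (~~ b).
have /boolp.choice[T1 HT1] : forall i, exists S, 1 <= S /\ forall s, S <= s ->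
    \int[surf]_(x in face r i) (t b x ^+ 2 * weight r s x) <=
    (16 * face_cst i + 2) * e ^+ 2 * s^-1 ^+ 2.
  by move=> i; have [S S1' SP] := trace_bounds wGv Av b i; exists S.
have /boolp.choice[T2 HT2] : forall i, exists S, 1 <= S /\ forall s, S <= s ->
    \int[surf]_(x in face r i) (t (~~ b) x ^+ 2 * weight r s x) <=
    (16 * face_cst i + 2) * e ^+ 2 * s^-1 ^+ 2.
  by move=> i; have [S S1' SP] := trace_bounds wGv Av (~~ b) i; exists S.
(* A sum used in place of a maximum: a threshold beyond all those found so far. *)
pose S0 := \sum_(i < 3) (T1 i + T2 i) + `|S1| + `|S2|.
have T10 i : 0 <= T1 i by have [h _] := HT1 i; exact: le_trans ler01 h.
have T20 i : 0 <= T2 i by have [h _] := HT2 i; exact: le_trans ler01 h.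
have Tsum i : T1 i + T2 i <= \sum_(i < 3) (T1 i + T2 i).
  by rewrite (bigD1 i)//= lerDl sumr_ge0// => j _; rewrite addr_ge0.
have Ssum : 0 <= \sum_(i < 3) (T1 i + T2 i) by rewrite sumr_ge0// => j _; rewrite addr_ge0.
have le1 : S1 <= S0 by have := ler_norm S1; have := normr_ge0 S2; rewrite /S0; lra.
have le2 : S2 <= S0 by have := ler_norm S2; have := normr_ge0 S1; rewrite /S0; lra.
have le3 i : T1 i <= S0.
  by have := Tsum i; have := T20 i; have := normr_ge0 S1; have := normr_ge0 S2; rewrite /S0; lra.
have le4 i : T2 i <= S0.
  by have := Tsum i; have := T10 i; have := normr_ge0 S1; have := normr_ge0 S2; rewrite /S0; lra.
pose C0 := k ^+ 2 * (Q + 1) * (normc (v 0) + 2).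
have C00 : 0 <= C0.
  exact: mulr_ge0 (mulr_ge0 (sqr_ge0 _) (addr_ge0 Q0 ler01))
    (addr_ge0 (normc_nonneg _) (ler0n _ 2)).
have LF := L2rB mB (LFw b) (LFv b).
apply: (core_bound (g := g b) (t := t b) (t' := t (~~ b)) r0 (Lu b) (Lu (~~ b)) LF.1 C00 C10 C20
  (@source_bound b) (fun s h => P1 s (le_trans le1 h)) (fun s h => P2 s (le_trans le2 h)) A0 e0
  (Lt b) (Lt (~~ b)) (fun i => (Lg b i).1) (@g_osc b)
  (fun i s h => (HT1 i).2 s (le_trans (le3 i) h)) (fun i s h => (HT2 i).2 s (le_trans (le4 i) h))).
move=> psi sp vp.
have mgG : measurable_fun (Gamma : set cE3) (g b) := measurable_funS mbd Gbd (mg b).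
rewrite -(surf_Rintegral_faces mgG (Lg b) sp vp).
have HT := transmission (vanishes_outside_bdry_test cube_G sp vp).
have Iv := normal_identity r0 mO BO OB cube_G nv wLv (LFv b) wGv sp vp.
have Iw := normal_identity r0 mO BO OB cube_G nw wLw (LFw b) wGw sp vp.
have E1 : part b (cintegral surf Gamma (fun x => eta x * tv x * (psi x)%:C)) =
    \int[surf]_(x in Gamma) (g b x * psi x).
  by rewrite part_cintegral; apply: eq_Rintegral => x _; rewrite partMr.
have E2 := green_box r0 (Lu b) (LGd b) sp vp (Au b).
have Lp := continuous_L2r_box r (smooth_continuous sp).
have Ldp i := continuous_L2r_box r (smooth_continuous (smooth_partial i sp)).
have LGw i := L2_part mO mB BO b (wGw i).1; have LGv i := L2_part mO mB BO b (wGv i).1.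
have E3 i : \int[leb3]_(x in box r) ((part b (Gw i x) - part b (Gv i x)) * partial i psi x) =
    \int[leb3]_(x in box r) (part b (Gw i x) * partial i psi x) -
    \int[leb3]_(x in box r) (part b (Gv i x) * partial i psi x).
  rewrite -(RintegralB mB (L2r_mul mB (LGw i) (Ldp i)) (L2r_mul mB (LGv i) (Ldp i))).
  by apply: eq_Rintegral => x _; rewrite mulrBl.
have E4 : \int[leb3]_(x in box r) ((part b (Fw x) - part b (Fv x)) * psi x) =
    \int[leb3]_(x in box r) (part b (Fw x) * psi x) -
    \int[leb3]_(x in box r) (part b (Fv x) * psi x).
  rewrite -(RintegralB mB (L2r_mul mB (LFw b) Lp) (L2r_mul mB (LFv b) Lp)).
  by apply: eq_Rintegral => x _; rewrite mulrBl.
rewrite (eq_bigr _ (fun i _ => E3 i)) sumrB in E2.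
have HT' : part b (Nw psi) = part b (Nv psi) + \int[surf]_(x in Gamma) (g b x * psi x).
  by rewrite -E1 -partD -HT.
rewrite -E2 E4; exact: (assemble Iv Iw HT').
Qed.

End corner_estimate.

(** * Reduction to a bounded potential, and conclusion *)

Section reductions.
Context {R : realType}.
Notation mR := (measurableTypeR R).
Notation mE3 := (E3 mR).
Notation cE3 := (caratheodory_type (@haus_outer R)).
Notation face r i := (insert i @` sq r).
Local Notation normc := ComplexField.Normc.normc.

Lemma measurable_bdry_surf (O : set (E3 R)) : measurable (bdry O : set cE3).
Proof.
have m1 : measurable (closure O : set mE3) by apply: closed_measurable3; exact: closed_closure.
have m2 : measurable (O^° : set mE3) by apply: open_measurable3; exact: open_interior.
exact: (measurable_surf (measurableD m1 m2)).
Qed.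

Lemma nbhs0_cube (U : set (E3 R)) : nbhs (0 : E3 R) U ->
  exists2 d : R, 0 < d & forall x, (forall i, `|coord i x| < d) -> U x.
Proof.
move=> /nbhs_ballP[d /= d0 dU]; exists d => // x xd; apply: dU.
have := xd (@Ordinal 3 0 isT); have := xd (@Ordinal 3 1 isT); have := xd (@Ordinal 3 2 isT).
rewrite /coord /= => x3 x2 x1.
by split; [split|]; rewrite /ball /= sub0r normrN.
Qed.

Lemma holder_small (al : R) (A : set (E3 R)) (f : E3 R -> R[i]) : 0 < al ->
  holder al A f -> A 0 -> forall e, 0 < e -> exists2 d : R, 0 < d &
  forall x, A x -> enorm x <= d -> normc (f x - f 0) <= e.
Proof.
move=> al0 [C HC] A0 e e0; pose C' := `|C| + 1.
have C'0 : 0 < C' by rewrite ltr_wpDl.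
exists ((e / C') `^ (al^-1)); first by rewrite powR_gt0// divr_gt0.
move=> x Ax xd; apply: le_trans (HC x 0 Ax A0) _; rewrite subr0.
have h : enorm x `^ al <= e / C'.
  have := ge0_ler_powR (ltW al0) _ _ xd; rewrite !nnegrE enorm_ge0 powR_ge0.
  move=> /(_ isT isT); rewrite -powRrM mulVf ?gt_eqF// powRr1//.
  by rewrite ltW// divr_gt0.
apply: (@le_trans _ _ (C' * (e / C'))); last by rewrite mulrCA divff ?mulr1// gt_eqF.
have h0 := powR_ge0 (enorm x) al.
apply: (@le_trans _ _ (C' * enorm x `^ al)).
  by apply: ler_wpM2r => //; rewrite (le_trans (ler_norm C))// lerDl.
by apply: ler_wpM2l => //; exact: ltW.
Qed.

Lemma weak_laplacian_ae (O : set (E3 R)) (k : R) (w q q' : E3 R -> R[i]) :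
  measurable (O : set mE3) -> cmeasurable (O : set mE3) w ->
  cmeasurable (O : set mE3) q -> cmeasurable (O : set mE3) q' ->
  {ae leb3, forall x, O x -> q x = q' x} ->
  weak_laplacian O w (fun x => - ((k ^+ 2)%:C * q x * w x)) ->
  weak_laplacian O w (fun x => - ((k ^+ 2)%:C * q' x * w x)).
Proof.
move=> mO mw mq mq' [N [mN N0 qq']] wL phi tphi; rewrite wL//; apply: part_inj => b.
rewrite !part_cintegral.
have mphi : cmeasurable (O : set mE3) (fun x => (phi x)%:C).
  split; last exact: measurable_cst.
  apply: (@measurable_funTS _ _ mE3 _ _ phi); apply: continuous_measurable3.
  exact: smooth_continuous tphi.1.
have mf (p : E3 R -> R[i]) : cmeasurable (O : set mE3) p ->
    measurable_fun (O : set mE3) (fun x => part b (- ((k ^+ 2)%:C * p x * w x) * (phi x)%:C)).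
  move=> mp; apply: (@cmeasurable_part _ _ mE3 O O mO (@subset_refl _ _)).
  apply: cmeasurableM mphi; apply: cmeasurableN; apply: cmeasurableM mw.
  by apply: cmeasurableM => //; exact: cmeasurable_cst.
rewrite /Rintegral; congr fine; apply: ae_eq_integral; [exact: mO| | |].
- by apply/measurable_EFinP; exact: mf.
- by apply/measurable_EFinP; exact: mf.
exists N; split=> // x /= h; apply: qq' => /= h'; apply: h => Ox.
by rewrite h'.
Qed.

(** Setting 1 + V to 0 on a null set turns the essential bound into a bound at every point;
    [weak_laplacian_ae] shows that the equation for w does not notice. *)
Lemma Linf_bounded_version (O : set (E3 R)) (V : E3 R -> R[i]) :
  measurable (O : set mE3) -> Linf leb3 O V ->
  exists (q' : E3 R -> R[i]) (Q : R), [/\ cmeasurable (O : set mE3) q',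
    cmeasurable (O : set mE3) (fun x => 1 + V x),
    {ae leb3, forall x, O x -> 1 + V x = q' x} & forall x, O x -> normc (q' x) <= Q].
Proof.
move=> mO [mV [M [N [mN N0 VM]]]].
have m1V : cmeasurable (O : set mE3) (fun x => 1 + V x).
  have := cmeasurableB (cmeasurable_cst O 1) (cmeasurableN mV).
  by under [X in cmeasurable O X -> _]eq_fun do rewrite opprK.
pose ind x : R := \1_(~` N) x.
have ind1 x : ~ N x -> (ind x)%:C = 1 by move=> nN; rewrite /ind indicE mem_set.
have ind0 x : N x -> (ind x)%:C = 0 by move=> Nx; rewrite /ind indicE memNset.
exists (fun x => (ind x)%:C * (1 + V x)), (1 + `|M|); split=> //.
- apply: cmeasurableM m1V; split; last exact: measurable_cst.
  by apply: measurable_funTS; apply: measurable_indic; exact: measurableC.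
- exists N; split=> // x /= h; apply: contrapT => nN; apply: h => _.
  by rewrite ind1// mul1r.
- move=> x Ox; have [Nx|nN] := pselect (N x).
    by rewrite ind0// mul0r ComplexField.Normc.normc0 addr_ge0.
  rewrite ind1// mul1r; apply: le_trans (le_normcD _ _) _.
  rewrite ComplexField.Normc.normc1 lerD2l; apply: le_trans (ler_norm M).
  by apply: contrapT => h; apply: nN; apply: VM => /= /(_ Ox).
Qed.

End reductions.

Theorem theorem4p3 (R : realType) (Omega Gamma : set (E3 R))
    (k h alpha : R) (V q eta v w : E3 R -> R[i])
    (Omega_lip : lipschitz_domain Omega)
    (Omega_bounded : bounded_set Omega)
    (Omega_compl : connected (~` Omega))
    (Gamma_open : exists2 U : set (E3 R), open U & Gamma = bdry Omega `&` U)
    (k_gt0 : 0 < k)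
    (V_Linf : Linf leb3 Omega V)
    (q_def : q = (fun x => 1 + V x))
    (eta_Linf : Linf surf (bdry Omega) eta)
    (vw_eigen : conductive_transmission_eigenfunctions Omega Gamma k q eta v w)
    (Gamma0 : Gamma 0)
    (h_gt0 : 0 < h)
    (corner : Omega `&` eball h = octant_trunc h)
    (alpha01 : 0 < alpha < 1)
    (v_holder : holder alpha (closure (octant_trunc h)) v)
    (q_H2 : sobolev 2 (octant_trunc h) q)
    (eta_holder : holder alpha (closure (octant_faces h)) eta) :
  eta 0 <> 0 -> v 0 = 0.
Proof.
move=> eta0.
have [U oU GammaE] := Gamma_open.
have [[[sv sw] _] wLw wLv [tv [tw [Nv [Nw [[trv trw] [nv nw] twtv bc]]]]]] := vw_eigen.
have [oO _ _ _] := Omega_lip.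
have mO := open_measurable3 oO.
have [q' [Q [mq' mq qq' q'Q]]] := Linf_bounded_version mO V_Linf.
rewrite -q_def in mq; have {}qq' : {ae leb3, forall x, Omega x -> q x = q' x}.
  by rewrite q_def.
have wLw' := weak_laplacian_ae mO sw.1.1 mq mq' qq' wLw.
have mbd := measurable_bdry_surf Omega.
have mU : measurable (U : set (caratheodory_type (@haus_outer R))).
  exact: measurable_surf (open_measurable3 oU).
have mG : measurable (Gamma : set (caratheodory_type (@haus_outer R))).
  by rewrite GammaE; exact: measurableI.
have [d d0 dU] : exists2 d : R, 0 < d & forall x, (forall i, `|coord i x| < d) -> U x.
  apply: nbhs0_cube; apply: open_nbhs_nbhs; split=> //.
  by have := Gamma0; rewrite GammaE => -[].
have [al0 _] := andP alpha01.
pose kk : R := @face_cst R ord0 / 160.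
have kk0 : 0 < kk by rewrite divr_gt0// face_cst_gt0.
pose A := ComplexField.Normc.normc (v 0) + ComplexField.Normc.normc (eta 0) + 1.
pose K := 2 + \sum_(i < 3) A * (36 * @face_cst R i + 4).
(* K and kk involve only v 0, eta 0 and the face constants, not the box, so e may tend to 0 although
   r shrinks with it. *)
have est b e : 0 < e -> e <= 1 -> `|part b (eta 0 * v 0)| * kk <= K * e.
  move=> e0 e1; have h20 : 0 < h / 4 by rewrite divr_gt0.
  have h4 : 3 * (h / 4) < h by lra.
  have [d1 d10 H1] := holder_small al0 v_holder (closure_octant_trunc0 h20 h4) e0.
  have [d2 d20 H2] := holder_small al0 eta_holder (closure_octant_faces0 h20 h4) e0.
  (* d / 2 keeps the closed cube inside U, h / 4 gives 3 r < h, and the thirds turn coordinate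
     bounds into the Euclidean bounds required by the two Hoelder estimates. *)
  pose r := Num.min (d / 2) (Num.min (h / 4) (Num.min (d1 / 3) (d2 / 3))).
  have r0 : 0 < r by rewrite /r !lt_min !divr_gt0.
  have rd : r <= d / 2 by rewrite /r ge_min lexx.
  have rh' : r <= h / 4 by rewrite /r !ge_min lexx orbT.
  have rd1 : r <= d1 / 3 by rewrite /r !ge_min lexx !orbT.
  have rd2 : r <= d2 / 3 by rewrite /r !ge_min lexx !orbT.
  have rh : 3 * r < h by lra.
  have cube_U x : (forall i, `|coord i x| <= r) -> U x.
    by move=> xr; apply: dU => i; apply: le_lt_trans (xr i) _; lra.
  apply: (corner_bound r0 mO (box_Omega corner rh) (Omega_box corner rh)
    (cube_Gamma GammaE cube_U) mbd mG _ (@face_Gamma _ _ _ _ _ _ corner r0 rh GammaE cube_U)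
    (Gamma_cube_cover corner rh GammaE) sv.1 sw.1 trv trw nv nw wLv wLw' mq' _ twtv bc
    eta_Linf.1 e0 e1).
  - by rewrite GammaE; exact: subIsetl.
  - by move=> x xr; apply: q'Q; exact: (box_Omega corner rh xr).
  - move=> x xr; apply: H1; first by apply: subset_closure; exact: (box_octant_trunc rh xr).
    by apply: le_trans (enorm_cube (box_cube xr)) _; lra.
  - move=> i x xr; apply: H2; first by apply: subset_closure; exact: (face_octant_faces r0 rh xr).
    by apply: le_trans (enorm_cube (face_cube r0 xr)) _; lra.
have K0 : 0 < K.
  rewrite ltr_pwDl// sumr_ge0// => i _; rewrite mulr_ge0 ?addr_ge0 ?normc_nonneg//.
  by rewrite mulr_ge0// ltW// face_cst_gt0.
have part0 b : part b (eta 0 * v 0) = 0.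
  apply/eqP; rewrite -normr_eq0; apply/eqP; apply/le_anti; rewrite normr_ge0 andbT.
  rewrite leNgt; apply/negP => p0.
  set p := `|_| in p0.
  (* For this e the bound K e is at most half of the positive number p kk that it should
     dominate. *)
  pose e := Num.min 1 (p * kk / (2 * K)).
  have pk0 : 0 < p * kk by exact: mulr_gt0.
  have e0 : 0 < e by rewrite lt_min ltr01 divr_gt0// mulr_gt0.
  have := est b e e0; rewrite {1}/e ge_min lexx => /(_ isT).
  rewrite -/p => le; have le2 : K * e <= p * kk / 2.
    apply: (@le_trans _ _ (K * (p * kk / (2 * K)))).
      by apply: ler_wpM2l; [exact: ltW|rewrite /e ge_min lexx orbT].
    by rewrite le_eqVlt; apply/orP; left; apply/eqP; field; rewrite gt_eqF.
  by have := le_trans le le2; lra.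
have /eqP : eta 0 * v 0 = 0 by apply: part_inj => b; rewrite part0; case: b.
by rewrite mulf_eq0 => /orP[/eqP//|/eqP].
Qed.
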